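(* Let $\mathbf{k}=(k_1,k_2,\dots)$ be an infinite sequence of strictly positive integers, let $\mathbf{k}-1=(k_1-1,k_2-1,\dots)$ and let $n\geq0$. Let $\mathcal{A}$ be the subalgebra of $H_{\mathbf{k},n}(q)$ corresponding to the subset of partitions $\{\lambda\in S_{\mathbf{k},n}\mid l(\lambda)=n\}$. Then $\mathcal{A}$ is isomorphic to $H_{\mathbf{k}-1,n}(q)$.
   Context: $q\in\mathbb{C}^{\times}$ with $q^2$ not a non-trivial root of unity ($q^2=1$ allowed). $H_m(q)$ is the $\mathbb{C}$-algebra generated by $\sigma_1,\dots,\sigma_{m-1}$ with relations $\sigma_i^2=(q-q^{-1})\sigma_i+1$, $\sigma_i\sigma_{i+1}\sigma_i=\sigma_{i+1}\sigma_i\sigma_{i+1}$, $\sigma_i\sigma_j=\sigma_j\sigma_i$ if $|i-j|>1$; $\sigma_w$ ($w\in\mathfrak{S}_m$) is its standard basis. $P_m=\bigl(\sum_{w\in\mathfrak{S}_m}q^{\ell(w)}\sigma_w\bigr)/\bigl(\sum_{w\in\mathfrak{S}_m}q^{2\ell(w)}\bigr)$ is the $q$-symmetriser. For a sequence $\mathbf{k}$ of non-negative integers, $P_{\mathbf{k},n}:=P_{k_1}\otimes\dots\otimes P_{k_n}\in H_{k_1}(q)\otimes\dots\otimes H_{k_n}(q)\subset H_{k_1+\dots+k_n}(q)$ (parabolic subalgebra). The fused Hecke algebra $H_{\mathbf{k},n}(q)$ is identified with $P_{\mathbf{k},n}H_{k_1+\dots+k_n}(q)P_{\mathbf{k},n}$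 (unit $P_{\mathbf{k},n}$; in the paper it is defined by diagrams, ''fused braids'', and shown isomorphic to this algebra); $H_{\mathbf{k},0}(q)=\mathbb{C}$. For $\lambda\vdash m$, $V_\lambda$ is the irreducible $H_m(q)$-module indexed by $\lambda$ in the usual way, with $V_{(m)}$ given by $\sigma_i\mapsto q$. $S_{\mathbf{k},n}$ is the set of partitions $\lambda\vdash k_1+\dots+k_n$ with $\lambda\ge\mathbf{k}_{|n}^{\mathrm{ord}}$ in the dominance order, where $\mathbf{k}_{|n}^{\mathrm{ord}}$ is $(k_1,\dots,k_n)$ reordered decreasingly. The modules $W_{\mathbf{k},\lambda}:=P_{\mathbf{k},n}(V_\lambda)$, $\lambda\in S_{\mathbf{k},n}$, form a complete set of pairwise non-isomorphic irreducible modules of the semisimple algebra $H_{\mathbf{k},n}(q)$, so that $H_{\mathbf{k},n}(q)\cong\bigoplus_{\lambda\in S_{\mathbf{k},n}}\mathrm{End}(W_{\mathbf{k},\lambda})$ (Artin–Wedderburn). The subalgebra corresponding to a subset $\Gamma\subset S_{\mathbf{k},n}$ is $\bigoplus_{\lambda\in\Gamma}\mathrm{End}(W_{\mathbf{k},\lambda})$ (with its own unit). $l(\lambda)$ is the number of non-zero parts of $\lambda$. *)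

(* Defs.v *)
From HB Require Import structures.
From mathcomp Require Import all_fingroup.
From mathcomp Require Import all_boot all_order all_algebra.
From mathcomp Require Import boolp classical_sets functions reals complex.

Set Implicit Arguments.
Unset Strict Implicit.
Unset Printing Implicit Defensive.

Import GRing.Theory.

Local Open Scope ring_scope.
Local Open Scope quotient_scope.

(** Conventions: the generators sigma_1, ..., sigma_(m-1) of H_m(q) are indexed
    from 0 by 'I_m.-1, and sequences k = (k_1, k_2, ...) from 0 by nat. *)

Section HeckePresentation.
Variables (F : fieldType) (q : F) (m : nat).

Record hecke_rel (A : algType F) (s : 'I_m.-1 -> A) : Prop := HeckeRel {
  hecke_quad : forall i, s i ^+ 2 = (q - q^-1) *: s i + 1;
  hecke_braid : forall i j : 'I_m.-1, j = i.+1 :> nat ->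
    s i * s j * s i = s j * s i * s j;
  hecke_comm : forall i j : 'I_m.-1, (i.+1 < j)%N -> s i * s j = s j * s i }.

(* Formal non-commutative polynomial expressions in the generators; TScal c
   stands for c times the unit. *)
Inductive hterm : Type :=
| TGen of 'I_m.-1
| TScal of F
| TAdd of hterm & hterm
| TMul of hterm & hterm.

(* The least congruence on expressions containing the axioms of unital
   associative F-algebras and the Hecke relations. *)
Inductive heq : hterm -> hterm -> Prop :=
| heq_refl t : heq t t
| heq_sym s t : heq s t -> heq t s
| heq_trans s t u : heq s t -> heq t u -> heq s u
| heq_add s s' t t' : heq s s' -> heq t t' -> heq (TAdd s t) (TAdd s' t')
| heq_mul s s' t t' : heq s s' -> heq t t' -> heq (TMul s t) (TMul s' t')
| heq_addC s t : heq (TAdd s t) (TAdd t s)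
| heq_addA s t u : heq (TAdd s (TAdd t u)) (TAdd (TAdd s t) u)
| heq_add0 t : heq (TAdd (TScal 0) t) t
| heq_addN t : heq (TAdd (TMul (TScal (-1)) t) t) (TScal 0)
| heq_mulA s t u : heq (TMul s (TMul t u)) (TMul (TMul s t) u)
| heq_mul1 t : heq (TMul (TScal 1) t) t
| heq_mulDl s t u : heq (TMul (TAdd s t) u) (TAdd (TMul s u) (TMul t u))
| heq_mulDr s t u : heq (TMul s (TAdd t u)) (TAdd (TMul s t) (TMul s u))
| heq_scalD a b : heq (TAdd (TScal a) (TScal b)) (TScal (a + b))
| heq_scalM a b : heq (TMul (TScal a) (TScal b)) (TScal (a * b))
| heq_scalC a t : heq (TMul (TScal a) t) (TMul t (TScal a))
| heq_quad i : heq (TMul (TGen i) (TGen i))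
                   (TAdd (TMul (TScal (q - q^-1)) (TGen i)) (TScal 1))
| heq_braid (i j : 'I_m.-1) : j = i.+1 :> nat ->
    heq (TMul (TMul (TGen i) (TGen j)) (TGen i))
        (TMul (TMul (TGen j) (TGen i)) (TGen j))
| heq_comm (i j : 'I_m.-1) : (i.+1 < j)%N ->
    heq (TMul (TGen i) (TGen j)) (TMul (TGen j) (TGen i)).

HB.instance Definition _ := gen_eqMixin hterm.
HB.instance Definition _ := gen_choiceMixin hterm.

Definition heqb (s t : hterm) : bool := `[< heq s t >].

Lemma heqb_refl : reflexive heqb.
Proof. by move=> t; apply/asboolP/heq_refl. Qed.

Lemma heqb_sym : symmetric heqb.
Proof. by move=> s t; apply/asboolP/asboolP => /heq_sym. Qed.

Lemma heqb_trans : transitive heqb.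
Proof.
by move=> t s u /asboolP st /asboolP tu; apply/asboolP; apply: heq_trans tu.
Qed.

Canonical heqb_equiv := EquivRel heqb heqb_refl heqb_sym heqb_trans.

Definition hecke : Type := {eq_quot heqb}.
HB.instance Definition _ := Choice.on hecke.
HB.instance Definition _ := EqQuotient.on hecke.

Definition hclass (t : hterm) : hecke := \pi_{eq_quot heqb} t.

Lemma hclassE s t : heq s t -> hclass s = hclass t.
Proof. by move=> st; apply/eqmodP/asboolP. Qed.

Lemma hclass_inj s t : hclass s = hclass t -> heq s t.
Proof. by move=> /eqmodP /asboolP. Qed.

Lemma hclassK (x : hecke) : hclass (repr x) = x.
Proof. exact: reprK. Qed.

Lemma repr_hclass t : heq (repr (hclass t)) t.
Proof. by apply: hclass_inj; rewrite hclassK. Qed.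

Definition hadd (x y : hecke) := hclass (TAdd (repr x) (repr y)).
Definition hmul (x y : hecke) := hclass (TMul (repr x) (repr y)).
Definition hscal (c : F) := hclass (TScal c).
Definition hopp (x : hecke) := hmul (hscal (-1)) x.

Lemma hclassD s t : hclass (TAdd s t) = hadd (hclass s) (hclass t).
Proof. by apply/hclassE/heq_add; apply/heq_sym/repr_hclass. Qed.

Lemma hclassM s t : hclass (TMul s t) = hmul (hclass s) (hclass t).
Proof. by apply/hclassE/heq_mul; apply/heq_sym/repr_hclass. Qed.

Lemma hecke_ind (P : hecke -> Prop) :
  (forall t, P (hclass t)) -> forall x, P x.
Proof. by move=> Pt x; rewrite -(hclassK x). Qed.

Lemma haddC : commutative hadd.
Proof.
elim/hecke_ind=> s; elim/hecke_ind=> t.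
by rewrite -!hclassD; apply/hclassE/heq_addC.
Qed.

Lemma haddA : associative hadd.
Proof.
elim/hecke_ind=> s; elim/hecke_ind=> t; elim/hecke_ind=> u.
by rewrite -!hclassD; apply/hclassE/heq_addA.
Qed.

Lemma hadd0 : left_id (hscal 0) hadd.
Proof.
by elim/hecke_ind=> s; rewrite -!hclassD; apply/hclassE/heq_add0.
Qed.

Lemma haddN : left_inverse (hscal 0) hopp hadd.
Proof.
by elim/hecke_ind=> s; rewrite /hopp -hclassM -hclassD; apply/hclassE/heq_addN.
Qed.

HB.instance Definition _ := GRing.isZmodule.Build hecke haddA haddC hadd0 haddN.

Lemma hmulA : associative hmul.
Proof.
elim/hecke_ind=> s; elim/hecke_ind=> t; elim/hecke_ind=> u.
by rewrite -!hclassM; apply/hclassE/heq_mulA.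
Qed.

Lemma hmul1 : left_id (hscal 1) hmul.
Proof.
by elim/hecke_ind=> s; rewrite -!hclassM; apply/hclassE/heq_mul1.
Qed.

Lemma hscalC c x : hmul (hscal c) x = hmul x (hscal c).
Proof.
by elim/hecke_ind: x => s; rewrite -!hclassM; apply/hclassE/heq_scalC.
Qed.

Lemma hmul1r : right_id (hscal 1) hmul.
Proof. by move=> x; rewrite -hscalC hmul1. Qed.

Lemma hmulDl : left_distributive hmul hadd.
Proof.
elim/hecke_ind=> s; elim/hecke_ind=> t; elim/hecke_ind=> u.
by rewrite -hclassD -!hclassM -hclassD; apply/hclassE/heq_mulDl.
Qed.

Lemma hmulDr : right_distributive hmul hadd.
Proof.
elim/hecke_ind=> s; elim/hecke_ind=> t; elim/hecke_ind=> u.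
by rewrite -hclassD -!hclassM -hclassD; apply/hclassE/heq_mulDr.
Qed.

Lemma hscalD a b : hscal (a + b) = hadd (hscal a) (hscal b).
Proof. by rewrite -hclassD; apply/hclassE/heq_sym/heq_scalD. Qed.

Lemma hscalM a b : hscal (a * b) = hmul (hscal a) (hscal b).
Proof. by rewrite -hclassM; apply/hclassE/heq_sym/heq_scalM. Qed.

(* Only used to see that 1 != 0 in H_m(q). *)
Fixpoint triv_eval (c : F) (t : hterm) : F :=
  match t with
  | TGen _ => c
  | TScal a => a
  | TAdd s t => triv_eval c s + triv_eval c t
  | TMul s t => triv_eval c s * triv_eval c t
  end.

Lemma triv_evalP c s t : c ^+ 2 = (q - q^-1) * c + 1 -> heq s t ->
  triv_eval c s = triv_eval c t.
Proof.
move=> qc; elim=> {s t} //=.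
- by move=> ? ? ? _ -> _ ->.
- by move=> ? ? ? ? _ -> _ ->.
- by move=> ? ? ? ? _ -> _ ->.
- by move=> *; rewrite addrC.
- by move=> *; rewrite addrA.
- by move=> *; rewrite add0r.
- by move=> *; rewrite mulN1r addNr.
- by move=> *; rewrite mulrA.
- by move=> *; rewrite mul1r.
- by move=> *; rewrite mulrDl.
- by move=> *; rewrite mulrDr.
- by move=> *; rewrite mulrC.
Qed.

Lemma hscal1_neq0 : hscal 1 != hscal 0.
Proof.
apply/eqP => /hclass_inj h.
have [c /triv_evalP/(_ h)/= /eqP] : exists c, c ^+ 2 = (q - q^-1) * c + 1.
  have [->|q0] := eqVneq q 0; first by exists 1; rewrite invr0 subrr mul0r add0r expr1n.
  by exists q; rewrite mulrBl mulVf // subrK expr2.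
by rewrite oner_eq0.
Qed.

HB.instance Definition _ := GRing.Zmodule_isNzRing.Build hecke
  hmulA hmul1 hmul1r hmulDl hmulDr hscal1_neq0.

Definition hscale (c : F) (x : hecke) : hecke := hscal c * x.

Lemma hscaleA a b x : hscale a (hscale b x) = hscale (a * b) x.
Proof. by rewrite /hscale mulrA; congr (_ * _); rewrite hscalM. Qed.

Lemma hscale1 : left_id 1 hscale.
Proof. exact: mul1r. Qed.

Lemma hscaleDr : right_distributive hscale +%R.
Proof. by move=> a x y; rewrite /hscale mulrDr. Qed.

Lemma hscaleDl x : {morph hscale^~ x : a b / a + b}.
Proof. by move=> a b; rewrite /hscale -mulrDl hscalD. Qed.

HB.instance Definition _ := GRing.Zmodule_isLmodule.Build F hecke
  hscaleA hscale1 hscaleDr hscaleDl.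

Lemma hscaleAl a (x y : hecke) : a *: (x * y) = (a *: x) * y.
Proof. exact: mulrA. Qed.

HB.instance Definition _ := GRing.Lmodule_isLalgebra.Build F hecke hscaleAl.

Lemma hscaleAr a (x y : hecke) : a *: (x * y) = x * (a *: y).
Proof.
rewrite [LHS]mulrA [RHS]mulrA; congr (_ * _); exact: hscalC.
Qed.

HB.instance Definition _ := GRing.Lalgebra_isAlgebra.Build F hecke hscaleAr.

Definition sigma (i : 'I_m.-1) : hecke := hclass (TGen i).

Lemma sigma_rel : hecke_rel sigma.
Proof.
split=> [i|i j ij|i j ij].
- by rewrite expr2 -[LHS]hclassM (hclassE (heq_quad i)) hclassD hclassM.
- by have := hclassE (heq_braid ij); rewrite !hclassM.
- by have := hclassE (heq_comm ij); rewrite !hclassM.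
Qed.

(** Evaluation of elements of H_m(q): in an algebra A at images s i of the
    generators, and on a module V where sigma_i acts by the operator r i.
    These are defined on a chosen expression of x, and are independent of this
    choice, hence morphisms, as soon as the Hecke relations hold (hecke_liftP
    and hecke_actP). *)

Fixpoint term_lift (A : algType F) (s : 'I_m.-1 -> A) (t : hterm) : A :=
  match t with
  | TGen i => s i
  | TScal c => c *: 1
  | TAdd t u => term_lift s t + term_lift s u
  | TMul t u => term_lift s t * term_lift s u
  end.

Definition hecke_lift (A : algType F) (s : 'I_m.-1 -> A) (x : hecke) : A :=
  term_lift s (repr x).

Fixpoint term_act (V : lmodType F) (r : 'I_m.-1 -> V -> V) (t : hterm) (v : V)
    : V :=
  match t with
  | TGen i => r i v
  | TScal c => c *: v
  | TAdd t u => term_act r t v + term_act r u v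
  | TMul t u => term_act r t (term_act r u v)
  end.

Definition hecke_act (V : lmodType F) (r : 'I_m.-1 -> V -> V) (x : hecke)
  : V -> V := term_act r (repr x).

Section Lift.
Variables (A : algType F) (s : 'I_m.-1 -> A).
Hypothesis srel : hecke_rel s.

Lemma term_lift_heq t u : heq t u -> term_lift s t = term_lift s u.
Proof.
elim=> {t u} //=.
- by move=> ? ? ? _ -> _ ->.
- by move=> ? ? ? ? _ -> _ ->.
- by move=> ? ? ? ? _ -> _ ->.
- by move=> *; rewrite addrC.
- by move=> *; rewrite addrA.
- by move=> *; rewrite scale0r add0r.
- by move=> *; rewrite scaleN1r mulN1r addNr scale0r.
- by move=> *; rewrite mulrA.
- by move=> *; rewrite scale1r mul1r.
- by move=> *; rewrite mulrDl.
- by move=> *; rewrite mulrDr.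
- by move=> *; rewrite scalerDl.
- by move=> *; rewrite -scalerAl mul1r scalerA.
- by move=> *; rewrite -scalerAl -scalerAr mul1r mulr1.
- by move=> i; rewrite -expr2 (hecke_quad srel) -scalerAl mul1r scale1r.
- by move=> i j; exact: hecke_braid.
- by move=> i j; exact: hecke_comm.
Qed.

Lemma hecke_lift_class t : hecke_lift s (hclass t) = term_lift s t.
Proof. exact/term_lift_heq/repr_hclass. Qed.

Lemma hecke_liftP :
  [/\ forall i, hecke_lift s (sigma i) = s i,
      hecke_lift s 1 = 1,
      {morph hecke_lift s : x y / x + y},
      {morph hecke_lift s : x y / x * y} &
      forall c, {morph hecke_lift s : x / c *: x}].
Proof.
have M : {morph hecke_lift s : x y / x * y}.
  elim/hecke_ind=> t; elim/hecke_ind=> u.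
  by rewrite -[_ * _]hclassM !hecke_lift_class.
split=> // [i||x y|c x].
- by rewrite hecke_lift_class.
- by rewrite [LHS]hecke_lift_class /= scale1r.
- elim/hecke_ind: x => t; elim/hecke_ind: y => u.
  by rewrite -[_ + _]hclassD !hecke_lift_class.
- by rewrite [c *: x]/GRing.scale /= /hscale M hecke_lift_class /= -scalerAl mul1r.
Qed.

End Lift.

Section Act.
Variables (V : lmodType F) (r : 'I_m.-1 -> {linear V -> V}).
Hypothesis rquad : forall i v, r i (r i v) = (q - q^-1) *: r i v + v.
Hypothesis rbraid : forall i j : 'I_m.-1, j = i.+1 :> nat ->
  forall v, r i (r j (r i v)) = r j (r i (r j v)).
Hypothesis rcomm : forall i j : 'I_m.-1, (i.+1 < j)%N ->
  forall v, r i (r j v) = r j (r i v).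

Lemma term_act_linear t : linear (term_act r t).
Proof.
elim: t => [i|c|t IHt u IHu|t IHt u IHu] a x y /=.
- exact: linearP.
- by rewrite scalerDr !scalerA mulrC.
- by rewrite IHt IHu scalerDr addrACA.
- by rewrite IHu IHt.
Qed.

Lemma term_act_heq t u : heq t u -> term_act r t =1 term_act r u.
Proof.
elim=> {t u} //=.
- by move=> s t _ IH v; rewrite IH.
- by move=> s t u _ IH _ IH' v; rewrite IH IH'.
- by move=> s s' t t' _ IH _ IH' v; rewrite IH IH'.
- by move=> s s' t t' _ IH _ IH' v; rewrite IH IH'.
- by move=> s t v; rewrite addrC.
- by move=> s t u v; rewrite addrA.
- by move=> t v; rewrite scale0r add0r.
- by move=> t v; rewrite scaleN1r addNr scale0r.
- by move=> t v; rewrite scale1r.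
- move=> s t u v.
  by have := term_act_linear s 1 (term_act r t v) (term_act r u v); rewrite !scale1r.
- by move=> c d v; rewrite scalerDl.
- by move=> c d v; rewrite scalerA.
- move=> a t v.
  have t0 : term_act r t 0 = 0.
    have := term_act_linear t (-1) 0 0.
    by rewrite scaler0 addr0 scaleN1r addNr.
  by have := term_act_linear t a v 0; rewrite t0 !addr0.
- by move=> i v; rewrite rquad scale1r.
Qed.

Lemma hecke_act_class t : hecke_act r (hclass t) =1 term_act r t.
Proof. exact/term_act_heq/repr_hclass. Qed.

Lemma hecke_actP :
  [/\ forall i, hecke_act r (sigma i) =1 r i,
      forall v, hecke_act r 1 v = v,
      forall x y v, hecke_act r (x + y) v = hecke_act r x v + hecke_act r y v,
      forall x y v, hecke_act r (x * y) v = hecke_act r x (hecke_act r y v) &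
      forall c x v, hecke_act r (c *: x) v = c *: hecke_act r x v].
Proof.
have M x y v : hecke_act r (x * y) v = hecke_act r x (hecke_act r y v).
  elim/hecke_ind: x => t; elim/hecke_ind: y => u.
  by rewrite -[_ * _]hclassM !hecke_act_class.
split=> // [i|v|x y v|c x v].
- exact: hecke_act_class.
- by rewrite [LHS]hecke_act_class /= scale1r.
- elim/hecke_ind: x => t; elim/hecke_ind: y => u.
  by rewrite -[_ + _]hclassD !hecke_act_class.
- by rewrite [c *: x]/GRing.scale /= /hscale M hecke_act_class.
Qed.

End Act.

End HeckePresentation.

Arguments sigma {F q m} i.
Arguments hecke_lift {F q m A} s x.
Arguments hecke_act {F q m V} r x v.

Section Symmetriser.
Variables (F : fieldType) (q : F) (m : nat).

Lemma gen_hi_subproof (i : 'I_m.-1) : (i.+1 < m)%N.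
Proof. by rewrite -ltn_predRL. Qed.

Definition gen_lo (i : 'I_m.-1) : 'I_m := widen_ord (leq_pred m) i.
Definition gen_hi (i : 'I_m.-1) : 'I_m := Ordinal (gen_hi_subproof i).

Definition simple_tperm (i : 'I_m.-1) : 'S_m := tperm (gen_lo i) (gen_hi i).

Definition perm_length (w : 'S_m) : nat :=
  #|[set ij : 'I_m * 'I_m | (ij.1 < ij.2)%N && (w ij.2 < w ij.1)%N]|.

Definition reduced_word (w : 'S_m) (s : seq 'I_m.-1) : bool :=
  ((\prod_(i <- s) simple_tperm i)%g == w) && (size s == perm_length w).

(* By Matsumoto's theorem the choice of the reduced word is immaterial; the
   default value is never reached. *)
Definition sigma_perm (w : 'S_m) : hecke q m :=
  if [pick s : (perm_length w).-tuple 'I_m.-1 | reduced_word w s] is Some s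
  then \prod_(i <- s) sigma i else 1.

Definition qsym : hecke q m :=
  (\sum_(w : 'S_m) q ^+ (2 * perm_length w)%N)^-1 *:
    \sum_(w : 'S_m) q ^+ perm_length w *: sigma_perm w.

End Symmetriser.

Arguments qsym {F} q m.

Section Fused.
Variables (F : fieldType) (q : F).

Lemma shift_gen_subproof a p m (ap : (a + p <= m)%N) (j : 'I_p.-1) :
  (a + j < m.-1)%N.
Proof.
rewrite ltn_predRL -addnS; apply: leq_trans ap.
by rewrite -addnS leq_add2l; exact: (gen_hi_subproof j).
Qed.

Definition shift_gen a p m (ap : (a + p <= m)%N) (j : 'I_p.-1) : 'I_m.-1 :=
  Ordinal (shift_gen_subproof ap j).

Lemma shift_gen_rel a p m (ap : (a + p <= m)%N) :
  hecke_rel q (fun j => sigma (shift_gen ap j) : hecke q m).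
Proof.
have [Q B C] := sigma_rel q m.
split=> [i|i j ij|i j ij]; [exact: Q | apply: B | apply: C] => /=.
  by rewrite ij addnS.
by rewrite -addnS ltn_add2l.
Qed.

(* The embedding H_p(q) -> H_m(q), sigma_j |-> sigma_(a+j). *)
Definition parabolic a p m (ap : (a + p <= m)%N) : hecke q p -> hecke q m :=
  hecke_lift (fun j => sigma (shift_gen ap j)).

Variables (k : nat -> nat) (n : nat).

Definition fused_size : nat := \sum_(i < n) k i.

Lemma block_subproof (i : 'I_n) : (\sum_(j < i) k j + k i <= fused_size)%N.
Proof.
rewrite /fused_size -(big_mkord xpredT k) -(big_mkord xpredT k) -big_nat_recr //=.
by rewrite [leqRHS](big_cat_nat (n := i.+1)) ?ltn_ord //= leq_addr.
Qed.

(* The image of P_(k_1) (x) ... (x) P_(k_n) in H_(k_1+...+k_n)(q). *)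
Definition fusedP : hecke q fused_size :=
  \prod_(i < n) parabolic (block_subproof i) (qsym q (k i)).

Definition fused : set (hecke q fused_size) :=
  [set fusedP * x * fusedP | x in [set: hecke q fused_size]]%classic.

End Fused.

Arguments fused {F} q k n _ .

(* Parts are non-zero, so that l(la) is size la. *)
Definition is_partition (m : nat) (la : seq nat) : bool :=
  [&& sorted geq la, 0%N \notin la & sumn la == m].

Definition dominates (la mu : seq nat) : Prop :=
  forall i, (sumn (take i mu) <= sumn (take i la))%N.

Definition fused_parts (k : nat -> nat) (n : nat) : set (seq nat) :=
  [set la | is_partition (fused_size k n) la /\
            dominates la (sort geq (mkseq k n))]%classic.

Section Seminormal.
Variables (F : fieldType) (q : F) (m : nat) (la : seq nat).

(* A filling sends an entry to its box (row, column), both counted from 0. *)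
Definition filling := {ffun 'I_m -> 'I_m * 'I_m}.

Definition is_stdtab (T : filling) : bool :=
  [&& injectiveb T,
      [forall x, (T x).2 < nth 0 la (T x).1]%N,
      [forall x, forall y,
        ((T x).1 == (T y).1) && ((T x).2 < (T y).2)%N ==> (x < y)%N] &
      [forall x, forall y,
        ((T x).2 == (T y).2) && ((T x).1 < (T y).1)%N ==> (x < y)%N]].

(* When la is a partition of m, these are the bijections from the entries to
   the boxes of la that increase along rows and columns. *)
Definition stdtab := {T : filling | is_stdtab T}.

Definition content (T : filling) (x : 'I_m) : int :=
  ((T x).2 : nat)%:Z - ((T x).1 : nat)%:Z.

Definition swap_tab (T : filling) (i : 'I_m.-1) : filling :=
  [ffun x => T (simple_tperm i x)].

(* [d]_q = (q^d - q^-d) / (q - q^-1), in a form valid for q^2 = 1 as well. *)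
Definition qint (d : int) : F :=
  (sgz d)%:~R * \sum_(j < `|d|%N) q ^ (`|d|%N%:Z - 1 - 2 * j%:Z).

Definition Vla := {ffun stdtab -> F^o}.

(* The basis vector attached to T, read as 0 when T is not standard. *)
Definition vtab (T : filling) : Vla := [ffun U => (val U == T)%:R].

Definition axial (T : filling) (i : 'I_m.-1) : F :=
  let d := content T (gen_hi i) - content T (gen_lo i) in q ^ d / qint d.

(* Young's seminormal form (Hoefsmit): with a := q^d / [d]_q, where d is the
   content of i+1 minus that of i in T, sigma_i acts by
   v_T |-> a v_T + (q^-1 + a) v_(s_i T). These operators satisfy the Hecke
   relations as soon as q != 0 and [d]_q != 0 for 0 < d < m, and for la = (m)
   they give sigma_i |-> q. *)
Definition seminormal (i : 'I_m.-1) (v : Vla) : Vla :=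
  \sum_(U : stdtab) v U *:
    (axial (val U) i *: vtab (val U)
     + (q^-1 + axial (val U) i) *: vtab (swap_tab (val U) i)).

Definition Vact (x : hecke q m) (v : Vla) : Vla := hecke_act seminormal x v.

End Seminormal.

Arguments Vla F m la : clear implicits.

Arguments Vact {F q m la} x v.

Section FusedModules.
Variables (F : fieldType) (q : F) (k : nat -> nat) (n : nat).

Definition Wla (la : seq nat) : set (Vla F (fused_size k n) la) :=
  range (Vact (la := la) (fusedP q k n)).

Arguments Wla la _ : clear implicits.

(* The subalgebra of H_(k,n)(q) corresponding to Gamma: the elements whose
   component in End(W_la) is zero for every la in S_(k,n) outside Gamma. *)
Definition fused_block (Gamma : set (seq nat)) : set (hecke q (fused_size k n)) :=
  [set x | fused q k n x /\
     forall la, fused_parts k n la -> ~ Gamma la ->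
       forall w, Wla la w -> Vact x w = 0]%classic.

End FusedModules.

Arguments fused_block {F} q k n Gamma _.

(* A and B stand for subspaces closed under product, whose units need not be
   those of the ambient algebras. *)
Definition unit_of (F : fieldType) (E : algType F) (A : set E) (e : E) : Prop :=
  A e /\ forall x, A x -> e * x = x /\ x * e = x.

Definition subalg_iso (F : fieldType) (E E' : algType F) (A : set E) (B : set E')
    : Prop :=
  exists f : E -> E',
    [/\ set_bij A B f,
        forall x y, A x -> A y -> f (x + y) = f x + f y,
        forall c x, A x -> f (c *: x) = c *: f x,
        forall x y, A x -> A y -> f (x * y) = f x * f y &
        exists e, unit_of A e /\ unit_of B (f e)].

(* Main.v *)
Require Import Defs.
From HB Require Import structures.
From mathcomp Require Import boolp classical_sets functions reals complex.
From mathcomp Require Import all_fingroup.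
From mathcomp Require Import all_boot all_order all_algebra.
From mathcomp Require Import zify ring.

(** The proof compares two algebras of block matrices.

    Hoefsmit's seminormal operators send a function v on fillings to
    q v(s_i T) + a (v(T) - v(s_i T)), where a = q^d / [d]_q depends on the axial
    distance d. In this form all the V_la live together on the functions on
    standard fillings (tab_op), where they satisfy the Hecke relations
    (tab_op_quad, tab_op_braid, tab_op_comm). The additive Jucys-Murphy elements
    act diagonally and separate standard fillings, so H_m(q) realises every matrix
    that respects shapes (realise_matrix). It is spanned by m! elements
    (hecke_spanned), while m! is also the number of pairs of standard tableaux of
    one shape, because Young's lattice is differential (card_same_shape). Hence
    H_m(q) is the product of the End(V_la) (tab_act_inj).

    The same operators with a in {kappa, 0} define the regular module; there the
    q-symmetriser is a constant function. This gives sigma_i P_m = q P_m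
    (sigma_qsym), and the normalisation of P_m is shown to be invertible by
    evaluating it on the one-row module (poincare_neq0). So the product e of the
    parabolic symmetrisers projects onto the vectors on which the generators inside
    the blocks act by q. The normalisation of the operators makes these vectors
    explicit: they are constant under exchanges inside a block, and vanish if a
    column contains two entries of a block. They have a basis indexed by the
    semistandard tableaux of content k, encoded here by their standardisations
    (canonical_tab, class_vector). Therefore e H e is the algebra of matrices
    indexed by these tableaux that respect shapes (entry_inj, entry_surj), and the
    subalgebra attached to a set of shapes consists of the matrices supported on
    tableaux of these shapes (corner_model, fused_blockE).

    Finally, if a semistandard tableau of content k has n rows, then its first
    column contains each of 1, ..., n once. Deleting it is a bijection onto the
    semistandard tableaux of content k - 1, compatible with equality of shapes
    (delete_canonical, add_canonical, delete_boxes). It transports one matrix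
    algebra to the other (matrix_model_iso). *)

Set Implicit Arguments.
Unset Strict Implicit.
Unset Printing Implicit Defensive.

Import GRing.Theory.

Local Open Scope ring_scope.

(** * Quantum integers *)

Section QIntegers.
Variables (F : fieldType) (q : F).
Hypothesis q0 : q != 0.

Definition kappa : F := q - q^-1.

(** This is (q^(2x) - 1) / (q - q^-1), in a form that makes sense for q^2 = 1; it is
    the eigenvalue of a Jucys-Murphy element at an entry of content x. *)
Definition gam (x : int) : F := q ^ x * qint q x.

Definition gamn (n : nat) : F := \sum_(j < n) q ^+ (2 * j).+1.

Lemma gam_nat n : gam n%:Z = gamn n.
Proof.
rewrite /gam /qint; case: n => [|n]; first by rewrite sgz0 mul0r mulr0 /gamn big_ord0.
rewrite gtr0_sgz // mulrA mulr1z mulr1 mulr_sumr (reindex_inj rev_ord_inj) /=.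
apply: eq_bigr => j _; rewrite -expfzDr // exprnP; congr (q ^ _).
by have := ltn_ord j; rewrite subSS; lia.
Qed.

Lemma gamnSl n : gamn n.+1 = q + q ^+ 2 * gamn n.
Proof.
rewrite /gamn big_ord_recl mulr_sumr expr1; congr (_ + _).
by apply: eq_bigr => j _; rewrite -exprD; congr (_ ^+ _); rewrite lift0; lia.
Qed.

Lemma kappa_gamn n : 1 + kappa * gamn n = q ^+ (2 * n).
Proof.
elim: n => [|n IH]; first by rewrite /gamn big_ord0 mulr0 addr0.
have -> : (2 * n.+1 = 2 * n + 2)%N by lia.
rewrite gamnSl exprD -IH /kappa; field; exact: q0.
Qed.

Lemma gam_opp n : gam (- n%:Z) = - q ^- (2 * n) * gamn n.
Proof.
rewrite -gam_nat /gam /qint sgzN abszN mulrNz !mulNr mulrN; congr (- _).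
rewrite [RHS]mulrA; congr (_ * _).
by rewrite exprnP invr_expz -expfzDr //; congr (q ^ _); lia.
Qed.

Lemma kappa_gam x : 1 + kappa * gam x = q ^ (2 * x).
Proof.
case: (intP x) => [|n|n]; first by rewrite gam_nat kappa_gamn.
  by rewrite gam_nat kappa_gamn.
rewrite gam_opp; have := kappa_gamn n.+1.
have -> : q ^ (2 * - n.+1%:Z) = (q ^+ (2 * n.+1))^-1.
  by rewrite exprnP invr_expz; congr (q ^ _); lia.
move=> <-; set g := gamn _; have : 1 + kappa * g != 0.
  by rewrite kappa_gamn expf_neq0.
by move=> h; field.
Qed.

Lemma gam0 : gam 0 = 0.
Proof. by rewrite (gam_nat 0) /gamn big_ord0. Qed.

Lemma gam1 : gam 1 = q.
Proof. by rewrite (gam_nat 1) /gamn big_ord1. Qed.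

Lemma gamD1 x : gam (x + 1) = q + q ^+ 2 * gam x.
Proof.
case: (intP x) => [|n|n]; first by rewrite add0r gam1 gam0 mulr0 addr0.
  by rewrite -PoszD addn1 !gam_nat gamnSl.
have -> : - n.+1%:Z + 1 = - n%:Z by lia.
rewrite !gam_opp gamnSl.
have -> : (2 * n.+1 = 2 * n + 2)%N by lia.
rewrite exprD; have := expf_neq0 (2 * n) q0; rewrite -kappa_gamn.
move: (gamn n) => g; rewrite /kappa => Q0; field.
by rewrite q0; apply: contra_neq Q0 => Q0; rewrite -[RHS](mulr0 q^-1) -Q0; field.
Qed.

Lemma gamD x y : gam (x + y) = gam x + gam y + kappa * gam x * gam y.
Proof.
have K z : q ^+ 2 * z = z + kappa * q * z by rewrite /kappa; field.
elim/int_rec: y => [|n IH|n IH]; first by rewrite addr0 gam0 mulr0 !addr0.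
  rewrite -addn1 PoszD addrA !gamD1 IH !K; ring.
have e z : gam (z - 1) = (gam z - q) / q ^+ 2.
  by rewrite -[in gam z](subrK 1 z) gamD1; field.
have -> : - n.+1%:Z = - n%:Z - 1 by lia.
by rewrite addrA !e IH /kappa; field.
Qed.

Lemma kappa_gam_neq0 x : 1 + kappa * gam x != 0.
Proof. by rewrite kappa_gam expfz_neq0. Qed.

Hypothesis qint_neq0 : forall n, (0 < n)%N -> qint q n%:Z != 0.

Lemma gam_neq0 x : x != 0 -> gam x != 0.
Proof.
have pos n : gamn n.+1 != 0.
  by rewrite -gam_nat mulf_neq0 ?qint_neq0 ?expfz_neq0.
case: (intP x) => [|n|n] // _; rewrite ?gam_nat // gam_opp.
by rewrite mulf_neq0 // oppr_eq0 invr_neq0 // expf_neq0.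
Qed.

Lemma gam_inj : injective gam.
Proof.
move=> x y xy; apply/eqP; rewrite -subr_eq0; apply/contraT => /gam_neq0.
have := gamD y (x - y); rewrite addrC subrK xy -addrA.
rewrite -[LHS]addr0 => /addrI /esym; rewrite -{1}[gam (x - y)]mul1r -mulrDl.
by move/eqP; rewrite mulf_eq0 (negbTE (kappa_gam_neq0 _)) => /= ->.
Qed.

(** The coefficient q^x / [x]_q of the seminormal form (acoefE). Written in terms of
    gam, its identities become consequences of the addition formula gamD. *)
Definition acoef (x : int) : F := kappa + (gam x)^-1.

Lemma acoefE x : x != 0 -> q ^ x / qint q x = acoef x.
Proof.
move=> /gam_neq0 gx; have: gam x != 0 by [].
rewrite {1}/gam mulf_eq0 negb_or => /andP[qx ix].
have <- : (1 + kappa * gam x) / gam x = acoef x by rewrite /acoef; field.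
rewrite kappa_gam; have -> : 2 * x = x + x by lia.
by rewrite expfzDr // /gam; field; rewrite ?qx ?ix.
Qed.

Lemma acoefN x : x != 0 -> acoef (- x) = kappa - acoef x.
Proof.
move=> x0; have gx := gam_neq0 x0; have gN : gam (- x) != 0.
  by apply: gam_neq0; rewrite oppr_eq0.
have := gamD x (- x); rewrite subrr gam0 /acoef => /esym e.
have -> : kappa = - (gam x + gam (- x)) / (gam x * gam (- x)).
  by apply/(canRL (mulfK _)); [rewrite mulf_neq0 | rewrite -[RHS]addr0 -e; ring].
by field; rewrite gx.
Qed.

(** The cocycle identity behind the braid relation, an addition formula of
    cotangent type. *)
Lemma acoefD x y : x != 0 -> y != 0 -> x + y != 0 ->
  acoef (x + y) * (acoef x + acoef y - kappa) = acoef x * acoef y.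
Proof.
move=> /gam_neq0 gx /gam_neq0 gy /gam_neq0; rewrite /acoef gamD => gxy.
by field; rewrite gx gy.
Qed.

Lemma acoef1 : acoef 1 = q.
Proof. by rewrite /acoef gam1 /kappa subrK. Qed.

Lemma acoef_neq_q x : x != 0 -> x != 1 -> q - acoef x != 0.
Proof.
move=> /gam_neq0 gx; apply: contra_neq => /subr0_eq; rewrite -[in LHS]acoef1.
rewrite /acoef => /addrI /invr_inj /gam_inj; exact: esym.
Qed.

(** The recursion satisfied by the eigenvalues of the Jucys-Murphy elements on
    two consecutive contents. *)
Lemma acoef_gam x y : x != y ->
  acoef (y - x) * (gam x - gam y) + kappa * gam y + 1 = 0.
Proof.
move=> xy; have d0 : y - x != 0 by rewrite subr_eq0 eq_sym.
have gd := gam_neq0 d0; rewrite /acoef.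
have -> : gam y = gam x + gam (y - x) + kappa * gam x * gam (y - x).
  by rewrite -gamD; congr gam; ring.
by field.
Qed.

End QIntegers.

(** * Standard fillings and simple transpositions *)

Section DemazureLusztig.
Variables (F : fieldType) (q : F).
Hypothesis q0 : q != 0.

(** The value at a point of the Demazure-Lusztig operator q s + a (1 - s), for a
    function with value v at the point and v' at its image by s. *)
Definition dl (a v v' : F) : F := a * v + (q - a) * v'.

Lemma dl_quad a v v' :
  dl a (dl a v v') (dl (kappa q - a) v' v) = kappa q * dl a v v' + v.
Proof. by rewrite /dl /kappa; field. Qed.

Lemma dl_braid a b c v123 v213 v132 v231 v312 v321 :
  c * (a + b - kappa q) = a * b ->
  dl a (dl b (dl a v123 v213) (dl c v132 v312))
       (dl c (dl (kappa q - a) v213 v123) (dl b v231 v321)) =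
  dl b (dl a (dl b v123 v132) (dl c v213 v231))
       (dl c (dl (kappa q - b) v132 v123) (dl a v312 v321)).
Proof.
move=> e; apply/eqP; rewrite -subr_eq0; apply/eqP.
(* The difference of the two sides is the defect of e times a linear form. *)
rewrite -[RHS](mul0r ((a - b) * v123 + (q - a) * v213 - (q - b) * v132)).
have <- : a * b - c * (a + b - kappa q) = 0 by rewrite e subrr.
by rewrite /dl /kappa; field.
Qed.

Lemma dl_comm a b v v1 v2 v12 :
  dl a (dl b v v2) (dl b v1 v12) = dl b (dl a v v1) (dl a v2 v12).
Proof. by rewrite /dl; ring. Qed.

Lemma dl_fixed a v v' : q - a != 0 -> dl a v v' = q * v -> v' = v.
Proof.
move=> qa e; apply/eqP; rewrite -subr_eq0; apply/eqP/(mulfI qa).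
by rewrite mulr0 -(subrr (q * v)) -{1}e /dl; ring.
Qed.

End DemazureLusztig.

Section SimpleTranspositions.
Variable m : nat.
Implicit Types i j : 'I_m.-1.

Lemma gen_lo_hi i : gen_lo i != gen_hi i.
Proof. by rewrite -val_eqE /= ltn_eqF. Qed.

Lemma gen_lo_next i j : j = i.+1 :> nat -> gen_lo j = gen_hi i.
Proof. by move=> ij; apply: val_inj. Qed.

Lemma simple_tperm_braid i j : j = i.+1 :> nat ->
  (simple_tperm i * simple_tperm j * simple_tperm i =
   simple_tperm j * simple_tperm i * simple_tperm j)%g.
Proof.
move=> ij; rewrite /simple_tperm (gen_lo_next ij).
set a := gen_lo i; set b := gen_hi i; set c := gen_hi j.
have ac : a != c by rewrite -val_eqE /= ij; lia.
have ab : a != b by exact: gen_lo_hi.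
have bc : b != c by rewrite -val_eqE /= ij; lia.
have -> : (tperm a b * tperm b c * tperm a b)%g = (tperm b c ^ tperm a b)%g.
  by rewrite conjgE tpermV mulgA.
have -> : (tperm b c * tperm a b * tperm b c)%g = (tperm a b ^ tperm b c)%g.
  by rewrite conjgE tpermV mulgA.
by rewrite !tpermJ tpermL tpermR !tpermD // eq_sym.
Qed.

Lemma simple_tperm_comm i j : (i.+1 < j)%N ->
  (simple_tperm i * simple_tperm j = simple_tperm j * simple_tperm i)%g.
Proof.
move=> ij; rewrite conjgC; congr (_ * _)%g.
by rewrite /simple_tperm tpermJ !tpermD // -val_eqE /=; lia.
Qed.

Lemma simple_tpermK i : involutive (simple_tperm i).
Proof. exact: tpermK. Qed.

Lemma simple_tperm_lo i : simple_tperm i (gen_lo i) = gen_hi i.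
Proof. exact: tpermL. Qed.

Lemma simple_tperm_hi i : simple_tperm i (gen_hi i) = gen_lo i.
Proof. exact: tpermR. Qed.

Lemma simple_tperm_lt i (x y : 'I_m) : (x < y)%N ->
  (simple_tperm i y <= simple_tperm i x)%N -> x = gen_lo i /\ y = gen_hi i.
Proof.
rewrite /simple_tperm; case: tpermP => [->|->|/eqP h1 /eqP h2];
  case: tpermP => [->|->|/eqP h3 /eqP h4] //=; try by lia.
- by move: h3 h4; rewrite -!val_eqE /=; lia.
- by move: h1 h2; rewrite -!val_eqE /=; lia.
Qed.

End SimpleTranspositions.

Section StandardFillings.
Variable m : nat.
Implicit Types (T U : filling m) (i j : 'I_m.-1) (x y : 'I_m) (p : 'I_m * 'I_m).

Definition le_box (p r : 'I_m * 'I_m) := (p.1 <= r.1)%N && (p.2 <= r.2)%N.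

(** A description of standard fillings that does not refer to a shape; for a
    partition la it amounts to is_stdtab la once the set of boxes is the diagram of la
    (stdtabE). *)
Definition standard T : bool :=
  injectiveb T && [forall x, forall p, le_box p (T x) ==>
    [exists y : 'I_m, (y <= x)%N && (T y == p)]].

Lemma standardP T : reflect
  (injective T /\ forall x p, le_box p (T x) -> exists2 y : 'I_m, (y <= x)%N & T y = p)
  (standard T).
Proof.
apply: (iffP andP) => [[/injectiveP Ti /forallP h]|[Ti h]]; split=> //.
- move=> x p xp; move: (h x) => /forallP/(_ p); rewrite xp => /existsP[y].
  by case/andP=> yx /eqP yp; exists y.
- exact/injectiveP.
apply/forallP=> x; apply/forallP=> p; apply/implyP => /h[y yx yp].
by apply/existsP; exists y; rewrite yx yp eqxx.
Qed.

Lemma standard_inj T : standard T -> injective T.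
Proof. by case/standardP. Qed.

Lemma standard_le T x y : standard T -> le_box (T x) (T y) -> (x <= y)%N.
Proof. by case/standardP=> Ti h /h[z zy /Ti <-]. Qed.

Lemma swap_tabE T i x : swap_tab T i x = T (simple_tperm i x).
Proof. by rewrite ffunE. Qed.

Lemma swap_tabK i : involutive ((@swap_tab m)^~ i).
Proof. by move=> T; apply/ffunP=> x; rewrite !ffunE simple_tpermK. Qed.

Lemma swap_tab_braid i j T : j = i.+1 :> nat ->
  swap_tab (swap_tab (swap_tab T i) j) i = swap_tab (swap_tab (swap_tab T j) i) j.
Proof.
move=> ij; apply/ffunP => x; rewrite !ffunE.
by have /perm.permP/(_ x) := simple_tperm_braid ij; rewrite !permM => ->.
Qed.

Lemma swap_tab_comm i j T : (i.+1 < j)%N ->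
  swap_tab (swap_tab T i) j = swap_tab (swap_tab T j) i.
Proof.
move=> ij; apply/ffunP => x; rewrite !ffunE.
by have /perm.permP/(_ x) := simple_tperm_comm ij; rewrite !permM => ->.
Qed.

Lemma standard_swap T i : standard T ->
  ~~ le_box (T (gen_lo i)) (T (gen_hi i)) -> standard (swap_tab T i).
Proof.
move=> /standardP[Ti h] inc; apply/standardP; split=> [x y|x p].
  by rewrite !ffunE => /Ti/perm_inj.
rewrite !ffunE => xp; have [y yx yp] := h _ _ xp.
exists (simple_tperm i y); last by rewrite ffunE simple_tpermK.
rewrite leqNgt; apply/negP=> lt.
have := simple_tperm_lt (i := i) lt; rewrite simple_tpermK => /(_ yx) [e1 e2].
move: xp inc; rewrite -yp e1 simple_tperm_lo.
by rewrite -(simple_tpermK i y) e2 simple_tperm_hi => ->.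
Qed.

Lemma standard_swapN T i : standard T ->
  le_box (T (gen_lo i)) (T (gen_hi i)) -> ~~ standard (swap_tab T i).
Proof.
move=> Ts le; apply/negP => sT.
have := @standard_le _ (gen_hi i) (gen_lo i) sT.
by rewrite !swap_tabE simple_tperm_lo simple_tperm_hi le => /(_ isT) /=; lia.
Qed.

Lemma standard_swapE T i : standard T ->
  standard (swap_tab T i) = ~~ le_box (T (gen_lo i)) (T (gen_hi i)).
Proof.
move=> Ts; case: (boolP (le_box _ _)) => h; last by rewrite standard_swap.
exact/negbTE/standard_swapN.
Qed.

Definition hook_next (p r : 'I_m * 'I_m) :=
  (r.1 == p.1 :> nat) && (r.2 == p.2.+1 :> nat) ||
  (r.2 == p.2 :> nat) && (r.1 == p.1.+1 :> nat).

(** Any other box between them would have to contain an intermediate entry. *)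
Lemma standard_adjacent T i : standard T ->
  le_box (T (gen_lo i)) (T (gen_hi i)) -> hook_next (T (gen_lo i)) (T (gen_hi i)).
Proof.
move=> Ts; have /standardP[Ti h] := Ts; set x := gen_lo i; set y := gen_hi i.
have xy : T x != T y by rewrite (inj_eq Ti) gen_lo_hi.
have btw p : le_box (T x) p -> le_box p (T y) -> p = T x \/ p = T y.
  move=> xp py; have [z zy zp] := h _ _ py; subst p.
  have xz := standard_le Ts xp.
  have [e|e] : (z = x :> nat) \/ (z = y :> nat) by move: xz zy => /=; lia.
    by left; congr (T _); apply: val_inj.
  by right; congr (T _); apply: val_inj.
move: xy btw; case: (T x) (T y) => [a b] [c d] /= xy btw /andP[/= ac bd].
rewrite /hook_next /=.
have [e|ne] := eqVneq (c : nat) a; last first.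
  have lt : (a < c)%N by rewrite ltn_neqAle eq_sym ne.
  have d1 : (a.+1 < m)%N by apply: leq_ltn_trans (ltn_ord c).
  have [] := btw (Ordinal d1, b); rewrite /le_box /= ?leqnn ?leqnSn ?lt //.
    by case=> /(congr1 val) /=; lia.
  by case=> <- <- /=; rewrite !eqxx ?orbT.
have ce : c = a by apply: val_inj.
subst c; have lt : (b < d)%N.
  by rewrite ltn_neqAle bd andbT; apply: contra xy => /eqP/val_inj->.
have d1 : (b.+1 < m)%N by apply: leq_ltn_trans (ltn_ord d).
have [] := btw (a, Ordinal d1); rewrite /le_box /= ?leqnn ?leqnSn ?lt //.
  by case=> /(congr1 val) /=; lia.
by case=> <- /=; rewrite !eqxx.
Qed.

Lemma content_eq_le T x y : content T x = content T y ->
  le_box (T x) (T y) || le_box (T y) (T x).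
Proof. by rewrite /content /le_box; lia. Qed.

(** The two boxes are the corners of a rectangle whose other corners contain two
    intermediate entries. *)
Lemma standard_content_far T x y : standard T -> (x < y)%N ->
  content T x = content T y -> (x.+2 < y)%N.
Proof.
move=> Ts xy ce; have /standardP[Ti h] := Ts.
have le : le_box (T x) (T y).
  case/orP: (content_eq_le ce) => // /(standard_le Ts); lia.
have ne : T x != T y by rewrite (inj_eq Ti) -val_eqE /=; lia.
have mid p : le_box (T x) p -> le_box p (T y) -> p != T x -> p != T y ->
    exists z : 'I_m, (x < z < y)%N /\ T z = p.
  move=> xp py px py'; have [z zy zp] := h _ _ py; subst p.
  exists z; split=> //; have := standard_le Ts xp.
  by move: px py'; rewrite !(inj_eq Ti) -!val_eqE /=; lia.
move: le ne ce mid; rewrite /content /le_box.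
move: (T x) (T y) => [a b] [c d] /= le ne ce mid.
have lt : (a < c)%N.
  rewrite ltnNge; apply: contraNN ne => ca.
  by apply/eqP; congr (_, _); apply: val_inj => /=; lia.
have [] := mid (a, d); rewrite /= ?leqnn ?andbT /=; try lia.
- by apply: contraTneq lt => -[/(congr1 val) /=]; lia.
- by apply: contraTneq lt => -[/(congr1 val) /=]; lia.
move=> z1 [b1 e1].
have [] := mid (c, b); rewrite /= ?leqnn ?andbT /=; try lia.
- by apply: contraTneq lt => -[/(congr1 val) /=]; lia.
- by apply: contraTneq lt => -[/(congr1 val) /=]; lia.
move=> z2 [b2 e2].
have : z1 != z2.
  by apply: contraTneq lt => e; move: e1; rewrite e e2 => -[/(congr1 val) /=]; lia.
rewrite -val_eqE /=; lia.
Qed.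

Definition axdist T i : int := content T (gen_hi i) - content T (gen_lo i).

Lemma axdist_neq0 T i : standard T -> axdist T i != 0.
Proof.
move=> Ts; rewrite subr_eq0; apply/eqP => e.
by have := standard_content_far Ts _ (esym e); rewrite /= => /(_ (ltnSn _)); lia.
Qed.

Lemma axdist_row T i : standard T -> axdist T i = 1 ->
  le_box (T (gen_lo i)) (T (gen_hi i)).
Proof.
move=> Ts e; have : ~~ le_box (T (gen_hi i)) (T (gen_lo i)).
  by apply/negP => /(standard_le Ts) /=; lia.
move: e; rewrite /axdist /content /le_box; lia.
Qed.

Lemma axdist_swap T i : axdist (swap_tab T i) i = - axdist T i.
Proof.
by rewrite /axdist /content !swap_tabE simple_tperm_lo simple_tperm_hi; lia.
Qed.

Lemma content_swap T i x : content (swap_tab T i) x = content T (simple_tperm i x).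
Proof. by rewrite /content swap_tabE. Qed.

End StandardFillings.

(** * The action on functions of tableaux *)

Section TableauModule.
Variables (F : fieldType) (q : F) (m : nat).
Hypothesis q0 : q != 0.
Hypothesis qint_neq0 : forall n, (0 < n)%N -> qint q n%:Z != 0.

Implicit Types (T : filling m) (i j : 'I_m.-1) (u : filling m -> F).

(** The seminormal modules of all shapes at once, as functions on standard fillings.
    The values at the other fillings form a summand on which every generator acts
    by q: this satisfies the Hecke relations too, and does not restrict the vectors
    on which given generators act by q. *)
Definition tabmod : Type := {ffun filling m -> F^o}.
HB.instance Definition _ := GRing.Lmodule.on tabmod.

Definition tab_op i (v : tabmod) : tabmod :=
  [ffun T => if standard T
    then dl q (acoef q (axdist T i)) (v T)
           ((standard (swap_tab T i))%:R * v (swap_tab T i))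
    else q * v T].

Lemma tab_op_linear i : linear (tab_op i).
Proof.
move=> c u v; apply/ffunP => T; rewrite !ffunE /= /GRing.scale /= /dl.
by case: ifP => _; ring.
Qed.

HB.instance Definition _ i :=
  GRing.isLinear.Build F tabmod tabmod _ (tab_op i) (tab_op_linear i).

Definition free_op i u T : F :=
  dl q (acoef q (axdist T i)) (u T) (u (swap_tab T i)).

Definition col_bad T : Prop := exists x y : 'I_m,
  [/\ (x < y)%N, (T x).2 = (T y).2 & ((T y).1 < (T x).1)%N].

Definition ideal_filling T : Prop :=
  injective T /\ forall x p, le_box p (T x) -> exists y, T y = p.

(** u is a lift of v to the subspace of functions that vanish on column violations, of
    which the functions on standard fillings are a quotient. *)
Definition extends u (v : tabmod) : Prop :=
  (forall T, standard T -> u T = v T) /\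
  (forall T, ideal_filling T -> col_bad T -> u T = 0).

Lemma ideal_swap i T : ideal_filling T -> ideal_filling (swap_tab T i).
Proof.
move=> [Ti h]; split=> [x y|x p]; first by rewrite !swap_tabE => /Ti/perm_inj.
rewrite swap_tabE => /h[y yp]; exists (simple_tperm i y).
by rewrite swap_tabE simple_tpermK.
Qed.

Lemma standard_ideal T : standard T -> ideal_filling T.
Proof. by move=> /standardP[Ti h]; split=> // x p /h[y _ yp]; exists y. Qed.

Lemma standard_col_good T : standard T -> ~ col_bad T.
Proof.
move=> Ts [x [y [xy e lt]]]; have := standard_le (x := y) (y := x) Ts.
by rewrite /le_box e leqnn (ltnW lt) => /(_ isT); lia.
Qed.

(** The exchange of i and i+1 can only repair a violation between these two entries.
    An entry strictly between them in their column would be part of a violation that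
    remains, so their boxes are vertical neighbours. *)
Lemma col_bad_axdist i T : ideal_filling T -> col_bad T ->
  ~ col_bad (swap_tab T i) -> axdist T i = 1.
Proof.
move=> [Ti h] [x [y [xy exy lt]]] good; set s := simple_tperm i.
have [ex ey] : x = gen_lo i /\ y = gen_hi i.
  apply: (simple_tperm_lt (i := i)) => //; rewrite leqNgt; apply/negP=> st.
  by apply: good; exists (s x), (s y); rewrite !swap_tabE !simple_tpermK.
suff rows : ((T x).1 = (T y).1.+1 :> nat).
  by rewrite /axdist /content -ex -ey rows exy; lia.
apply/eqP; rewrite eqn_leq lt andbT leqNgt; apply/negP => lt2.
have pm : ((T y).1.+1 < m)%N by apply: leq_ltn_trans (ltn_ord (T x).1).
have [z zp] : exists z, T z = (Ordinal pm, (T x).2).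
  by apply: (h x); rewrite /le_box leqnn /= andbT.
have zx : z != x by apply: contraTneq lt2 => e; move: zp; rewrite e => ->/=; lia.
have zy : z != y.
  by apply/eqP => e; have := congr1 (fun p => val p.1) zp; rewrite e /=; lia.
have sz : s z = z by rewrite /s /simple_tperm tpermD // -?ex -?ey eq_sym.
have [zlt|] := ltnP z x.
  apply: good; exists z, x; rewrite !swap_tabE -/s sz zlt.
  by rewrite ex simple_tperm_lo -ey zp /= exy; split.
rewrite leq_eqVlt val_eqE eq_sym (negbTE zx) /= => xz.
apply: good; exists y, z; rewrite !swap_tabE -/s sz zp.
have -> : s y = x by rewrite ex -simple_tperm_hi -ey.
split=> //.
by move: xz zy; rewrite -val_eqE ex ey /=; lia.
Qed.

(** The truncated operators are induced by the operators free_op on a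
    subquotient of the space of all functions: free_op preserves vanishing on
    column violations, and its coefficient towards a row violation is zero. *)
Lemma extends_op i u v : extends u v -> extends (free_op i u) (tab_op i v).
Proof.
move=> [uv u0]; split=> [T Ts|T Ti bad].
  rewrite ffunE Ts /free_op uv //.
  case: (boolP (standard _)) => st; first by rewrite uv // mul1r.
  rewrite mul0r; have le : le_box (T (gen_lo i)) (T (gen_hi i)).
    by rewrite standard_swapE // negbK in st.
  rewrite /dl mulr0.
  case/orP: (standard_adjacent Ts le) => /andP[/eqP e1 /eqP e2].
    have -> : axdist T i = 1 by rewrite /axdist /content e1 e2; lia.
    by rewrite acoef1 // subrr mul0r.
  rewrite u0 ?mulr0 //; first exact/ideal_swap/standard_ideal.
  exists (gen_lo i), (gen_hi i).
  rewrite !swap_tabE simple_tperm_lo simple_tperm_hi.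
  by rewrite e2 ltnSn; split=> //=; apply: val_inj.
rewrite /free_op /dl (u0 T) // mulr0 add0r.
have [bad'|good] := pselect (col_bad (swap_tab T i)).
  by rewrite u0 ?mulr0 //; apply: ideal_swap.
by rewrite (col_bad_axdist (i := i)) // acoef1 // subrr mul0r.
Qed.

Lemma extends_trunc (v : tabmod) :
  extends (fun T => (standard T)%:R * v T) v.
Proof.
split=> [T ->|T _ bad]; first by rewrite mul1r.
by case: (boolP (standard T)) => [/standard_col_good|]; rewrite ?mul0r.
Qed.

Lemma tab_op_std i u v T : extends u v -> standard T -> tab_op i v T = free_op i u T.
Proof. by move=> /(extends_op i)[h _] /h ->. Qed.

Lemma tab_op_nonstd i (v : tabmod) T : ~~ standard T -> tab_op i v T = q * v T.
Proof. by move=> /negbTE Ts; rewrite ffunE Ts. Qed.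

Lemma tab_opE i (v : tabmod) T : standard T -> tab_op i v T =
  dl q (acoef q (axdist T i)) (v T)
     ((standard (swap_tab T i))%:R * v (swap_tab T i)).
Proof. by rewrite ffunE => ->. Qed.

Lemma tab_scaleE c (v : tabmod) T : (c *: v) T = c * v T.
Proof. by rewrite ffunE. Qed.

Lemma tab_op_quad i (v : tabmod) :
  tab_op i (tab_op i v) = (q - q^-1) *: tab_op i v + v.
Proof.
apply/ffunP => T; rewrite [RHS]ffunE [in RHS]ffunE /= [_ *: _]/GRing.scale /=.
case: (boolP (standard T)) => Ts; last first.
  by rewrite !tab_op_nonstd //; field.
have e := extends_trunc v.
have -> : v T = (standard T)%:R * v T by rewrite Ts mul1r.
rewrite (tab_op_std _ (extends_op i e)) // (tab_op_std _ e) // /free_op.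
by rewrite axdist_swap swap_tabK acoefN ?axdist_neq0 // dl_quad.
Qed.

Lemma tab_op_braid i j : j = i.+1 :> nat -> forall v,
  tab_op i (tab_op j (tab_op i v)) = tab_op j (tab_op i (tab_op j v)).
Proof.
move=> ij v; apply/ffunP => T; case: (boolP (standard T)) => Ts; last first.
  by rewrite !tab_op_nonstd.
have e := extends_trunc v; set u := fun T => _ in e.
rewrite (tab_op_std _ (extends_op j (extends_op i e))) //.
rewrite (tab_op_std _ (extends_op i (extends_op j e))) // /free_op.
have lj := gen_lo_next ij.
have d i' T' : axdist T' i' = content T' (gen_hi i') - content T' (gen_lo i') by [].
have bi : simple_tperm i (gen_hi j) = gen_hi j.
  by rewrite /simple_tperm tpermD // -val_eqE /= ij; lia.
have bj : simple_tperm j (gen_lo i) = gen_lo i.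
  by rewrite /simple_tperm tpermD // -val_eqE /= ij; lia.
have hj : simple_tperm j (gen_hi i) = gen_hi j by rewrite -lj simple_tperm_lo.
have jh : simple_tperm j (gen_hi j) = gen_hi i by rewrite -lj simple_tperm_hi.
have cs := (simple_tperm_lo, simple_tperm_hi, content_swap, lj, bi, bj, hj, jh).
rewrite (swap_tab_braid _ ij) !swap_tabK.
rewrite !d !cs.
set x := content T (gen_lo i); set y := content T (gen_hi i).
set z := content T (gen_hi j).
have xy : y - x != 0 by apply: axdist_neq0.
have yz : z - y != 0 by rewrite -[y]/(content T (gen_hi i)) -lj; apply: axdist_neq0.
have xz : (y - x) + (z - y) != 0.
  rewrite addrC subrKA subr_eq0; apply/eqP => e'.
  by have := standard_content_far Ts _ (esym e'); rewrite /= ij => /(_ _); lia.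
have -> : z - x = (y - x) + (z - y) by ring.
have -> : x - y = - (y - x) by ring.
have -> : y - z = - (z - y) by ring.
rewrite !acoefN // dl_braid //; exact: acoefD.
Qed.

Lemma tab_op_comm i j : (i.+1 < j)%N -> forall v,
  tab_op i (tab_op j v) = tab_op j (tab_op i v).
Proof.
move=> ij v; apply/ffunP => T; case: (boolP (standard T)) => Ts; last first.
  by rewrite !tab_op_nonstd //; ring.
have e := extends_trunc v.
rewrite (tab_op_std _ (extends_op j e)) // (tab_op_std _ (extends_op i e)) //.
rewrite /free_op (swap_tab_comm _ ij).
have dj : axdist (swap_tab T i) j = axdist T j.
  by rewrite /axdist !content_swap /simple_tperm !tpermD // -val_eqE /=; lia.
have di : axdist (swap_tab T j) i = axdist T i.
  by rewrite /axdist !content_swap /simple_tperm !tpermD // -val_eqE /=; lia.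
by rewrite dj di dl_comm.
Qed.

Definition tab_act (x : hecke q m) (v : tabmod) : tabmod :=
  hecke_act (fun i => tab_op i) x v.

Lemma tab_actP :
  [/\ forall i v, tab_act (sigma i) v = tab_op i v,
      forall v, tab_act 1 v = v,
      forall x y v, tab_act (x + y) v = tab_act x v + tab_act y v,
      forall x y v, tab_act (x * y) v = tab_act x (tab_act y v) &
      forall c x v, tab_act (c *: x) v = c *: tab_act x v].
Proof.
have [h1 h2 h3 h4 h5] := @hecke_actP F q m tabmod (fun i => tab_op i)
  tab_op_quad tab_op_braid tab_op_comm.
by split=> // i v; apply: h1.
Qed.

End TableauModule.

(** * Reduced words and the regular module *)

Section PermutationLength.
Variable m : nat.
Implicit Types (w : 'S_m) (i : 'I_m.-1).

(** Exchanging the positions i and i+1 matches the inversions of the two permutations,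
    except that the pair (i, i+1) becomes one. *)
Lemma perm_length_up i w : (w (gen_lo i) < w (gen_hi i))%N ->
  perm_length (simple_tperm i * w)%g = (perm_length w).+1.
Proof.
move=> asc; rewrite /perm_length; set s := simple_tperm i.
set f := fun p : 'I_m * 'I_m => (s p.1, s p.2).
have f_inj : injective f by move=> [a b] [c d] [/perm_inj-> /perm_inj->].
set A := [set p : 'I_m * 'I_m | (p.1 < p.2)%N && (w p.2 < w p.1)%N].
have -> : [set p : 'I_m * 'I_m | (p.1 < p.2)%N &&
      ((s * w)%g p.2 < (s * w)%g p.1)%N] =
    (gen_lo i, gen_hi i) |: f @: A.
  apply/setP=> -[x y]; rewrite !inE /= !permM xpair_eqE.
  apply/andP/orP => [[xy ww]|].
    have [/andP[/eqP-> /eqP->]|ne] := boolP ((x == gen_lo i) && (y == gen_hi i)).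
      by left.
    right; apply/imsetP; exists (s x, s y); last by rewrite /f /= !simple_tpermK.
    rewrite inE /= ww andbT ltnNge; apply: contraNN ne => le.
    by have [-> ->] := simple_tperm_lt xy le; rewrite !eqxx.
  case=> [/andP[/eqP-> /eqP->]|].
    by rewrite simple_tperm_lo simple_tperm_hi asc ltnSn.
  case/imsetP=> -[a b]; rewrite inE /= => /andP[ab ww] [-> ->].
  rewrite !simple_tpermK ww; split=> //; rewrite ltnNge; apply/negP => le.
  by have [e1 e2] := simple_tperm_lt ab le; move: ww; rewrite e1 e2; lia.
rewrite cardsU1 card_imset //.
suff -> : (gen_lo i, gen_hi i) \notin f @: A by [].
apply/imsetP => -[[a b]]; rewrite inE => /andP[/= ab _] [ea eb].
have e1 : a = gen_hi i by rewrite -simple_tperm_lo ea simple_tpermK.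
have e2 : b = gen_lo i by rewrite -simple_tperm_hi eb simple_tpermK.
by move: ab; rewrite e1 e2 /=; lia.
Qed.

Lemma perm_length_down i w : (w (gen_hi i) < w (gen_lo i))%N ->
  perm_length w = (perm_length (simple_tperm i * w)%g).+1.
Proof.
move=> desc; rewrite -(perm_length_up (i := i)) ?permM ?simple_tperm_lo ?simple_tperm_hi //.
by rewrite mulgA /simple_tperm tperm2 mul1g.
Qed.

Lemma ascentVdescent i w :
  (w (gen_lo i) < w (gen_hi i))%N \/ (w (gen_hi i) < w (gen_lo i))%N.
Proof.
have : w (gen_lo i) != w (gen_hi i) by rewrite (inj_eq perm_inj) gen_lo_hi.
by rewrite -val_eqE; case: ltngtP; [left|right|].
Qed.

Lemma perm_length_step i w :
  (perm_length (simple_tperm i * w)%g <= (perm_length w).+1)%N.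
Proof.
have [/perm_length_up->//|/perm_length_down->] := ascentVdescent i w.
by rewrite ltnW // ltnW.
Qed.

Lemma perm_no_descent w :
  (forall i, (w (gen_lo i) < w (gen_hi i))%N) -> w = 1%g.
Proof.
move=> asc.
have next (x : 'I_m) : (x.+1 < m)%N ->
    exists i : 'I_m.-1, x = gen_lo i /\ gen_hi i = x.+1 :> nat.
  move=> xm; have xm' : (x < m.-1)%N by lia.
  by exists (Ordinal xm'); split=> //; apply: val_inj.
have ge k : forall x : 'I_m, x = k :> nat -> (x <= w x)%N.
  elim: k => [|k IH] x xk; first by rewrite xk.
  have km : (k < m)%N by rewrite ltnW // -xk.
  have km1 : (k.+1 < m)%N by rewrite -xk.
  have [i [lo hi]] := next (Ordinal km) km1.
  have -> : x = gen_hi i by apply: val_inj; rewrite [RHS]hi.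
  by rewrite hi; apply: leq_ltn_trans (asc i); rewrite -lo; apply: IH.
have le k : forall x : 'I_m, (x + k).+1 = m -> (w x <= x)%N.
  elim: k => [|k IH] x xk; first by have := ltn_ord (w x); lia.
  have [i [lo hi]] := next x ltac:(lia).
  have h : (w (gen_hi i) <= gen_hi i)%N by apply: IH; rewrite hi addSnnS.
  by rewrite -ltnS -hi; apply: leq_trans h; rewrite lo; apply: asc.
apply/perm.permP => x; rewrite perm1; apply: val_inj; apply/eqP.
rewrite eqn_leq (ge x) // (le (m - x.+1)%N) //; have := ltn_ord x; lia.
Qed.

Lemma perm_descent w : w != 1%g -> exists i, (w (gen_hi i) < w (gen_lo i))%N.
Proof.
move=> w1; case: (pickP (fun i => w (gen_hi i) < w (gen_lo i))%N) => [i|no].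
  by exists i.
case/eqP: w1; apply: perm_no_descent => i.
by have := no i; case: (ascentVdescent i w) => // ->.
Qed.

Lemma perm_length1 : perm_length (1%g : 'S_m) = 0%N.
Proof.
apply: eq_card0 => -[x y]; rewrite !inE /= !perm1; lia.
Qed.

Lemma reduced_word_exists w : exists s : seq 'I_m.-1, reduced_word w s.
Proof.
have [n] := ubnP (perm_length w); elim: n w => // n IH w lt.
have [->|/perm_descent[i desc]] := eqVneq w 1%g.
  by exists [::]; rewrite /reduced_word big_nil eqxx perm_length1.
have e := perm_length_down desc.
have [|s /andP[/eqP sw /eqP ss]] := IH (simple_tperm i * w)%g; first by lia.
exists (i :: s); rewrite /reduced_word big_cons sw /= ss e eqxx andbT.
by rewrite mulgA /simple_tperm tperm2 mul1g.
Qed.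

Lemma perm_length_word (s : seq 'I_m.-1) :
  (perm_length (\prod_(i <- s) simple_tperm i)%g <= size s)%N.
Proof.
elim: s => [|i s IH]; first by rewrite big_nil perm_length1.
by rewrite big_cons; apply: leq_trans (perm_length_step _ _) _.
Qed.

End PermutationLength.

Section RegularModule.
Variables (F : fieldType) (q : F) (m : nat).
Hypothesis q0 : q != 0.

Implicit Types (w : 'S_m) (i j : 'I_m.-1).

Definition regmod : Type := {ffun 'S_m -> F^o}.
HB.instance Definition _ := GRing.Lmodule.on regmod.

(** The coefficient kappa + 1 / gam d of tab_op tends to kappa or 0 when q^(2d) tends
    to infinity or 0; with these values the operators of the same form describe the
    left regular representation, sigma_w corresponding to q^-l(w) times the indicator
    function of w. *)
Definition desc_coef w (x y : 'I_m) : F := if (w y < w x)%N then kappa q else 0.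

Definition reg_op i (v : regmod) : regmod :=
  [ffun w => dl q (desc_coef w (gen_lo i) (gen_hi i)) (v w)
                  (v (simple_tperm i * w)%g)].

Lemma reg_op_linear i : linear (reg_op i).
Proof.
by move=> c u v; apply/ffunP => w; rewrite !ffunE /= /GRing.scale /= /dl; ring.
Qed.

HB.instance Definition _ i :=
  GRing.isLinear.Build F regmod regmod _ (reg_op i) (reg_op_linear i).

Lemma desc_coefC w (x y : 'I_m) : x != y ->
  desc_coef w y x = kappa q - desc_coef w x y.
Proof.
move=> xy; rewrite /desc_coef; have : w x != w y by rewrite (inj_eq perm_inj).
by rewrite -val_eqE /=; case: ltngtP => //; rewrite ?subr0 ?subrr.
Qed.

Lemma desc_coef_swap i w (x y : 'I_m) :
  desc_coef (simple_tperm i * w)%g x y =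
  desc_coef w (simple_tperm i x) (simple_tperm i y).
Proof. by rewrite /desc_coef !permM. Qed.

(** Being inverted is a transitive relation with transitive complement, which is
    the identity required of the coefficients by the braid relation. *)
Lemma desc_coef_trans w x y z : y != z -> x != y -> x != z ->
  desc_coef w x z * (desc_coef w x y + desc_coef w y z - kappa q) =
  desc_coef w x y * desc_coef w y z.
Proof.
have d a b : a != b -> val (w a) != val (w b).
  by rewrite val_eqE (inj_eq perm_inj).
move=> /d yz /d xy /d xz; rewrite /desc_coef.
case: (ltnP (w z) (w x)) => h1; case: (ltnP (w y) (w x)) => h2;
  case: (ltnP (w z) (w y)) => h3; try ring; move: yz xy xz; lia.
Qed.

Lemma simple_tperm2 i w : (simple_tperm i * (simple_tperm i * w))%g = w.
Proof. by rewrite mulgA /simple_tperm tperm2 mul1g. Qed.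

Lemma reg_op_quad i v : reg_op i (reg_op i v) = (q - q^-1) *: reg_op i v + v.
Proof.
apply/ffunP => w; rewrite !ffunE [_ *: _]/GRing.scale /=.
rewrite simple_tperm2 desc_coef_swap simple_tperm_lo simple_tperm_hi.
by rewrite (desc_coefC w (gen_lo_hi i)) dl_quad.
Qed.

Lemma reg_op_braid i j : j = i.+1 :> nat -> forall v,
  reg_op i (reg_op j (reg_op i v)) = reg_op j (reg_op i (reg_op j v)).
Proof.
move=> ij v; apply/ffunP => w; rewrite !ffunE !simple_tperm2.
have lj := gen_lo_next ij.
have bi : simple_tperm i (gen_hi j) = gen_hi j.
  by rewrite /simple_tperm tpermD // -val_eqE /= ij; lia.
have bj : simple_tperm j (gen_lo i) = gen_lo i.
  by rewrite /simple_tperm tpermD // -val_eqE /= ij; lia.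
have hj : simple_tperm j (gen_hi i) = gen_hi j by rewrite -lj simple_tperm_lo.
have jh : simple_tperm j (gen_hi j) = gen_hi i by rewrite -lj simple_tperm_hi.
have cs := (simple_tperm_lo, simple_tperm_hi, desc_coef_swap, lj, bi, bj, hj, jh).
have -> : (simple_tperm i * (simple_tperm j * (simple_tperm i * w)) =
           simple_tperm j * (simple_tperm i * (simple_tperm j * w)))%g.
  by rewrite !mulgA simple_tperm_braid.
rewrite !cs.
have xy : gen_lo i != gen_hi i := gen_lo_hi i.
have yz : gen_hi i != gen_hi j by rewrite -val_eqE /= ij; lia.
have xz : gen_lo i != gen_hi j by rewrite -val_eqE /= ij; lia.
rewrite (desc_coefC w xy) (desc_coefC w yz) dl_braid //; exact: desc_coef_trans.
Qed.

Lemma reg_op_comm i j : (i.+1 < j)%N -> forall v,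
  reg_op i (reg_op j v) = reg_op j (reg_op i v).
Proof.
move=> ij v; apply/ffunP => w; rewrite !ffunE !desc_coef_swap.
rewrite !mulgA (simple_tperm_comm ij) /simple_tperm.
rewrite !(tpermD (x := gen_lo i)) ?(tpermD (x := gen_lo j)) -?val_eqE /=; try lia.
exact: dl_comm.
Qed.

Definition reg_act (x : hecke q m) (v : regmod) : regmod :=
  hecke_act (fun i => reg_op i) x v.

Lemma reg_actP :
  [/\ forall i v, reg_act (sigma i) v = reg_op i v,
      forall v, reg_act 1 v = v,
      forall x y v, reg_act (x + y) v = reg_act x v + reg_act y v,
      forall x y v, reg_act (x * y) v = reg_act x (reg_act y v) &
      forall c x v, reg_act (c *: x) v = c *: reg_act x v].
Proof.
have [h1 h2 h3 h4 h5] := @hecke_actP F q m regmod (fun i => reg_op i)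
  reg_op_quad reg_op_braid reg_op_comm.
by split=> // i v; apply: h1.
Qed.

Definition rdelta w : regmod := [ffun u => (u == w)%:R].

Lemma reg_op_delta i w : (w (gen_lo i) < w (gen_hi i))%N ->
  reg_op i (rdelta w) = q^-1 *: rdelta (simple_tperm i * w)%g.
Proof.
move=> asc; apply/ffunP => u; rewrite !ffunE [_ *: _]/GRing.scale /= /dl /kappa.
have ne : w != (simple_tperm i * w)%g.
  apply/eqP => e; have := perm_length_up asc; rewrite -e; lia.
have [->|uw] := eqVneq u w.
  rewrite eq_sym (negbTE ne) /desc_coef ltnNge (ltnW asc) /= -/(_ == _).
  by rewrite !mulr0 mul0r add0r.
have -> : (simple_tperm i * u == w)%g = (u == (simple_tperm i * w)%g).
  by apply/eqP/eqP => [<-|->]; rewrite simple_tperm2.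
have [->|_] := eqVneq u (simple_tperm i * w)%g; last by rewrite !mulr0 addr0.
rewrite desc_coef_swap simple_tperm_lo simple_tperm_hi /desc_coef asc /kappa.
by rewrite mulr0 add0r opprB addrC subrK.
Qed.

(** The final segments of a reduced word are reduced, so that every generator meets an
    ascent. *)
Lemma reg_act_word (s : seq 'I_m.-1) w : reduced_word w s ->
  reg_act (\prod_(i <- s) sigma i) (rdelta 1%g) = q ^- size s *: rdelta w.
Proof.
have [r1 r2 _ rM rZ] := reg_actP.
elim: s w => [|i s IH] w /andP[/eqP <- /eqP ss].
  by rewrite !big_nil r2 expr0 invr1 scale1r.
set u := (\prod_(j <- s) simple_tperm j)%g.
move: ss; rewrite !big_cons /= -/u => ss.
have us := perm_length_word s; rewrite -/u in us.
have asc : (u (gen_lo i) < u (gen_hi i))%N.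
  by case: (ascentVdescent i u) => // /perm_length_down; lia.
have /IH e : reduced_word u s.
  by rewrite /reduced_word eqxx /=; have := perm_length_up asc; rewrite -ss => -[->].
rewrite rM e r1.
have -> : reg_op i (q ^- size s *: rdelta u) = q ^- size s *: reg_op i (rdelta u).
  exact: linearZ.
by rewrite reg_op_delta // scalerA exprSr invfM mulrC.
Qed.

Lemma sigma_perm_word w : exists s : seq 'I_m.-1,
  reduced_word w s /\ sigma_perm q w = \prod_(i <- s) sigma i.
Proof.
rewrite /sigma_perm; case: pickP => [s rs|no]; first by exists s.
have [s rs] := reduced_word_exists w.
have /eqP ss : size s == perm_length w by case/andP: rs.
by have := no (Tuple (introT eqP ss)); rewrite rs.
Qed.

Definition poincare : F := \sum_(w : 'S_m) q ^+ (2 * perm_length w)%N.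

Definition qsum : hecke q m := \sum_(w : 'S_m) q ^+ perm_length w *: sigma_perm q w.

Lemma qsym_def : qsym q m = poincare^-1 *: qsum.
Proof. by []. Qed.

Lemma reg_act_sigma_perm w :
  reg_act (sigma_perm q w) (rdelta 1%g) = q ^- perm_length w *: rdelta w.
Proof.
have [s [rs ->]] := sigma_perm_word w; rewrite (reg_act_word rs).
by case/andP: rs => _ /eqP->.
Qed.

Lemma reg_act_coef (c : 'S_m -> F) :
  reg_act (\sum_w (c w * q ^+ perm_length w) *: sigma_perm q w) (rdelta 1%g) =
  [ffun w => c w].
Proof.
have [_ _ rD _ rZ] := reg_actP.
have r0 u : reg_act 0 u = 0 by rewrite -(scale0r 0) rZ scale0r.
rewrite (big_morph (fun x => reg_act x _) (id1 := 0) (op1 := +%R)) //.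
rewrite (eq_bigr (fun w => c w *: rdelta w)) => [|w _]; last first.
  by rewrite rZ reg_act_sigma_perm scalerA mulfK // expf_neq0.
apply/ffunP => u; rewrite sum_ffunE (bigD1 u) //= big1 ?addr0 => [|w wu].
  by rewrite !ffunE eqxx [_ *: _]mulr1.
by rewrite !ffunE eq_sym (negbTE wu) scaler0.
Qed.

Lemma reg_act_surj (v : regmod) : exists x, reg_act x (rdelta 1%g) = v.
Proof.
exists (\sum_w ((v w : F) * q ^+ perm_length w) *: sigma_perm q w).
by rewrite (reg_act_coef v); apply/ffunP => w; rewrite ffunE.
Qed.

Lemma reg_act_qsum : reg_act qsum (rdelta 1%g) = [ffun=> 1].
Proof.
rewrite -(reg_act_coef (fun=> 1)); congr (reg_act _ _).
by apply: eq_bigr => w _; rewrite mul1r.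
Qed.

(** Both sides are the constant function q. *)
Lemma reg_act_sigma_qsum i :
  reg_act (sigma i * qsum) (rdelta 1%g) = reg_act (q *: qsum) (rdelta 1%g).
Proof.
have [r1 _ _ rM rZ] := reg_actP.
rewrite rM rZ reg_act_qsum r1; apply/ffunP => w; rewrite !ffunE.
by rewrite /dl -mulrDl addrC subrK.
Qed.

End RegularModule.

(** * H_m(q) is spanned by m! elements *)

Section Spanning.
Variables (F : fieldType) (V : lmodType F).

Definition spanned (l : seq V) (x : V) : Prop :=
  exists c : 'I_(size l) -> F, x = \sum_i c i *: l`_i.

Lemma spannedD l x y : spanned l x -> spanned l y -> spanned l (x + y).
Proof.
move=> [c ->] [d ->]; exists (fun i => c i + d i); rewrite -big_split /=.
by apply: eq_bigr => i _; rewrite scalerDl.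
Qed.

Lemma spannedZ l a x : spanned l x -> spanned l (a *: x).
Proof.
move=> [c ->]; exists (fun i => a * c i); rewrite scaler_sumr.
by apply: eq_bigr => i _; rewrite scalerA.
Qed.

Lemma spanned_mem (l : seq V) x : x \in l -> spanned l x.
Proof.
rewrite -index_mem => xl; exists (fun i => (i == Ordinal xl)%:R).
rewrite (bigD1 (Ordinal xl)) //= eqxx scale1r nth_index -?index_mem //.
by rewrite big1 ?addr0 // => i /negbTE->; rewrite scale0r.
Qed.

Lemma spanned_sum l (I : finType) (f : I -> V) :
  (forall i, spanned l (f i)) -> spanned l (\sum_i f i).
Proof.
move=> h; elim/big_ind: _ => //; last by move=> x y; apply: spannedD.
by exists (fun=> 0); rewrite big1 // => i _; rewrite scale0r.
Qed.

(** The images of the elements of l span a space of dimension #|P|, which is at least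
    their number, so they are linearly independent. *)
Lemma surjective_injective (P : finType) (l : seq V) (f : V -> P -> F) :
  (forall x, spanned l x) -> (size l <= #|P|)%N ->
  (forall x y p, f (x + y) p = f x p + f y p) ->
  (forall a x p, f (a *: x) p = a * f x p) ->
  (forall g : P -> F, exists x, forall p, f x p = g p) ->
  forall x, (forall p, f x p = 0) -> x = 0.
Proof.
move=> sp le fD fZ surj x fx0.
have f0 p : f 0 p = 0 by rewrite -(scale0r 0) fZ mul0r.
have fsum (c : 'I_(size l) -> F) p :
    f (\sum_i c i *: l`_i) p = \sum_i c i * f l`_i p.
  rewrite (big_morph (f^~ p) (id1 := 0) (op1 := +%R)) //.
  by apply: eq_bigr => i _; rewrite fZ.
pose A : 'M[F]_(size l, #|P|) := \matrix_(i, j) f l`_i (enum_val j).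
have full : row_full A.
  apply/row_fullP.
  have rows (j : 'I_#|P|) : exists r : 'rV[F]_(size l), r *m A = delta_mx 0 j.
    have [y hy] := surj (fun p => (p == enum_val j)%:R).
    have [c yc] := sp y; exists (\row_i c i); apply/rowP => j'.
    rewrite !mxE eqxx /=; have := hy (enum_val j'); rewrite yc fsum.
    rewrite (inj_eq enum_val_inj) => <-.
    by apply: eq_bigr => i _; rewrite !mxE.
  have [r rP] := choice rows; exists (\matrix_(j, i) r j 0 i).
  apply/row_matrixP => j; rewrite row_mul rowK row1 -rP; congr (_ *m _).
have free : row_free A.
  rewrite /row_free; move: full; rewrite /row_full => /eqP rA.
  by rewrite eqn_leq rank_leq_row rA.
have [c xc] := sp x.
have cA : (\row_i c i) *m A = 0.
  apply/rowP => j; rewrite !mxE; apply: etrans (fx0 (enum_val j)); rewrite xc fsum.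
  by apply: eq_bigr => i _; rewrite !mxE.
have c0 : \row_i c i = 0.
  by apply/eqP; rewrite -(mulmx_free_eq0 _ free) cA.
rewrite xc big1 // => i _.
have -> : c i = 0 by have := congr1 (fun M : 'rV_(size l) => M 0 i) c0; rewrite !mxE.
exact: scale0r.
Qed.

End Spanning.

Section HeckeSpanning.
Variables (F : fieldType) (q : F) (m : nat).
Local Notation H := (hecke q m).

Definition sgen (j : nat) : H :=
  if insub j : option 'I_m.-1 is Some i then sigma i else 0.

Lemma sgenE (i : 'I_m.-1) : sgen i = sigma i.
Proof. by rewrite /sgen valK. Qed.

Lemma sgen_quad j : (j < m.-1)%N ->
  sgen j * sgen j = kappa q *: sgen j + 1.
Proof.
move=> jm; rewrite (sgenE (Ordinal jm)) -expr2.
exact: (hecke_quad (sigma_rel q m)).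
Qed.

Lemma sgen_braid j : (j.+1 < m.-1)%N ->
  sgen j * sgen j.+1 * sgen j = sgen j.+1 * sgen j * sgen j.+1.
Proof.
move=> jm; rewrite (sgenE (Ordinal (ltnW jm))) (sgenE (Ordinal jm)).
exact: (hecke_braid (sigma_rel q m)).
Qed.

Lemma sgen_comm i j : (i.+1 < j)%N -> sgen i * sgen j = sgen j * sgen i.
Proof.
move=> ij; rewrite /sgen; case: insubP => [a _ ea|_]; last by rewrite mul0r mulr0.
case: insubP => [b _ eb|_]; last by rewrite mul0r mulr0.
by apply: (hecke_comm (sigma_rel q m)); move: ij; rewrite -ea -eb.
Qed.

(** The lifts of the minimal representatives of the right cosets of S_j in S_(j+1). *)
Fixpoint descend (j k : nat) : H :=
  if k is k'.+1 then descend j k' * sgen (j - k) else 1.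

Lemma descend_comm j k l : (l.+1 < j - k)%N ->
  descend j k * sgen l = sgen l * descend j k.
Proof.
elim: k => [|k IH] lt /=; first by rewrite mul1r mulr1.
by rewrite -mulrA -sgen_comm // mulrA IH ?mulrA //; lia.
Qed.

Lemma descend_shift j k l : (k <= j <= m.-1)%N -> (j - k < l < j)%N ->
  descend j k * sgen l = sgen l.-1 * descend j k.
Proof.
elim/ltn_ind: k => -[|k] IH kj lt /=; first by lia.
have [lt2|] := ltnP (j - k) l.
  rewrite -mulrA sgen_comm; last by lia.
  by rewrite mulrA IH ?mulrA //; lia.
case: k IH kj lt => [|k] IH kj lt le; first by lia.
have e1 : (j - k.+1 = l)%N by lia.
have e2 : (j - k.+2 = l.-1)%N by lia.
have e3 : l = l.-1.+1 by lia.
rewrite /= e1 e2 -mulrA -(mulrA (descend j k)) [in sgen l]e3 (mulrA (sgen _)).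
rewrite -sgen_braid; last by lia.
by rewrite !mulrA descend_comm //; lia.
Qed.

Fixpoint hecke_basis (j : nat) : seq H :=
  if j is j'.+1
  then [seq b * descend j k | b <- hecke_basis j', k <- iota 0 j.+1]
  else [:: 1].
Arguments hecke_basis : simpl never.

Lemma size_hecke_basis j : size (hecke_basis j) = j.+1`!.
Proof.
elim: j => // j IH.
by rewrite [LHS]size_allpairs IH size_iota (factS j.+1) mulnC.
Qed.

Lemma spanned_mulr (l l' : seq H) (y : H) :
  (forall b, b \in l -> spanned l' (b * y)) ->
  forall x, spanned l x -> spanned l' (x * y).
Proof.
move=> h x [c ->]; rewrite mulr_suml; apply: spanned_sum => i.
by rewrite -scalerAl; apply/spannedZ/h/mem_nth.
Qed.

(** Pushing a generator to the left through a coset representative either leaves a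
    generator of smaller index, or changes the length of the representative by one,
    or produces a square. *)
Lemma hecke_basis_mul j l : (l < j <= m.-1)%N ->
  forall x, spanned (hecke_basis j) x -> spanned (hecke_basis j) (x * sgen l).
Proof.
elim: j l => [|j IH] l lj; first by lia.
apply: spanned_mulr => _ /allpairsP[[b k] [bB kI ->]].
rewrite mem_iota in kI; move: bB kI => /= bB kI.
have base k' : (k' <= j.+1)%N -> forall z, spanned (hecke_basis j) z ->
    spanned (hecke_basis j.+1) (z * descend j.+1 k').
  move=> kj; apply: spanned_mulr => z zB; apply: spanned_mem.
  by apply/allpairsP; exists (z, k'); split; rewrite // mem_iota /=; lia.
have bS := spanned_mem bB.
rewrite -mulrA; case: (ltngtP l.+1 (j.+1 - k)%N) => lk.
- rewrite descend_comm // mulrA; apply: base; first by lia.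
  by apply: IH => //; lia.
- have [le|gt] := leqP l (j.+1 - k)%N.
    case: k kI lk le => [|k] kI lk le; first by lia.
    have el : (j.+1 - k.+1)%N = l by lia.
    rewrite /= -mulrA el sgen_quad; last by lia.
    rewrite mulrDr mulr1 mulrDr -2!scalerAr; apply: spannedD.
      by apply: spannedZ; have := base k.+1 ltac:(lia) _ bS; rewrite /= el.
    by apply: base => //; lia.
  rewrite descend_shift; [|lia|lia].
  by rewrite mulrA; apply: base; [lia | apply: IH => //; lia].
- have el : (j.+1 - k.+1)%N = l by lia.
  by have := base k.+1 ltac:(lia) _ bS; rewrite /= el.
Qed.

Lemma hecke_spanned : exists l : seq H, size l = m`! /\ forall x, spanned l x.
Proof.
exists (hecke_basis m.-1); split.
  by rewrite size_hecke_basis; case: (m).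
have one : spanned (hecke_basis m.-1) 1.
  apply: spanned_mem; elim: (m.-1) => [|j IH]; first by rewrite inE.
  apply/allpairsP; exists (1, 0%N); split=> //=; by rewrite mulr1.
suff h t : forall x, spanned (hecke_basis m.-1) x ->
    spanned (hecke_basis m.-1) (x * hclass q t).
  by elim/hecke_ind=> t; rewrite -[hclass q t]mul1r; apply: h.
elim: t => [i|c|t IHt u IHu|t IHt u IHu] x xS.
- by rewrite -[hclass q _]/(sigma i) -sgenE; apply: hecke_basis_mul; rewrite ?ltn_ord /=.
- have -> : hclass q (TScal m c) = c *: 1 by rewrite [RHS]mulr1.
  by rewrite -scalerAr mulr1; apply: spannedZ.
- by rewrite hclassD mulrDr; apply: spannedD; [apply: IHt|apply: IHu].
- by rewrite hclassM mulrA; apply/IHu/IHt.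
Qed.

End HeckeSpanning.

Section Symmetriser.
Variables (F : fieldType) (q : F) (m : nat).
Hypothesis q0 : q != 0.

(** The regular module has dimension m! and is generated by rdelta 1, while H_m(q) is
    spanned by m! elements. *)
Lemma reg_act_inj (x y : hecke q m) :
  reg_act x (rdelta F 1%g) = reg_act y (rdelta F 1%g) -> x = y.
Proof.
have [_ _ rD _ rZ] := reg_actP m q0.
move=> xy; apply/eqP; rewrite -subr_eq0; apply/eqP.
have [l [sl sp]] := hecke_spanned q m.
have e : reg_act (x - y) (rdelta F 1%g) = 0.
  by rewrite -scaleN1r rD rZ xy scaleN1r subrr.
apply: (surjective_injective (P := 'S_m)
  (f := fun x w => reg_act x (rdelta F 1%g) w) sp).
- by rewrite sl card_Sn.
- by move=> a b p; rewrite rD ffunE.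
- by move=> c a p; rewrite rZ ffunE.
- move=> g; have [z hz] := reg_act_surj q0 [ffun w => g w].
  by exists z => p; rewrite hz ffunE.
- by move=> p; rewrite e ffunE.
Qed.

Lemma sigma_qsym (i : 'I_m.-1) : sigma i * qsym q m = q *: qsym q m.
Proof.
rewrite qsym_def -scalerAr (_ : sigma i * qsum q m = q *: qsum q m).
  by rewrite !scalerA mulrC.
exact/reg_act_inj/reg_act_sigma_qsum.
Qed.

End Symmetriser.

(** * Jucys-Murphy elements and density *)

Section Boxes.
Variable m : nat.
Implicit Types T U : filling m.

Definition boxes T : {set 'I_m * 'I_m} := [set T x | x in 'I_m].

Lemma boxes_swap T i : boxes (swap_tab T i) = boxes T.
Proof.
apply/setP=> p; apply/imsetP/imsetP => -[x _ ->]; exists (simple_tperm i x) => //.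
  by rewrite swap_tabE.
by rewrite swap_tabE simple_tpermK.
Qed.

Lemma mem_boxes T x : T x \in boxes T.
Proof. exact: imset_f. Qed.

Lemma boxes_perm T U : injective T -> injective U -> boxes T = boxes U ->
  exists w : 'S_m, forall x, T x = U (w x).
Proof.
move=> Ti Ui e.
have inU x : exists y, T x = U y.
  by have := mem_boxes T x; rewrite e => /imsetP[y _ ->]; exists y.
have [f fE] := choice inU.
have f_inj : injective f by move=> x y xy; apply: Ti; rewrite !fE xy.
by exists (perm f_inj) => x; rewrite permE.
Qed.

(** The permutation w relating T to U has a descent i unless T = U. The entries i and
    i+1 of T are then incomparable, and exchanging them shortens w. *)
Lemma standard_connect (P : filling m -> Prop) T U :
  standard T -> standard U -> boxes T = boxes U -> P T ->
  (forall S i, standard S -> standard (swap_tab S i) -> P S -> P (swap_tab S i)) ->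
  P U.
Proof.
move=> Ts Us TU PT step.
have [w Tw] := boxes_perm (standard_inj Ts) (standard_inj Us) TU.
have [n] := ubnP (perm_length w).
elim: n => // n IH in T Ts TU PT w Tw *; move=> lt.
have [w1|/perm_descent[i desc]] := eqVneq w 1%g.
  suff -> : U = T by [].
  by apply/ffunP => x; rewrite Tw w1 perm1.
have Ss : standard (swap_tab T i).
  apply: standard_swap => //; apply/negP; rewrite !Tw => /(standard_le Us).
  by rewrite leqNgt desc.
have Sw x : swap_tab T i x = U ((simple_tperm i * w)%g x) by rewrite swap_tabE Tw permM.
apply: (IH (swap_tab T i)) Sw _ => //; first by rewrite boxes_swap.
  exact: step.
by have := perm_length_down desc; lia.
Qed.

(** At the first entry where T and U differ, their boxes lie on one diagonal, and the
    smaller of the two is already filled in the other tableau. *)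
Lemma standard_content_inj T U : standard T -> standard U ->
  (forall x, content T x = content U x) -> T = U.
Proof.
move=> Ts Us TU; apply/ffunP => x; move: {2}(x : nat) (erefl (x : nat)) => n.
elim/ltn_ind: n x => n IH x xn.
wlog le : T U Ts Us TU IH / le_box (T x) (U x) => [sym|].
  have : le_box (T x) (U x) || le_box (U x) (T x).
    by have := TU x; rewrite /content /le_box; lia.
  case/orP => le; first exact: sym.
  by apply/esym/sym => // k kn y yk; apply/esym/(IH k).
have /standardP[_ h] := Us; have [y yx yT] := h _ _ le.
have [lt|] := ltnP y x; last first.
  by move=> xy; rewrite -yT; congr (U _); apply: val_inj => /=; lia.
have e : T y = U y by apply: (IH y); rewrite -?xn.
by move: lt; rewrite (standard_inj Ts (etrans e yT)) ltnn.
Qed.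

Lemma standard_first T (x : 'I_m) : standard T -> x = 0%N :> nat ->
  content T x = 0.
Proof.
move=> /standardP[_ h] x0; pose p : 'I_m * 'I_m := (x, x).
have [|y yx yp] := h x p; first by rewrite /le_box /= x0.
have <- : y = x by apply: val_inj => /=; lia.
by rewrite /content yp /p /= subrr.
Qed.

End Boxes.

Section Density.
Variables (F : fieldType) (q : F) (m : nat).
Hypothesis q0 : q != 0.
Hypothesis qint_neq0 : forall n, (0 < n)%N -> qint q n%:Z != 0.

Local Notation H := (hecke q m).
Local Notation V := (tabmod F m).
Implicit Types (T U S : filling m) (i : 'I_m.-1) (x y : H) (v : V).

Lemma tab_act0 v : tab_act (0 : H) v = 0.
Proof.
by have [_ _ _ _ rZ] := tab_actP m q0 qint_neq0; rewrite -(scale0r 0) rZ scale0r.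
Qed.

Lemma tab_act_sum (I : Type) (r : seq I) (P : pred I) (f : I -> H) v :
  tab_act (\sum_(i <- r | P i) f i) v = \sum_(i <- r | P i) tab_act (f i) v.
Proof.
have [_ _ rD _ rZ] := tab_actP m q0 qint_neq0.
by apply: (big_morph (fun x => tab_act x v)) => [x y|]; rewrite ?tab_act0.
Qed.

Lemma tab_act_linear x c v v' :
  tab_act x (c *: v + v') = c *: tab_act x v + tab_act x v'.
Proof. exact: (@term_act_linear F m V (fun i => tab_op q i)). Qed.

Lemma tab_actD x v v' : tab_act x (v + v') = tab_act x v + tab_act x v'.
Proof. by have := tab_act_linear x 1 v v'; rewrite !scale1r. Qed.

Lemma tab_actZ x c v : tab_act x (c *: v) = c *: tab_act x v.
Proof.
have z : tab_act x 0 = 0.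
  by have := tab_act_linear x (-1) 0 0; rewrite scaler0 addr0 scaleN1r addNr.
by have := tab_act_linear x c v 0; rewrite z !addr0.
Qed.

Definition diagonal x (d : filling m -> F) : Prop :=
  forall v T, standard T -> tab_act x v T = d T * v T.

(** The additive Jucys-Murphy elements; unlike those of their multiplicative versions,
    their eigenvalues separate contents when q^2 = 1 too. *)
Fixpoint jucys_murphy (k : nat) : H :=
  if k is k'.+1 then
    sgen q m k' * jucys_murphy k' * sgen q m k' + sgen q m k'
  else 0.

Lemma jucys_murphy_diagonal (k : 'I_m) :
  diagonal (jucys_murphy k) (fun T => gam q (content T k)).
Proof.
have [rs r1 rD rM rZ] := tab_actP m q0 qint_neq0.
case: k => k km; elim: k km => [|k IH] km v T Ts.
  by rewrite /= tab_act0 (standard_first Ts) // gam0 // mul0r ffunE.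
have ki : (k < m.-1)%N by rewrite ltn_predRL.
pose i := Ordinal ki.
have lo : Ordinal (ltnW km) = gen_lo i by apply: val_inj.
have hi : Ordinal km = gen_hi i by apply: val_inj.
have {IH} IH := IH (ltnW km); rewrite lo in IH; rewrite hi.
have J u S : standard S ->
    tab_act (jucys_murphy k) u S = gam q (content S (gen_lo i)) * u S by exact: IH.
have sg : sgen q m k = sigma i := sgenE q i.
rewrite /= sg rD !rM !rs ffunE.
set u := tab_op q i v.
have opE w S : standard S -> tab_op q i w S = dl q (acoef q (axdist S i)) (w S)
    ((standard (swap_tab S i))%:R * w (swap_tab S i)) by rewrite ffunE => ->.
rewrite [X in X + _]opE //.
have d0 := axdist_neq0 i Ts.
have ne : content T (gen_lo i) != content T (gen_hi i).
  by move: d0; rewrite subr_eq0 eq_sym.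
have e := acoef_gam q0 qint_neq0 ne; rewrite -[_ - _]/(axdist T i) in e.
set g := gam q _ in e; set g' := gam q _ in e *; set a := acoef q _ in e *.
(* The diagonal part of sigma_i J sigma_i + sigma_i, where g and g' are the
     eigenvalues of J at T and at its exchange. *)
have key : g' = a * a * g + (q - a) * (q^-1 + a) * g' + a.
  by rewrite -[LHS]addr0 -(mulr0 a) -e /kappa; field.
case: (boolP (standard (swap_tab T i))) => st; last first.
  have uT : u T = a * v T.
    by rewrite /u opE // (negbTE st) mul0r /dl mulr0 addr0.
  rewrite mul0r /dl mulr0 addr0 J // -/g uT.
  have aq : (q - a) * (q^-1 + a) = 0.
    have le : le_box (T (gen_lo i)) (T (gen_hi i)).
      by rewrite standard_swapE // negbK in st.
    case/orP: (standard_adjacent Ts le) => /andP[/eqP e1 /eqP e2].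
      have a1 : axdist T i = 1 by rewrite /axdist /content e1 e2; lia.
      by rewrite /a a1 acoef1 // subrr mul0r.
    have a1 : axdist T i = - 1 by rewrite /axdist /content e1 e2; lia.
    by rewrite /a a1 acoefN // acoef1 // /kappa; field.
  by rewrite key aq; ring.
have uT : u T = a * v T + (q - a) * v (swap_tab T i).
  by rewrite /u opE // st mul1r.
have uS : u (swap_tab T i) =
    (kappa q - a) * v (swap_tab T i) + (q^-1 + a) * v T.
  rewrite /u opE // swap_tabK Ts mul1r axdist_swap acoefN // /dl /kappa -/a.
  by field.
rewrite mul1r /dl !J // -/g uT uS content_swap simple_tperm_lo -/g'.
transitivity ((a * a * g + (q - a) * (q^-1 + a) * g' + a) * v T
  + (q - a) * (a * (g - g') + kappa q * g' + 1) * v (swap_tab T i)).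
  by ring.
by rewrite -key e mulr0 mul0r addr0.
Qed.

Lemma diagonal_mul x y d d' : diagonal x d -> diagonal y d' ->
  diagonal (x * y) (fun T => d T * d' T).
Proof.
have [_ _ _ rM _] := tab_actP m q0 qint_neq0.
by move=> dx dy v T Ts; rewrite rM dx // dy // mulrA.
Qed.

Lemma separate_two T S : standard T -> standard S -> S != T ->
  exists x d, [/\ diagonal x d, d T = 1 & d S = 0].
Proof.
move=> Ts Ss ST.
have [k ck] : exists k, content S k != content T k.
  case: (pickP (fun k => content S k != content T k)) => [k|no]; first by exists k.
  case/eqP: ST; apply: standard_content_inj => // k.
  by apply/eqP; have /negbFE := no k.
have [_ r1 rD _ rZ] := tab_actP m q0 qint_neq0.
set g := fun U => gam q (content U k).
have ne : g T - g S != 0.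
  by rewrite subr_eq0; apply: contra_neq ck => /gam_inj->.
exists ((g T - g S)^-1 *: (jucys_murphy k - g S *: 1)).
exists (fun U => (g T - g S)^-1 * (g U - g S)); split.
- move=> v U Us; rewrite rZ ffunE [_ *: _]/GRing.scale /=.
  rewrite -scaleN1r rD !rZ r1 !ffunE !/(_ *: _) /=.
  by rewrite (jucys_murphy_diagonal k) // -/(g U); ring.
- exact: mulVf.
- by rewrite subrr mulr0.
Qed.

Definition tab_delta T : V := [ffun U => (U == T)%:R].

Definition matrix_unit x T U : Prop :=
  forall v S, standard S -> tab_act x v S = (S == T)%:R * v U.

(** Lagrange interpolation in the Jucys-Murphy elements. *)
Lemma matrix_unit_diag T : standard T -> exists x, matrix_unit x T T.
Proof.
move=> Ts.
have h (l : seq (filling m)) : (forall S, S \in l -> standard S /\ S != T) ->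
    exists x d, [/\ diagonal x d, d T = 1 & forall S, S \in l -> d S = 0].
  elim: l => [|S l IH] hl.
    have [_ r1 _ _ _] := tab_actP m q0 qint_neq0.
    exists 1, (fun=> 1); split=> //.
    by move=> v S _; rewrite r1 mul1r.
  have [|x [d [dx dT dl]]] := IH; first by move=> U Ul; apply: hl; rewrite inE Ul orbT.
  have [Ss ST] := hl S (mem_head _ _).
  have [y [d' [dy dT' dS]]] := separate_two Ts Ss ST.
  exists (y * x), (fun U => d' U * d U); split; first exact: diagonal_mul.
    by rewrite dT dT' mulr1.
  by move=> U; rewrite inE => /orP[/eqP->|/dl->]; rewrite ?dS ?mul0r ?mulr0.
have [|x [d [dx dT dl]]] := h (enum [pred S | standard S && (S != T)]).
  by move=> S; rewrite mem_enum inE => /andP[].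
exists x => v S Ss; rewrite dx //; have [->|ST] := eqVneq S T.
  by rewrite dT.
by rewrite dl ?mul0r // mem_enum inE Ss ST.
Qed.

(** Along an admissible exchange sigma_i has a non-zero matrix coefficient, which
    links the two projections. *)
Lemma matrix_unit_exists T U : standard T -> standard U -> boxes T = boxes U ->
  exists x, matrix_unit x T U.
Proof.
move=> Ts Us TU; have [rs _ _ rM rZ] := tab_actP m q0 qint_neq0.
apply: (@standard_connect m (fun U => exists x, matrix_unit x T U) T U) => //.
  exact: matrix_unit_diag.
move=> S i Ss sS [x xS]; have [y yS] := matrix_unit_diag sS.
have ne : S != swap_tab S i.
  apply/eqP => /ffunP/(_ (gen_lo i)); rewrite swap_tabE simple_tperm_lo.
  by move=> /(standard_inj Ss)/eqP; rewrite (negbTE (gen_lo_hi i)).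
set b := q - acoef q (axdist S i).
have b0 : b != 0.
  apply: acoef_neq_q => //; first exact: axdist_neq0.
  by apply: contraTneq sS => /(axdist_row Ss) /(standard_swapN Ss).
exists (b^-1 *: (x * sigma i * y)) => v R Rs.
rewrite rZ ffunE [_ *: _]/GRing.scale /= !rM xS // rs ffunE Ss sS mul1r !yS //.
rewrite (negbTE ne) eqxx mul0r mul1r /dl mulr0 add0r -/b.
by rewrite mulrCA mulKf.
Qed.

Lemma realise_matrix (M : filling m -> filling m -> F) :
  (forall T U, standard T -> standard U -> boxes T != boxes U -> M T U = 0) ->
  exists x, forall v T, standard T ->
    tab_act x v T = \sum_(U | standard U) M T U * v U.
Proof.
move=> M0; have [_ _ _ _ rZ] := tab_actP m q0 qint_neq0.
pose P (TU : filling m * filling m) :=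
  [&& standard TU.1, standard TU.2 & boxes TU.1 == boxes TU.2].
have ex (TU : filling m * filling m) : exists x, P TU -> matrix_unit x TU.1 TU.2.
  case: (boolP (P TU)) => [/and3P[h1 h2 /eqP h3]|_]; last by exists 0.
  by have [x hx] := matrix_unit_exists h1 h2 h3; exists x.
have [e eP] := choice ex.
exists (\sum_(TU | P TU) M TU.1 TU.2 *: e TU) => v T Ts.
rewrite tab_act_sum sum_ffunE.
transitivity (\sum_(TU | P TU) (T == TU.1)%:R * (M T TU.2 * v TU.2)).
  apply: eq_bigr => TU PTU; rewrite rZ ffunE [_ *: _]/GRing.scale /= eP //.
  by have [->|] := eqVneq T TU.1; rewrite ?mul0r ?mulr0 // !mul1r.
rewrite [RHS](bigID (fun U => boxes T == boxes U)) /= [X in _ + X]big1 ?addr0; last first.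
  by move=> U /andP[Us TU]; rewrite M0 ?mul0r.
rewrite (bigID (fun TU : filling m * filling m => TU.1 == T)) /= [X in _ + X]big1 ?addr0; last first.
  by move=> TU /andP[_ /negbTE]; rewrite eq_sym => ->; rewrite mul0r.
rewrite (reindex_onto (fun U => (T, U)) snd) /=; last first.
  by move=> [a b] /andP[_ /eqP /= ->].
apply: eq_big => [U|U _]; last by rewrite eqxx mul1r.
by rewrite /P /= !eqxx Ts !andbT.
Qed.

End Density.

(** * Counting pairs of tableaux in Young's lattice *)

Section YoungLattice.
Variable N : nat.
Local Notation shape := {ffun 'I_N.+1 -> nat}.
Implicit Types (la mu : shape) (r s : 'I_N.+1) (w : seq 'I_N.+1).

Definition box_up la r : shape := [ffun s => la s + (s == r)]%N.
Definition box_down la r : shape := [ffun s => la s - (s == r)]%N.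

Definition decreasing la : bool :=
  [forall r : 'I_N.+1, forall s : 'I_N.+1, (r <= s)%N ==> (la s <= la r)%N].

Lemma decreasingP la :
  reflect (forall r s, (r <= s)%N -> (la s <= la r)%N) (decreasing la).
Proof.
apply: (iffP forallP) => [h r s rs|h r].
  by have /forallP/(_ s)/implyP := h r; apply.
by apply/forallP => s; apply/implyP/h.
Qed.

Definition counts w : shape := [ffun r => count_mem r w].

(** Lattice words: the standard tableaux, read as the sequence of the rows of
    their entries. *)
Fixpoint lattice_words (m : nat) : seq (seq 'I_N.+1) :=
  if m is m'.+1 then
    [seq rcons w r | w <- lattice_words m',
       r <- [seq r <- enum 'I_N.+1 | decreasing (box_up (counts w) r)]]
  else [:: [::]].
Arguments lattice_words : simpl never.

Lemma counts_rcons w r : counts (rcons w r) = box_up (counts w) r.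
Proof.
by apply/ffunP=> s; rewrite !ffunE -cats1 count_cat /= addn0 eq_sym.
Qed.

Lemma mem_lattice_words m w r : rcons w r \in lattice_words m.+1 =
  (w \in lattice_words m) && decreasing (counts (rcons w r)).
Proof.
apply/allpairsPdep/andP => [[w' [r' [w'm r'm /rcons_inj[-> ->]]]]|[wm wd]].
  by move: r'm; rewrite mem_filter counts_rcons => /andP[->].
by exists w, r; rewrite mem_filter mem_enum -counts_rcons wm wd.
Qed.

Lemma lattice_words_rcons m w : w \in lattice_words m.+1 ->
  exists w' r, w = rcons w' r.
Proof. by case/allpairsPdep=> w' [r [_ _ ->]]; exists w', r. Qed.

Lemma lattice_words_size m w : w \in lattice_words m -> size w = m.
Proof.
elim: m w => [|m IH] w; first by rewrite inE => /eqP->.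
move=> wm; have [w' [r e]] := lattice_words_rcons wm; move: wm.
by rewrite e mem_lattice_words size_rcons => /andP[/IH->].
Qed.

Lemma lattice_words_decreasing m w : w \in lattice_words m -> decreasing (counts w).
Proof.
case: m => [|m] wm; last first.
  have [w' [r e]] := lattice_words_rcons wm.
  by move: wm; rewrite e mem_lattice_words => /andP[].
move: wm; rewrite inE => /eqP->.
by apply/decreasingP => r s _; rewrite !ffunE.
Qed.

Lemma lattice_words_take m w n : w \in lattice_words m -> (n <= m)%N ->
  take n w \in lattice_words n.
Proof.
elim: m w => [|m IH] w wm; first by rewrite leqn0 => /eqP->; rewrite take0.
rewrite leq_eqVlt => /orP[/eqP->|nm].
  by rewrite take_oversize // (lattice_words_size wm).
have [w' [r e]] := lattice_words_rcons wm; move: wm; rewrite e mem_lattice_words.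
case/andP=> w'm _; rewrite -cats1 takel_cat ?(lattice_words_size w'm) //.
exact: IH.
Qed.

Lemma lattice_words_uniq m : uniq (lattice_words m).
Proof.
elim: m => // m IH; apply: allpairs_uniq_dep => //.
  by move=> w _; apply/filter_uniq/enum_uniq.
move=> [w r] [w' r'] _ _ /= /rcons_inj[-> ->] //.
Qed.

Definition npaths m la : nat := count (fun w => counts w == la) (lattice_words m).

Lemma npaths_decreasing m la : ~~ decreasing la -> npaths m la = 0%N.
Proof.
move=> nd; apply/eqP; rewrite -leqn0 leqNgt -has_count; apply/hasP=> -[w wm /eqP e].
by move: nd; rewrite -e (lattice_words_decreasing wm).
Qed.

Lemma npathsS m la : decreasing la ->
  npaths m.+1 la = (\sum_(r | 0 < la r) npaths m (box_down la r))%N.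
Proof.
move=> dl; rewrite /npaths -sum1_count big_mkcond big_allpairs_dep /=.
under [RHS]eq_bigr => r _ do rewrite -sum1_count big_mkcond /=.
rewrite exchange_big /=; apply: eq_bigr => w _.
rewrite big_filter big_enum_cond -big_mkcondr /= -big_mkcondr /=.
apply: eq_bigl => r; rewrite counts_rcons.
apply/andP/andP => [[_ /eqP <-]|[lr /eqP->]].
  rewrite ffunE eqxx addn1; split=> //; apply/eqP/ffunP => s.
  by rewrite !ffunE addnK.
have -> : box_up (box_down la r) r = la; last by [].
apply/ffunP => s; rewrite !ffunE; case: eqP => [->|_]; first by rewrite subnK.
by rewrite subn0 addn0.
Qed.

(** Adding a box in row r and removing one from row s commute when r and s differ, as
    both orders pass through partitions. *)
Lemma exchange_decreasing la r s : decreasing la -> r != s -> (0 < la s)%N ->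
  decreasing (box_up (box_down la s) r) ->
  decreasing (box_up la r) /\ decreasing (box_down la s).
Proof.
move=> /decreasingP d rs ls /decreasingP e.
have rsn : (r : nat) != s by [].
split; apply/decreasingP => a b ab; have := d _ _ ab; have := e _ _ ab;
  have eqb := (fun x y => esym (@val_eqE _ _ 'I_N.+1 x y)); rewrite !ffunE !eqb /=;
  case: (eqVneq (a : nat) r) => h1; case: (eqVneq (b : nat) r) => h2;
  case: (eqVneq (a : nat) s) => h3; case: (eqVneq (b : nat) s) => h4; try lia.
Qed.

(** Row 0 can always be enlarged, and row r+1 exactly when row r can be shrunk. *)
Lemma count_up_down la : decreasing la -> la ord_max = 0%N ->
  #|[pred r | decreasing (box_up la r)]| =
  #|[pred s | (0 < la s)%N && decreasing (box_down la s)]|.+1.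
Proof.
move=> /decreasingP d l0; rewrite -!sum1_card.
rewrite [in LHS]big_mkcond [in RHS]big_mkcond /=.
rewrite big_ord_recl [in RHS]big_ord_recr /= !inE l0 /= addn0 -[RHS]add1n; congr (_ + _)%N.
  have -> // : decreasing (box_up la ord0).
  apply/decreasingP => a b ab; rewrite !ffunE -!val_eqE /=.
  by have := d _ _ ab; lia.
apply: eq_bigr => i _; congr (if _ then _ else _); rewrite !inE.
set s := widen_ord _ i; set r := lift ord0 i.
have rs : r = s.+1 :> nat by rewrite lift0.
have sr : (s <= r)%N by rewrite rs.
have sne : (s == r) = false.
  by apply/eqP => e; move: (rs); rewrite -e; lia.
apply/decreasingP/andP => [h|[ls /decreasingP h] a b ab].
  have lt : (la r < la s)%N by have := h _ _ sr; rewrite !ffunE eqxx sne; lia.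
  split; first by apply: leq_ltn_trans lt.
  apply/decreasingP => a b ab; rewrite !ffunE.
  have [as_|_] := eqVneq a s; last by have := d _ _ ab; lia.
  rewrite as_ in ab *; have [_|bs] := eqVneq b s; first by have := d _ _ ab; lia.
  have : (la b <= la r)%N.
    by apply: d; rewrite rs ltn_neqAle ab andbT; apply: contra_neq bs => /val_inj.
  by lia.
rewrite !ffunE; have [br|_] := eqVneq b r; last by have := d _ _ ab; lia.
rewrite br in ab *; have [->//|ar] := eqVneq a r.
have as_ : (la s <= la a)%N.
  apply: d; rewrite -ltnS -rs ltn_neqAle ab andbT.
  by apply: contra_neq ar => /val_inj.
by have := h _ _ sr; rewrite !ffunE eqxx eq_sym sne; lia.
Qed.

Lemma last_row_empty la : decreasing la -> (\sum_r la r <= N)%N ->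
  la ord_max = 0%N.
Proof.
move=> /decreasingP d le; apply/eqP; rewrite -leqn0 leqNgt; apply/negP => pos.
have : (\sum_(r : 'I_N.+1) 1 <= \sum_r la r)%N.
  by apply: leq_sum => r _; apply: leq_trans pos (d _ _ _); rewrite -ltnS.
by rewrite sum1_card card_ord; lia.
Qed.

Lemma box_up_down la r s : r != s -> (0 < la s)%N ->
  box_down (box_up la r) s = box_up (box_down la s) r.
Proof.
move=> rs ls; apply/ffunP => t; rewrite !ffunE.
have [->|_] := eqVneq t s; last by rewrite !subn0.
by rewrite eq_sym (negbTE rs) !addn0.
Qed.

Lemma sum_box_down la s : (0 < la s)%N ->
  (\sum_r box_down la s r)%N = (\sum_r la r).-1.
Proof.
move=> ls; rewrite (bigD1 s) //= [in RHS](bigD1 s) //= ffunE eqxx.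
have -> : (\sum_(r | r != s) box_down la s r = \sum_(r | r != s) la r)%N.
  by apply: eq_bigr => r /negbTE rs; rewrite ffunE rs subn0.
by move: ls; case: (la s) => // a _; rewrite subn1.
Qed.

Definition exchange_sum m la : nat :=
  \sum_r \sum_(s | (s != r) && (0 < la s)) npaths m (box_up (box_down la s) r).

Lemma npaths_up_expand m la : decreasing la ->
  (\sum_(r | decreasing (box_up la r)) npaths m.+1 (box_up la r) =
   #|[pred r | decreasing (box_up la r)]| * npaths m la + exchange_sum m la)%N.
Proof.
move=> dl; rewrite -sum_nat_const /exchange_sum.
rewrite [X in (_ + X)%N](bigID (fun r => decreasing (box_up la r))) /=.
rewrite [X in (_ + (_ + X))%N]big1 => [|r nd]; last first.
  apply: big1 => s /andP[sr ls]; apply: npaths_decreasing.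
  apply: contra nd => e.
  by have [] := exchange_decreasing dl _ ls e; rewrite // eq_sym.
rewrite addn0 -big_split /=; apply: eq_bigr => r dr.
rewrite npathsS // (bigD1 r) /= ?ffunE ?eqxx ?addn1 //; congr (_ + _)%N.
  by congr npaths; apply/ffunP => s; rewrite !ffunE addnK.
apply: eq_big => [s|s /andP[ls sr]].
  by rewrite ffunE andbC; case: eqP => //= _; rewrite addn0.
rewrite box_up_down //; first by rewrite eq_sym.
by move: ls; rewrite ffunE (negbTE sr) addn0.
Qed.

(** The branching identity dual to npathsS. In both ways of moving a box the pairs of
    distinct rows contribute exchange_sum, so only the difference of count_up_down
    remains. *)
Lemma npaths_up m la : decreasing la -> (\sum_r la r)%N = m -> (m <= N)%N ->
  (\sum_(r | decreasing (box_up la r)) npaths m.+1 (box_up la r))%N =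
  (m.+1 * npaths m la)%N.
Proof.
elim: m la => [|m IH] la dl sz mN; rewrite npaths_up_expand // count_up_down //
  ?last_row_empty ?sz //; set R := #|_|.
  have la0 r : la r = 0%N.
    by apply/eqP; rewrite -leqn0 -sz (bigD1 r) //= leq_addr.
  have -> : R = 0%N by apply: eq_card0 => s; rewrite !inE la0.
  rewrite /exchange_sum big1 ?addn0 // => r _.
  by apply: big1 => s; rewrite la0 andbF.
suff down : (m.+1 * npaths m.+1 la =
    R * npaths m.+1 la + exchange_sum m.+1 la)%N.
  by rewrite [RHS]mulSn down mulSn addnA.
rewrite {1}npathsS // big_distrr /= (bigID (fun s => decreasing (box_down la s))) /=.
rewrite [X in (_ + X)%N]big1 ?addn0 => [|s /andP[_ /npaths_decreasing->]]; last first.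
  by rewrite muln0.
transitivity (\sum_(s | (0 < la s) && decreasing (box_down la s))
   (npaths m.+1 la + \sum_(r | s != r) npaths m.+1 (box_up (box_down la s) r)))%N.
  apply: eq_bigr => s /andP[ls ds]; rewrite -IH ?sum_box_down ?sz //; last by lia.
  have us : box_up (box_down la s) s = la.
    by apply/ffunP => t; rewrite !ffunE; case: eqP => [->|_]; rewrite ?subnK ?subn0 ?addn0.
  rewrite (bigD1 s) /= us //; congr (_ + _)%N.
  rewrite [RHS](bigID (fun r => decreasing (box_up (box_down la s) r))) /=.
  rewrite [X in (_ + X)%N]big1 ?addn0 => [|r /andP[_ /npaths_decreasing->]] //.
  by apply: eq_bigl => r; rewrite andbC eq_sym.
rewrite big_split /= sum_nat_const; congr (_ + _)%N.
rewrite /exchange_sum [RHS](exchange_big_dep (fun s => 0 < la s)%N) /=; last first.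
  by move=> r s _ /andP[].
rewrite [RHS](bigID (fun s => decreasing (box_down la s))) /=.
rewrite [X in (_ = _ + X)%N]big1 ?addn0 => [|s /andP[ls nd]].
  apply: eq_bigr => s /andP[ls _]; apply: eq_bigl => r.
  by rewrite ls andbT.
apply: big1 => r /andP[sr _]; apply: npaths_decreasing; apply: contra nd => e.
by have [] := exchange_decreasing dl _ ls e; rewrite // eq_sym.
Qed.

Lemma sum_counts w : (\sum_r counts w r)%N = size w.
Proof.
elim: w => [|x w IH]; first by apply: big1 => r _; rewrite ffunE.
rewrite /= -IH -[RHS]add1n (eq_bigr (fun r => (x == r) + counts w r)%N) => [|r _].
  rewrite big_split /=; congr (_ + _)%N.
  by rewrite (bigD1 x) //= eqxx big1 // => r; rewrite eq_sym => /negbTE->.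
by rewrite !ffunE.
Qed.

(** The left-hand side counts the pairs of standard tableaux of one shape; by npaths_up
    it is multiplied by m + 1 from m to m + 1. *)
Lemma sum_npaths m : (m <= N.+1)%N ->
  (\sum_(w <- lattice_words m) npaths m (counts w))%N = m`!.
Proof.
elim: m => [|m IH] mN.
  by rewrite big_cons big_nil /npaths /= eqxx.
rewrite big_allpairs_dep /= factS -IH; last by lia.
rewrite big_distrr /=; apply: eq_big_seq => w wm.
have {}wm : w \in lattice_words m := wm.
rewrite -npaths_up ?sum_counts ?(lattice_words_size wm) //; last first.
  exact: lattice_words_decreasing wm.
rewrite big_filter big_enum_cond /=.
by apply: eq_bigr => r _; rewrite counts_rcons.
Qed.

End YoungLattice.

(** * Faithfulness *)

Section WordFillings.
Variable N : nat.
Implicit Types (w : seq 'I_N.+1) (x : 'I_N.+1).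

Definition word_filling w : filling N.+1 :=
  [ffun x : 'I_N.+1 => (nth ord0 w x, inord (count_mem (nth ord0 w x) (take x w)))].

Lemma count_take_occurrence w (r : 'I_N.+1) n c : (c < count_mem r (take n w))%N ->
  exists y, [/\ (y < n)%N, (y < size w)%N, nth ord0 w y = r &
    count_mem r (take y w) = c].
Proof.
elim: n => [|n IH]; first by rewrite take0.
have [nw|nw] := ltnP n (size w); last first.
  rewrite take_oversize; last by exact: leqW.
  rewrite -{1}(take_oversize nw) => /IH[y [yn yw e1 e2]].
  by exists y; split=> //; apply: ltnW.
rewrite (take_nth ord0 nw) -cats1 count_cat /= addn0.
have [lt _|ge] := ltnP c (count_mem r (take n w)).
  by have [y [yn yw e1 e2]] := IH lt; exists y; split=> //; apply: ltnW.
case: eqP => [e|_]; last by rewrite addn0 ltnNge ge.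
by rewrite addn1 ltnS => le; exists n; split=> //; apply/eqP; rewrite eqn_leq ge.
Qed.

Lemma count_take_le w (r : 'I_N.+1) n n' : (n <= n')%N ->
  (count_mem r (take n w) <= count_mem r (take n' w))%N.
Proof.
by move=> nn; rewrite -(subnKC nn) takeD count_cat leq_addr.
Qed.

Variables (w : seq 'I_N.+1).
Hypothesis wm : w \in lattice_words N N.+1.

Let sw : size w = N.+1 := lattice_words_size wm.

Lemma word_filling_col x : ((word_filling w x).2 : nat) =
  count_mem (nth ord0 w x) (take x w).
Proof.
rewrite ffunE /= inordK //; apply: leq_ltn_trans (count_size _ _) _.
by rewrite size_take sw ltn_ord ltn_ord.
Qed.

Lemma word_filling_row x : (word_filling w x).1 = nth ord0 w x.
Proof. by rewrite ffunE. Qed.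

Lemma count_take_decreasing n (r s : 'I_N.+1) : (r <= s)%N -> (n <= N.+1)%N ->
  (count_mem s (take n w) <= count_mem r (take n w))%N.
Proof.
move=> rs nN; have /lattice_words_decreasing := lattice_words_take wm nN.
by move/decreasingP/(_ _ _ rs); rewrite !ffunE.
Qed.

Lemma count_take_next x (r : 'I_N.+1) : nth ord0 w x = r ->
  count_mem r (take x.+1 w) = (count_mem r (take x w)).+1.
Proof.
move=> e; rewrite (take_nth ord0) ?sw // e -cats1 count_cat /= eqxx.
by rewrite addn0 addn1.
Qed.

Lemma word_filling_standard : standard (word_filling w).
Proof.
have lt x (y : 'I_N.+1) : (x < y)%N -> word_filling w x <> word_filling w y.
  move=> xy e; have er := congr1 fst e; rewrite !word_filling_row in er.
  have := congr1 (fun p : 'I_N.+1 * 'I_N.+1 => p.2 : nat) e.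
  rewrite /= !word_filling_col er.
  have := count_take_le w (nth ord0 w y) xy; rewrite count_take_next //; lia.
apply/standardP; split=> [x y e|x p].
  apply: val_inj; case: (ltngtP x y) => // xy; first by have /(_ e) := lt _ _ xy.
  by have /(_ (esym e)) := lt _ _ xy.
case/andP; rewrite word_filling_row word_filling_col => pr pc.
have [|y [yx yw e1 e2]] := @count_take_occurrence w p.1 x.+1 p.2.
  apply: leq_trans (count_take_decreasing pr (ltn_ord x)).
  by rewrite (count_take_next (erefl _)).
rewrite sw in yw; exists (Ordinal yw) => //.
rewrite [LHS]surjective_pairing [RHS]surjective_pairing; congr (_, _).
  by rewrite word_filling_row.
by apply: val_inj; rewrite /= word_filling_col /= e1.
Qed.

Lemma word_filling_boxes :
  boxes (word_filling w) =
  [set p : 'I_N.+1 * 'I_N.+1 | (p.2 < counts w p.1)%N].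
Proof.
apply/setP=> p; rewrite inE ffunE; apply/imsetP/idP => [[x _ ->]|lt].
  rewrite word_filling_row word_filling_col -(count_take_next (erefl _)).
  have := @count_take_le w (nth ord0 w x) x.+1 (size w).
  by rewrite take_size; apply; rewrite sw.
have [|y [_ yw e1 e2]] := @count_take_occurrence w p.1 (size w) p.2.
  by rewrite take_size.
rewrite sw in yw; exists (Ordinal yw) => //.
rewrite [LHS]surjective_pairing [RHS]surjective_pairing; congr (_, _).
  by rewrite word_filling_row.
by apply: val_inj; rewrite /= word_filling_col /= e1.
Qed.

End WordFillings.

Lemma word_filling_inj N (w w' : seq 'I_N.+1) :
  w \in lattice_words N N.+1 -> w' \in lattice_words N N.+1 ->
  word_filling w = word_filling w' -> w = w'.
Proof.
move=> wm wm' e; have s := lattice_words_size wm; have s' := lattice_words_size wm'.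
apply: (@eq_from_nth _ ord0) => [|i]; first by rewrite s s'.
rewrite s => iN; have := word_filling_row w (Ordinal iN).
by rewrite e word_filling_row.
Qed.

Definition same_shape m : pred (filling m * filling m) :=
  [pred TU | [&& standard TU.1, standard TU.2 & boxes TU.1 == boxes TU.2]].

(** Lattice words inject into standard fillings, and words with the same counts give the
    same shape. *)
Lemma card_same_shape m : (m`! <= #|@same_shape m|)%N.
Proof.
case: m => [|N].
  have s0 (T : filling 0) : standard T.
    by apply/standardP; split=> [] [].
  apply/card_gt0P; exists ([ffun x => (x, x)], [ffun x => (x, x)]).
  by rewrite !inE !s0 eqxx.
pose L := [seq (w, w') | w <- lattice_words N N.+1,
  w' <- [seq w' <- lattice_words N N.+1 | counts w' == counts w]].
have sL : size L = N.+1`!.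
  rewrite -(@sum_npaths N N.+1 (leqnn _)) size_allpairs_dep sumnE big_map.
  by apply: eq_bigr => w _; rewrite size_filter.
have memL p : p \in L -> [/\ p.1 \in lattice_words N N.+1,
    p.2 \in lattice_words N N.+1 & counts p.1 = counts p.2].
  case/allpairsPdep=> w [w' [wm]]; rewrite mem_filter => /andP[/eqP e w'm] ->.
  by split.
have uL : uniq L.
  apply: allpairs_uniq_dep; first exact: lattice_words_uniq.
    by move=> w _; apply/filter_uniq/lattice_words_uniq.
  by move=> [a b] [c d] _ _ /= [-> ->].
pose f (p : seq 'I_N.+1 * seq 'I_N.+1) := (word_filling p.1, word_filling p.2).
have fL : uniq (map f L).
  rewrite map_inj_in_uniq // => -[a b] [c d] /memL[/= am bm _] /memL[/= cm dm _].
  by case=> /(word_filling_inj am cm)-> /(word_filling_inj bm dm)->.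
rewrite -sL -(size_map f) cardE; apply: uniq_leq_size => // _ /mapP[p /memL[pm p'm e] ->].
rewrite mem_enum !inE /= !word_filling_standard //= !word_filling_boxes // e.
exact: eqxx.
Qed.

Section Faithful.
Variables (F : fieldType) (q : F) (m : nat).
Hypothesis q0 : q != 0.
Hypothesis qint_neq0 : forall n, (0 < n)%N -> qint q n%:Z != 0.

(** H_m(q) is spanned by m! elements and acts on the span of the standard fillings
    by all block matrices, of which there are at least m! independent ones. *)
Lemma tab_act_faithful (x : hecke q m) :
  (forall v T, standard T -> tab_act x v T = 0) -> x = 0.
Proof.
have [_ _ rD _ rZ] := tab_actP m q0 qint_neq0.
move=> x0; have [l [sl sp]] := hecke_spanned q m.
pose P := {TU : filling m * filling m | same_shape TU}.
apply: (@surjective_injective _ _ P l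
  (fun x (p : P) => tab_act x (tab_delta F (val p).2) (val p).1) sp).
- by rewrite sl card_sig; apply: leq_trans (card_same_shape m) _.
- by move=> a b p; rewrite rD ffunE.
- by move=> c a p; rewrite rZ ffunE.
- move=> g; pose M T U := if insub (T, U) : option P is Some p then g p else 0.
  have [|z zM] := @realise_matrix F q m q0 qint_neq0 M.
    move=> T U Ts Us TU; by rewrite /M insubN // /same_shape /= (negbTE TU) !andbF.
  exists z => p; case/and3P: (valP p) => s1 s2 _.
  rewrite zM // (bigD1 (val p).2) //= ffunE eqxx mulr1 big1 ?addr0.
    by rewrite /M -surjective_pairing valK.
  by move=> U /andP[_ /negbTE ne]; rewrite ffunE ne mulr0.
- by move=> p; rewrite x0 //; case/and3P: (valP p).
Qed.

Lemma tab_act_inj (x y : hecke q m) :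
  (forall v T, standard T -> tab_act x v T = tab_act y v T) -> x = y.
Proof.
have [_ _ rD _ rZ] := tab_actP m q0 qint_neq0.
move=> xy; apply/eqP; rewrite -subr_eq0; apply/eqP/tab_act_faithful => v T Ts.
by rewrite -scaleN1r rD rZ !ffunE xy // scaleN1r subrr.
Qed.

End Faithful.

(** * The q-symmetriser and its parabolic products *)

Section QEigenvectors.
Variables (F : fieldType) (q : F) (m : nat).
Hypothesis q0 : q != 0.

Local Notation qsum := (qsum q m).

Lemma qsum_eigen (V : lmodType F) (act : hecke q m -> V -> V) (v : V) :
  (forall u, act 1 u = u) ->
  (forall x y u, act (x + y) u = act x u + act y u) ->
  (forall x y u, act (x * y) u = act x (act y u)) ->
  (forall c x u, act (c *: x) u = c *: act x u) ->
  (forall x c u, act x (c *: u) = c *: act x u) ->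
  (forall i, act (sigma i) v = q *: v) -> act qsum v = poincare q m *: v.
Proof.
move=> a1 aD aM aZ aV av.
have a0 u : act 0 u = 0 by rewrite -(scale0r 0) aZ scale0r.
rewrite /qsum (big_morph (fun x => act x v) (id1 := 0) (op1 := +%R)) //.
rewrite /poincare scaler_suml; apply: eq_bigr => w _.
have [s [/andP[_ /eqP sl] ->]] := sigma_perm_word q w.
rewrite aZ mul2n -addnn exprD -scalerA -sl; congr (_ *: _).
elim: s {sl} => [|i s IH]; first by rewrite big_nil a1 scale1r.
by rewrite big_cons aM IH aV av scalerA exprSr.
Qed.

(** In the regular module such an element becomes a constant function, like qsum. *)
Lemma qsum_spans (x : hecke q m) : (forall i, sigma i * x = q *: x) ->
  exists c, x = c *: qsum.
Proof.
have [r1 _ _ rM rZ] := reg_actP m q0.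
move=> hx; set v := reg_act x (rdelta F 1%g).
have vi i : reg_op q i v = q *: v by rewrite -r1 -rM hx rZ.
have step i w : v (simple_tperm i * w)%g = v w.
  have e := congr1 (fun u : regmod F m => u w) (vi i); rewrite !ffunE in e.
  apply: dl_fixed e; rewrite /desc_coef /kappa.
  by case: ifP => _; rewrite ?subr0 // opprB addrC subrK invr_eq0.
have const w : v w = v 1%g.
  have [s /andP[/eqP <- _]] := reduced_word_exists w.
  by elim: s => [|i s IH]; rewrite ?big_nil // big_cons step.
exists (v 1%g); apply: (reg_act_inj q0); rewrite rZ reg_act_qsum // -/v.
by apply/ffunP => w; rewrite !ffunE const [RHS]mulr1.
Qed.

Hypothesis qint_neq0 : forall n, (0 < n)%N -> qint q n%:Z != 0.

(** The element of H_m(q) that acts by 1 on the one-row module and by 0 on the other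
    irreducible ones is a multiple of qsum, which acts by the Poincare polynomial
    there. *)
Lemma poincare_neq0 : poincare q m != 0.
Proof.
pose T0 : filling m := [ffun x => (insubd x 0%N, x)].
have row x : ((T0 x).1 : nat) = 0%N.
  by rewrite ffunE /= val_insubd (leq_ltn_trans _ (ltn_ord x)).
have col x : (T0 x).2 = x by rewrite ffunE.
have Ts : standard T0.
  apply/standardP; split=> [x y e|x p]; first by rewrite -(col x) e col.
  rewrite /le_box row col leqn0 => /andP[/eqP p1 p2]; exists p.2 => //.
  rewrite [LHS]surjective_pairing [RHS]surjective_pairing col; congr (_, _).
  by apply: val_inj; rewrite /= row p1.
have le i : le_box (T0 (gen_lo i)) (T0 (gen_hi i)) by rewrite /le_box !row !col /=.
have a1 i : axdist T0 i = 1.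
  by rewrite /axdist /content !row !col /=; lia.
have [h hT] := matrix_unit_diag q0 qint_neq0 Ts.
have [r1 t1 rD rM rZ] := tab_actP m q0 qint_neq0.
have hq i : sigma i * h = q *: h.
  apply: (tab_act_inj q0 qint_neq0) => v S Ss.
  rewrite rM r1 rZ tab_scaleE tab_opE // !(hT v S Ss).
  case: (boolP (standard (swap_tab S i))) => sS; last first.
    rewrite mul0r; have [->|ST] := eqVneq S T0; last by rewrite /dl !mul0r !mulr0 addr0.
    by rewrite a1 acoef1 // mul1r /dl mulr0 addr0.
  rewrite hT // mul1r.
  have [e|ne] := eqVneq S T0.
    by move: sS; rewrite e (negbTE (standard_swapN _ _)).
  have -> : (swap_tab S i == T0) = false.
    by apply/eqP => e; move: Ss; rewrite -(swap_tabK i S) e (negbTE (standard_swapN _ _)).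
  by rewrite /dl !mul0r !mulr0 addr0.
have [c hc] := qsum_spans hq.
have ev i : tab_act (sigma i : hecke q m) (tab_delta F T0) = q *: tab_delta F T0.
  rewrite r1; apply/ffunP => S; rewrite tab_scaleE.
  case: (boolP (standard S)) => Ss; last exact: tab_op_nonstd.
  rewrite tab_opE // [tab_delta F T0 S]ffunE [tab_delta F T0 _]ffunE.
  have [->|ST] := eqVneq S T0.
    by rewrite a1 acoef1 // (negbTE (standard_swapN _ _)) // mul0r /dl mulr0 addr0.
  case: (eqVneq (swap_tab S i) T0) => [e|_]; last by rewrite /dl !mulr0 addr0.
  by move: Ss; rewrite -(swap_tabK i S) e (negbTE (standard_swapN _ _)).
have := hT (tab_delta F T0) T0 Ts; rewrite hc rZ.
rewrite (qsum_eigen t1 rD rM rZ _ ev) => [|x a u]; last exact: tab_actZ.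
rewrite !tab_scaleE eqxx mul1r [tab_delta F T0 T0]ffunE eqxx !mulr1 => e.
by apply: contra_eq_neq e => ->; rewrite mulr0 eq_sym oner_eq0.
Qed.

End QEigenvectors.

Section Blocks.
Variables (k : nat -> nat) (n : nat).
Local Notation m := (fused_size k n).

Definition offset (k : nat -> nat) (b : nat) : nat := \sum_(j < b) k j.

Lemma offsetS b : offset k b.+1 = (offset k b + k b)%N.
Proof. by rewrite /offset big_ord_recr. Qed.

Lemma offset_le b c : (b <= c)%N -> (offset k b <= offset k c)%N.
Proof.
by move=> /subnKC <-; elim: (c - b)%N => [|d IH]; rewrite ?addn0 // addnS offsetS; lia.
Qed.

(** The index of the block of x, defined as a number of blocks in order to be
    visibly monotone. *)
Definition block (k : nat -> nat) (n x : nat) : nat :=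
  \sum_(b < n) (offset k b.+1 <= x).

Lemma block_homo : {homo block k n : x y / (x <= y)%N}.
Proof.
move=> x y xy; apply: leq_sum => b _.
by case: (leqP _ x) => //= h; rewrite (leq_trans h xy).
Qed.

Lemma blockE b x : (b < n)%N -> (offset k b <= x < offset k b.+1)%N ->
  block k n x = b.
Proof.
move=> bn /andP[bx xb]; rewrite /block -(big_mkord xpredT (fun c => (offset k c.+1 <= x)%N : nat)).
rewrite (big_cat_nat (n := b)) //= ?(ltnW bn) //.
rewrite big_nat_cond (eq_bigr (fun=> 1%N)) => [|c /andP[/andP[_ cb] _]]; last first.
  by rewrite (leq_trans (offset_le cb) bx).
rewrite -big_nat_cond sum_nat_const_nat subn0 muln1.
rewrite big_nat_cond big1 ?addn0 // => c /andP[/andP[bc _] _].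
by rewrite leqNgt (leq_trans xb) // offset_le.
Qed.

Lemma block_bounds x : (x < m)%N -> (block k n x < n)%N /\
  (offset k (block k n x) <= x < offset k (block k n x).+1)%N.
Proof.
move=> xm.
have [b [bn bx]] : exists b, (b < n)%N /\ (offset k b <= x < offset k b.+1)%N.
  move: xm; rewrite /fused_size -[X in (_ < X)%N]/(offset k n).
  elim: (n) => [|c IH]; first by rewrite /offset big_ord0.
  have [lt _|ge lt] := ltnP x (offset k c); last by exists c; rewrite ltnSn ge lt.
  by have [b [bc h]] := IH lt; exists b; rewrite h ltnW.
by rewrite (blockE bn bx).
Qed.

Lemma in_block_gen (i : 'I_m.-1) :
  block k n (gen_lo i) = block k n (gen_hi i) ->
  exists (b : 'I_n) (l : 'I_(k b).-1), i = shift_gen (block_subproof k b) l.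
Proof.
move=> e; have [bn b1] := block_bounds (ltn_ord (gen_lo i)).
have [_ b2] := block_bounds (ltn_ord (gen_hi i)); rewrite -e in b2.
move: b1 b2; set b := block k n (gen_lo i) in bn *; rewrite offsetS => b1 b2.
have lk : (i - offset k b < (k b).-1)%N by move: b1 b2 => /=; lia.
exists (Ordinal bn), (Ordinal lk); apply: val_inj => /=.
by rewrite -[\sum_(j < b) _]/(offset k b) subnKC //; case/andP: b1.
Qed.

Lemma gen_in_block (b : 'I_n) (l : 'I_(k b).-1) :
  let i := shift_gen (block_subproof k b) l in
  block k n (gen_lo i) = b /\ block k n (gen_hi i) = b.
Proof.
have lk := gen_hi_subproof l.
by split; apply: blockE => //=; rewrite offsetS -[\sum_(j < b) _]/(offset k b); lia.
Qed.

End Blocks.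

Section FusedIdempotent.
Variables (F : fieldType) (q : F).
Hypothesis q0 : q != 0.
Hypothesis qint_neq0 : forall n, (0 < n)%N -> qint q n%:Z != 0.

Lemma parabolic_comm a p m (ap : (a + p <= m)%N) (y : hecke q m) :
  (forall j, y * sigma (shift_gen ap j) = sigma (shift_gen ap j) * y) ->
  forall x, y * parabolic ap x = parabolic ap x * y.
Proof.
move=> h; elim/hecke_ind => t.
rewrite /parabolic (hecke_lift_class (shift_gen_rel q ap)).
elim: t => //= [c|t IHt u IHu|t IHt u IHu].
- by rewrite -scalerAr -scalerAl mul1r mulr1.
- by rewrite mulrDl mulrDr IHt IHu.
- by rewrite mulrA IHt -mulrA IHu mulrA.
Qed.

Variables (k : nat -> nat) (n : nat).
Local Notation m := (fused_size k n).
Local Notation e := (fusedP q k n).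

(** The factors of the other blocks commute with the generator, and the one of its own
    block turns it into q. *)
Lemma sigma_fusedP (i : 'I_m.-1) :
  block k n (gen_lo i) = block k n (gen_hi i) -> sigma i * e = q *: e.
Proof.
move=> /in_block_gen[b [l il]]; rewrite /fusedP.
have: b \in index_enum 'I_n by rewrite mem_index_enum.
elim: (index_enum _) => // c r IH; rewrite inE big_cons.
have [<- _|bc /= /IH {}IH] := eqVneq b c.
  have [L1 _ _ LM LZ] := hecke_liftP (shift_gen_rel q (block_subproof k b)).
  rewrite mulrA il -L1 -[hecke_lift _ (sigma l)]/(parabolic _ _).
  by rewrite /parabolic -LM sigma_qsym // LZ scalerAl.
rewrite mulrA parabolic_comm => [|j]; first by rewrite -mulrA IH scalerAr.
have [h1 h2] := gen_in_block l; rewrite -il in h1 h2.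
have [h3 h4] := gen_in_block j; set i' := shift_gen _ j in h3 h4 *.
have [lt|lt|e'] := ltngtP b c; last by case/eqP: bc; apply: val_inj.
- apply: (hecke_comm (sigma_rel q m)); rewrite ltnNge; apply/negP => le.
  have : (c <= b)%N by rewrite -h3 -h2; apply: block_homo.
  by rewrite leqNgt lt.
- apply/esym/(hecke_comm (sigma_rel q m)); rewrite ltnNge; apply/negP => le.
  have : (b <= c)%N by rewrite -h1 -h4; apply: block_homo.
  by rewrite leqNgt lt.
Qed.

Lemma fusedP_fixes (v : tabmod F m) :
  (forall i : 'I_m.-1, block k n (gen_lo i) = block k n (gen_hi i) ->
     tab_op q i v = q *: v) ->
  tab_act e v = v.
Proof.
move=> hv; have [r1 t1 rD rM rZ] := tab_actP m q0 qint_neq0.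
rewrite /fusedP; elim: (index_enum _) => [|b r IH]; first by rewrite big_nil t1.
rewrite big_cons rM IH.
have [L1 L2 LD LM LZ] := hecke_liftP (shift_gen_rel q (block_subproof k b)).
rewrite /parabolic qsym_def LZ rZ.
rewrite (qsum_eigen (act := fun x => tab_act (hecke_lift _ x))).
- by rewrite scalerA mulVf ?scale1r //; apply: poincare_neq0.
- by move=> u; rewrite L2 t1.
- by move=> x y u; rewrite LD rD.
- by move=> x y u; rewrite LM rM.
- by move=> c x u; rewrite LZ rZ.
- by move=> x c u; apply: tab_actZ.
- move=> i; rewrite L1 r1 hv //.
  by have [-> ->] := gen_in_block i.
Qed.

End FusedIdempotent.

(** * Semistandard tableaux as a basis of the invariants *)

Section TabModuleSupport.
Variables (F : fieldType) (q : F) (m : nat).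
Local Notation V := (tabmod F m).

Lemma tab_act_stable (P : V -> Prop) :
  (forall c v v', P v -> P v' -> P (c *: v + v')) ->
  (forall i v, P v -> P (tab_op q i v)) ->
  forall (x : hecke q m) v, P v -> P (tab_act x v).
Proof.
move=> Plin Pop x; rewrite /tab_act /hecke_act.
have P0 v : P v -> P 0 by move=> Pv; have := Plin (-1) v v Pv Pv; rewrite scaleN1r addNr.
elim: (repr x) => /= [i|c|t IHt u IHu|t IHt u IHu] v Pv.
- exact: Pop.
- by have := Plin c v 0 Pv (P0 v Pv); rewrite addr0.
- by have := Plin 1 _ _ (IHt v Pv) (IHu v Pv); rewrite scale1r.
- exact/IHt/IHu.
Qed.

Lemma tab_act_boxes (b : {set 'I_m * 'I_m}) (x : hecke q m) (v : V) :
  (forall T, standard T -> boxes T != b -> v T = 0) ->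
  forall T, standard T -> boxes T != b -> tab_act x v T = 0.
Proof.
apply: (@tab_act_stable (fun v => forall T, standard T -> boxes T != b -> v T = 0)).
  by move=> c u u' h h' T Ts Tb; rewrite ffunE tab_scaleE h // h' // mulr0 addr0.
move=> i u h T Ts Tb; rewrite tab_opE // h // /dl mulr0 add0r.
by case: (boolP (standard _)) => sT; rewrite ?mul0r ?mulr0 // h ?boxes_swap ?mulr0.
Qed.

Lemma tab_act_standard (x : hecke q m) (v v' : V) :
  (forall T, standard T -> v T = v' T) ->
  forall T, standard T -> tab_act x v T = tab_act x v' T.
Proof.
move=> vv T Ts; apply/eqP; rewrite -subr_eq0; apply/eqP.
suff : tab_act x (v - v') T = 0.
  by rewrite -scaleN1r tab_actD tab_actZ ffunE tab_scaleE mulN1r.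
move: T Ts; apply: (@tab_act_stable (fun v => forall T, standard T -> v T = 0)).
- by move=> c u u' h h' T Ts; rewrite ffunE tab_scaleE h // h' // mulr0 addr0.
- move=> i u h T Ts; rewrite tab_opE // h // /dl mulr0 add0r.
  by case: (boolP (standard _)) => sT; rewrite ?mul0r ?mulr0 // h ?mulr0.
- by move=> T Ts; rewrite -scaleN1r ffunE tab_scaleE mulN1r vv // subrr.
Qed.

End TabModuleSupport.

Section CanonicalFillings.
Variables (m : nat) (B : 'I_m -> nat).
Hypothesis B_homo : {homo B : x y / (x <= y)%N}.
Implicit Types (T U : filling m).

(** The semistandard tableaux, each represented by its standardisation: the entries
    of one fibre of B are met from left to right, in distinct columns. *)
Definition canonical_tab T : bool := standard T &&
  [forall x : 'I_m, forall y : 'I_m,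
    (x < y)%N && (B x == B y) ==> ((T x).2 < (T y).2)%N].

Lemma canonicalP T : reflect (standard T /\
   forall x y : 'I_m, (x < y)%N -> B x = B y -> ((T x).2 < (T y).2)%N)
  (canonical_tab T).
Proof.
apply: (iffP andP) => -[Ts h]; split=> //.
  move=> x y xy Bxy; have /forallP/(_ y)/implyP := (forallP h) x; apply.
  by rewrite xy Bxy eqxx.
apply/forallP=> x; apply/forallP=> y; apply/implyP=> /andP[xy /eqP]; exact: h.
Qed.

Lemma canonical_standard T : canonical_tab T -> standard T.
Proof. by case/andP. Qed.

Lemma canonical_local T : standard T ->
  (forall i : 'I_m.-1, B (gen_lo i) = B (gen_hi i) ->
     ((T (gen_lo i)).2 < (T (gen_hi i)).2)%N) -> canonical_tab T.
Proof.
move=> Ts h; apply/canonicalP; split=> // x y.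
move: {2}(y - x.+1)%N (erefl (y - x.+1)%N) => d; elim: d y => [|d IH] y dE xy Bxy.
  have xm : (x < m.-1)%N by have := ltn_ord y; lia.
  have e1 : x = gen_lo (Ordinal xm) by apply: val_inj.
  have e2 : y = gen_hi (Ordinal xm) by apply: val_inj => /=; lia.
  by rewrite e1 e2; apply: h; rewrite -e1 -e2.
have zm : (y.-1 < m.-1)%N by have := ltn_ord y; lia.
set i := Ordinal zm; have hi : gen_hi i = y by apply: val_inj => /=; lia.
have lo : (gen_lo i : nat) = y.-1 by [].
have Bx : B x = B (gen_lo i).
  apply/eqP; rewrite eqn_leq {2}Bxy !B_homo ?lo //; lia.
apply: (@ltn_trans (T (gen_lo i)).2); first by apply: IH; rewrite ?lo //; lia.
by rewrite -hi; apply: h; rewrite hi -Bxy Bx.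
Qed.

(** Decreases when an entry is exchanged with a successor further left. *)
Definition col_weight T : nat := \sum_(x < m) (m - x) * (T x).2.

Lemma col_weight_swap T (i : 'I_m.-1) :
  ((T (gen_hi i)).2 < (T (gen_lo i)).2)%N ->
  (col_weight (swap_tab T i) < col_weight T)%N.
Proof.
move=> lt; have ne := gen_lo_hi i; rewrite eq_sym in ne.
rewrite /col_weight (bigD1 (gen_lo i)) //= (bigD1 (gen_hi i)) //=.
rewrite [in X in (_ < X)%N](bigD1 (gen_lo i)) //= [in X in (_ < X)%N](bigD1 (gen_hi i)) //=.
rewrite !swap_tabE simple_tperm_lo simple_tperm_hi.
rewrite (eq_bigr (fun x : 'I_m => (m - x) * (T x).2))%N => [|x /andP[xl xh]].
  rewrite !addnA ltn_add2r; have := gen_hi_subproof i.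
  have -> : (m - i = (m - i.+1).+1)%N by have := gen_hi_subproof i; lia.
  by move: lt; move: (T _).2 (T _).2 => a b; move: (m - i.+1)%N; nia.
by rewrite swap_tabE /simple_tperm tpermD // eq_sym.
Qed.

(** A tableau is in the class of a canonical one when both have the same image under
    the relabelling of entries by B. *)
Definition in_class U T : bool := [&& standard T, boxes T == boxes U &
  [forall x, forall y, (T x == U y) ==> (B x == B y)]].

Lemma in_class_perm U T : standard U -> in_class U T ->
  exists w : 'S_m, (forall x, T x = U (w x)) /\ (forall x, B (w x) = B x).
Proof.
move=> Us /and3P[Ts /eqP bTU /forallP h].
have [w Tw] := boxes_perm (standard_inj Ts) (standard_inj Us) bTU.
exists w; split=> // x.
by have /forallP/(_ (w x)) := h x; rewrite Tw eqxx => /eqP.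
Qed.

Lemma in_class_swap U T (i : 'I_m.-1) : B (gen_lo i) = B (gen_hi i) ->
  standard (swap_tab T i) -> in_class U T -> in_class U (swap_tab T i).
Proof.
move=> Bi sT /and3P[_ bT h]; rewrite /in_class sT boxes_swap bT.
apply/forallP => x; apply/forallP => y; apply/implyP; rewrite swap_tabE => e.
have /forallP/(_ y) := (forallP h) (simple_tperm i x); rewrite e /=.
suff -> : B (simple_tperm i x) = B x by [].
by rewrite /simple_tperm; case: tpermP => [->|->|] //.
Qed.

Lemma in_class_canonical U T : canonical_tab U -> canonical_tab T -> in_class U T = (T == U).
Proof.
move=> /canonicalP[Us Uc] /canonicalP[Ts Tc].
apply/idP/eqP => [/(in_class_perm Us)[w [Tw Bw]]|->]; last first.
  rewrite /in_class Us eqxx; apply/forallP => x; apply/forallP => y.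
  by apply/implyP => /eqP/(standard_inj Us)->.
suff w1 : w = 1%g by apply/ffunP => x; rewrite Tw w1 perm1.
apply: perm_no_descent => i; case: (ascentVdescent i w) => // desc.
have Bi : B (gen_lo i) = B (gen_hi i).
  apply/eqP; rewrite eqn_leq B_homo ?leqnSn //= -(Bw (gen_lo i)) -(Bw (gen_hi i)).
  exact/B_homo/ltnW.
have := Uc _ _ desc; rewrite !Bw Bi => /(_ erefl).
have := Tc (gen_lo i) (gen_hi i) (ltnSn _) Bi; rewrite !Tw.
by move=> h1 h2; move: (ltn_trans h1 h2); rewrite ltnn.
Qed.

End CanonicalFillings.

Section Corner.
Variables (F : fieldType) (q : F) (m : nat).
Hypothesis q0 : q != 0.
Hypothesis qint_neq0 : forall n, (0 < n)%N -> qint q n%:Z != 0.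
Variable B : 'I_m -> nat.
Hypothesis B_homo : {homo B : x y / (x <= y)%N}.
Local Notation V := (tabmod F m).
Local Notation H := (hecke q m).
Implicit Types (T U : filling m) (v : V) (x y : H).

Definition q_invariant v : Prop := forall i : 'I_m.-1,
  B (gen_lo i) = B (gen_hi i) -> tab_op q i v = q *: v.

Lemma invariant_lin c v v' : q_invariant v -> q_invariant v' -> q_invariant (c *: v + v').
Proof. by move=> h h' i Bi; rewrite tab_op_linear h // h' // scalerDr !scalerA mulrC. Qed.

Lemma invariant_sum (P : pred (filling m)) (c : filling m -> F) (f : filling m -> V) :
  (forall U, P U -> q_invariant (f U)) -> q_invariant (\sum_(U | P U) c U *: f U).
Proof.
move=> h; elim/big_rec: _ => [|U v PU IH].
  move=> i _; have := tab_op_linear q i (-1) 0 0.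
  by rewrite !scaleN1r !addNr scaler0.
exact/invariant_lin/IH/h.
Qed.

(** The eigenvector equation reads (q - a) (v(s_i T) - v(T)) = 0, v being extended by
    zero. *)
Lemma invariant_nonzero v T i : B (gen_lo i) = B (gen_hi i) -> q_invariant v ->
  standard T -> axdist T i != 1 ->
  (standard (swap_tab T i))%:R * v (swap_tab T i) = v T.
Proof.
move=> Bi h Ts d1; have := congr1 (fun u : V => u T) (h i Bi).
rewrite tab_opE // tab_scaleE => /(dl_fixed _) -> //.
by apply: acoef_neq_q => //; apply: axdist_neq0.
Qed.

(** By invariant_nonzero, v vanishes on a tableau having two consecutive entries of one
    block in one column, and is unchanged when two entries of one block that go
    leftwards are exchanged; repeating this leads to a canonical tableau. *)
Lemma invariant_canonical v : q_invariant v ->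
  (forall T, canonical_tab B T -> v T = 0) -> forall T, standard T -> v T = 0.
Proof.
move=> vi v0 T; have [n] := ubnP (col_weight T); elim: n T => // n IH T lt Ts.
case: (boolP (canonical_tab B T)) => [/v0//|/negP nc].
have [i /andP[/eqP Bi le]] : exists i : 'I_m.-1, (B (gen_lo i) == B (gen_hi i)) &&
    ((T (gen_hi i)).2 <= (T (gen_lo i)).2)%N.
  case: (pickP (fun i : 'I_m.-1 => (B (gen_lo i) == B (gen_hi i)) &&
    ((T (gen_hi i)).2 <= (T (gen_lo i)).2)%N)) => [i|no]; first by exists i.
  case: nc; apply: canonical_local => // i Bi.
  by have := no i; rewrite Bi eqxx /= ltnNge => ->.
have d1 : axdist T i != 1.
  apply/eqP => /[dup] e /(axdist_row Ts) lo.
  case/orP: (standard_adjacent Ts lo) => /andP[/eqP e1 /eqP e2].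
    by move: le; rewrite e2 ltnn.
  by move: e; rewrite /axdist /content e1 e2; lia.
rewrite -(invariant_nonzero Bi vi Ts d1).
case: (boolP (standard _)) => sT; last by rewrite mul0r.
rewrite mul1r; apply: IH => //; rewrite ltnS in lt.
apply: leq_trans lt; apply: col_weight_swap.
move: sT; rewrite standard_swapE // /le_box negb_and -!ltnNge => /orP[lt1|//].
rewrite ltn_neqAle le andbT; apply/eqP => e.
have : le_box (T (gen_hi i)) (T (gen_lo i)) by rewrite /le_box e leqnn ltnW.
by move=> /(standard_le Ts) /=; rewrite ltnn.
Qed.

Definition class_vector U : V := [ffun T => (in_class B U T)%:R].

(** Entries i and i+1 of one block are never in the same column in the class of a
    canonical tableau; if they are neighbours in a row, then a = q. *)
Lemma class_vector_invariant U : canonical_tab B U -> q_invariant (class_vector U).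
Proof.
move=> /canonicalP[Us Uc] i Bi; apply/ffunP => T; rewrite tab_scaleE.
case: (boolP (standard T)) => Ts; last exact: tab_op_nonstd.
rewrite tab_opE // [class_vector U T]ffunE [class_vector U _]ffunE.
case: (boolP (standard _)) => sT.
  have -> : in_class B U (swap_tab T i) = in_class B U T.
    apply/idP/idP; last exact: in_class_swap.
    by move=> /(in_class_swap Bi); rewrite swap_tabK; apply.
  by rewrite mul1r /dl -mulrDl addrC subrK.
rewrite mul0r /dl mulr0 addr0.
case: (boolP (in_class B U T)) => [|_]; last by rewrite !mulr0.
move=> /(in_class_perm Us)[w [Tw Bw]]; rewrite !mulr1.
have le : le_box (T (gen_lo i)) (T (gen_hi i)) by rewrite standard_swapE // negbK in sT.
case/orP: (standard_adjacent Ts le) => /andP[/eqP e1 /eqP e2].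
  by rewrite (_ : axdist T i = 1) ?acoef1 // /axdist /content e1 e2; lia.
have ne : w (gen_lo i) != w (gen_hi i) by rewrite (inj_eq perm_inj) gen_lo_hi.
move: e1; rewrite !Tw => e1.
case: (ascentVdescent i w) => /Uc; rewrite !Bw => /(_ _); rewrite -?Bi ?e1 ltnn => /(_ erefl) //.
Qed.

Lemma class_vector_canonical U T : canonical_tab B U -> canonical_tab B T ->
  class_vector U T = (T == U)%:R.
Proof. by move=> Uc Tc; rewrite ffunE in_class_canonical. Qed.

Lemma class_vector_boxes U T : boxes T != boxes U -> class_vector U T = 0.
Proof. by move=> ne; rewrite ffunE /in_class (negbTE ne) andbF. Qed.

Lemma invariant_expand v : q_invariant v -> forall T, standard T ->
  v T = (\sum_(U | canonical_tab B U) v U *: class_vector U) T.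
Proof.
move=> vi T Ts; apply/eqP; rewrite -subr_eq0; apply/eqP.
set u := \sum_(U | _) _.
have ui : q_invariant u by apply: invariant_sum => U; apply: class_vector_invariant.
suff : (-1 *: u + v) T = 0 by rewrite ffunE tab_scaleE mulN1r addrC.
apply: (invariant_canonical (invariant_lin (-1) ui vi)) => // S Sc.
rewrite ffunE tab_scaleE mulN1r; suff -> : u S = v S by rewrite addNr.
rewrite /u sum_ffunE (bigD1 S) //= tab_scaleE class_vector_canonical // eqxx mulr1.
rewrite big1 ?addr0 // => U /andP[Uc US].
by rewrite tab_scaleE class_vector_canonical // eq_sym (negbTE US) mulr0.
Qed.

Variable e : H.
Hypothesis e_eigen : forall i : 'I_m.-1, B (gen_lo i) = B (gen_hi i) ->
  sigma i * e = q *: e.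
Hypothesis e_fixes : forall v, q_invariant v -> tab_act e v = v.

Lemma corner_invariant v : q_invariant (tab_act e v).
Proof.
have [r1 t1 rD rM rZ] := tab_actP m q0 qint_neq0.
by move=> i Bi; rewrite -r1 -rM e_eigen // rZ.
Qed.

Lemma corner_idem : e * e = e.
Proof.
have [r1 t1 rD rM rZ] := tab_actP m q0 qint_neq0.
by apply: (tab_act_inj q0 qint_neq0) => v T _; rewrite rM e_fixes //; apply: corner_invariant.
Qed.

Definition corner x : Prop := exists z, e * z * e = x.

Lemma cornerE x : corner x -> e * x = x /\ x * e = x.
Proof.
case=> z <-; split; first by rewrite !mulrA corner_idem.
by rewrite -mulrA corner_idem.
Qed.

Lemma corner_act x v : corner x -> q_invariant (tab_act x v).
Proof.
have [r1 t1 rD rM rZ] := tab_actP m q0 qint_neq0.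
by move=> /cornerE[<- _]; rewrite rM; apply: corner_invariant.
Qed.

Lemma corner_add x y : corner x -> corner y -> corner (x + y).
Proof. by move=> [z <-] [z' <-]; exists (z + z'); rewrite mulrDr mulrDl. Qed.

Lemma corner_scale c x : corner x -> corner (c *: x).
Proof. by move=> [z <-]; exists (c *: z); rewrite -scalerAr -scalerAl. Qed.

Lemma corner_mul x y : corner x -> corner y -> corner (x * y).
Proof.
move=> /cornerE[xl _] [z <-]; exists (x * e * z).
by rewrite -{2}xl !mulrA.
Qed.

(** For x in the corner, the matrix of x on the invariants in the basis of class
    vectors. *)
Definition entry x T U : F := tab_act x (class_vector U) T.

Lemma entryD x y T U : entry (x + y) T U = entry x T U + entry y T U.
Proof.
by have [_ _ rD _ _] := tab_actP m q0 qint_neq0; rewrite /entry rD ffunE.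
Qed.

Lemma entryZ c x T U : entry (c *: x) T U = c * entry x T U.
Proof.
by have [_ _ _ _ rZ] := tab_actP m q0 qint_neq0; rewrite /entry rZ tab_scaleE.
Qed.

Lemma tab_act_lsum x (P : pred (filling m)) (c : filling m -> F) (f : filling m -> V) :
  tab_act x (\sum_(U | P U) c U *: f U) = \sum_(U | P U) c U *: tab_act x (f U).
Proof.
have z : tab_act x 0 = 0 by have := tab_actZ x 0 0; rewrite !scale0r.
rewrite (big_morph (tab_act x) (id1 := 0) (op1 := +%R)) //; last exact: tab_actD.
by apply: eq_bigr => U _; rewrite tab_actZ.
Qed.

Lemma tab_act_expand x v T : q_invariant v -> standard T ->
  tab_act x v T = \sum_(U | canonical_tab B U) v U * entry x T U.
Proof.
move=> vi Ts; rewrite (tab_act_standard x (invariant_expand vi)) //.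
rewrite tab_act_lsum sum_ffunE; apply: eq_bigr => U _; exact: tab_scaleE.
Qed.

Lemma entryM x y T U : corner y -> standard T ->
  entry (x * y) T U = \sum_(Z | canonical_tab B Z) entry x T Z * entry y Z U.
Proof.
have [_ _ _ rM _] := tab_actP m q0 qint_neq0.
move=> yc Ts; rewrite /entry rM tab_act_expand //; last exact: corner_act.
by apply: eq_bigr => Z _; rewrite mulrC.
Qed.

Lemma entry_boxes x T U : standard T -> boxes T != boxes U -> entry x T U = 0.
Proof.
move=> Ts; apply: tab_act_boxes => // S _; exact: class_vector_boxes.
Qed.

Lemma entry_inj x y : corner x -> corner y ->
  (forall T U, canonical_tab B T -> canonical_tab B U -> entry x T U = entry y T U) -> x = y.
Proof.
have [_ _ _ rM _] := tab_actP m q0 qint_neq0.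
move=> xc yc xy; have [_ xe] := cornerE xc; have [_ ye] := cornerE yc.
apply: (tab_act_inj q0 qint_neq0) => v T Ts; rewrite -xe -ye !rM.
have vi := corner_invariant v; rewrite !tab_act_expand //.
apply: eq_bigr => U Uc; congr (_ * _).
apply/esym/eqP; rewrite -subr_eq0; apply/eqP.
pose u := -1 *: tab_act x (class_vector U) + tab_act y (class_vector U).
have uE S : u S = entry y S U - entry x S U.
  by rewrite /u ffunE tab_scaleE mulN1r addrC.
rewrite -uE; apply: (@invariant_canonical u) => [|S Sc|//].
  by apply: invariant_lin; apply: corner_act.
by rewrite uE xy // subrr.
Qed.

Lemma entry_surj (M : filling m -> filling m -> F) :
  (forall T U, canonical_tab B T -> canonical_tab B U -> boxes T != boxes U -> M T U = 0) ->
  exists x, corner x /\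
    forall T U, canonical_tab B T -> canonical_tab B U -> entry x T U = M T U.
Proof.
move=> M0; have [_ _ _ rM _] := tab_actP m q0 qint_neq0.
pose M' T U : F := if canonical_tab B U then
  (\sum_(R | canonical_tab B R) M R U *: class_vector R) T else 0.
have [|z hz] := @realise_matrix F q m q0 qint_neq0 M'.
  move=> T U Ts Us TU; rewrite /M'; case: ifP => // Uc.
  rewrite sum_ffunE big1 // => R Rc; rewrite tab_scaleE.
  have [e'|RU] := eqVneq (boxes R) (boxes U); last by rewrite M0 ?mul0r.
  by rewrite class_vector_boxes ?mulr0 // e'.
exists (e * z * e); split=> [|T U Tc Uc]; first by exists z.
have Ui := class_vector_invariant Uc.
rewrite /entry -mulrA rM rM (e_fixes Ui).
pose u := \sum_(R | canonical_tab B R) M R U *: class_vector R.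
have ui : q_invariant u by apply: invariant_sum => R; apply: class_vector_invariant.
have Ts := canonical_standard Tc; have Us := canonical_standard Uc.
have zu S : standard S -> tab_act z (class_vector U) S = u S.
  move=> Ss; rewrite hz // (bigD1 U) //=.
  rewrite class_vector_canonical // eqxx mulr1 /M' Uc.
  rewrite [X in _ + X]big1 ?addr0 // => R /andP[Rs RU]; case: ifP => Rc; last by rewrite mul0r.
  by rewrite class_vector_canonical // (negbTE RU) mulr0.
rewrite (tab_act_standard e zu Ts) (e_fixes ui) /u sum_ffunE (bigD1 T) //=.
rewrite tab_scaleE class_vector_canonical // eqxx mulr1.
rewrite big1 ?addr0 // => R /andP[Rc RT].
by rewrite tab_scaleE class_vector_canonical // eq_sym (negbTE RT) mulr0.
Qed.

End Corner.

(** * Algebras isomorphic to block matrices *)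

Section MatrixModels.
Variable F : fieldType.

(** A set A of elements identified by phi with the algebra of matrices that are indexed
    by C and have their support in R. *)
Record matrix_model (E : algType F) (A : set E) (I : finType) (C : pred I)
    (R : rel I) (phi : E -> I -> I -> F) : Prop := MatrixModel {
  model_add : forall x y, A x -> A y -> A (x + y);
  model_scale : forall c x, A x -> A (c *: x);
  model_mul : forall x y, A x -> A y -> A (x * y);
  entry_add : forall x y i j, phi (x + y) i j = phi x i j + phi y i j;
  entry_scale : forall c x i j, phi (c *: x) i j = c * phi x i j;
  entry_mul : forall x y i j, A x -> A y -> C i -> C j ->
    phi (x * y) i j = \sum_(l | C l) phi x i l * phi y l j;
  model_refl : forall i, C i -> R i i;
  model_block : forall x i j, A x -> C i -> C j -> ~~ R i j -> phi x i j = 0;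
  model_inj : forall x y, A x -> A y ->
    (forall i j, C i -> C j -> phi x i j = phi y i j) -> x = y;
  model_surj : forall M : I -> I -> F,
    (forall i j, C i -> C j -> ~~ R i j -> M i j = 0) ->
    exists x, A x /\ forall i j, C i -> C j -> phi x i j = M i j }.

Lemma matrix_model_iso (E E' : algType F) (A : set E) (A' : set E')
    (I I' : finType) (C : pred I) (C' : pred I') (R : rel I) (R' : rel I') phi phi'
    (b : I -> I') (b' : I' -> I) :
  matrix_model A C R phi -> matrix_model A' C' R' phi' ->
  (forall i, C i -> C' (b i)) -> (forall j, C' j -> C (b' j)) ->
  (forall i, C i -> b' (b i) = i) -> (forall j, C' j -> b (b' j) = j) ->
  (forall i j, C i -> C j -> R' (b i) (b j) = R i j) ->
  subalg_iso A A'.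
Proof.
move=> mA mA' bC b'C bK b'K bR.
have R'b i j : C' i -> C' j -> R (b' i) (b' j) = R' i j.
  by move=> Ci Cj; rewrite -bR ?b'C // !b'K.
have ex x : exists y, A x -> A' y /\
    forall i j, C' i -> C' j -> phi' y i j = phi x (b' i) (b' j).
  have [Ax|nAx] := pselect (A x); last by exists 0.
  have [|y hy] := model_surj mA' (M := fun i j => phi x (b' i) (b' j)).
    by move=> i j Ci Cj nR; apply: (model_block mA); rewrite ?b'C ?R'b.
  by exists y.
have {ex} [f fP] := choice ex.
have fA x : A x -> A' (f x) by move=> /fP[].
have fE x i j : A x -> C' i -> C' j -> phi' (f x) i j = phi x (b' i) (b' j).
  by move=> /fP[_]; apply.
have fE' x i j : A x -> C i -> C j -> phi' (f x) (b i) (b j) = phi x i j.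
  by move=> Ax Ci Cj; rewrite fE ?bC // !bK.
exists f; split.
- split.
  + by move=> x; apply: fA.
  + move=> x y /set_mem Ax /set_mem Ay fxy; apply: (model_inj mA) => // i j Ci Cj.
    by rewrite -!fE' // fxy.
  + move=> y A'y.
    have [|x [Ax hx]] := model_surj mA (M := fun i j => phi' y (b i) (b j)).
      by move=> i j Ci Cj nR; apply: (model_block mA'); rewrite ?bC ?bR.
    exists x => //; apply: (model_inj mA') => // [|i j Ci Cj]; first exact: fA.
    by rewrite fE // hx ?b'C // !b'K.
- move=> x y Ax Ay; apply: (model_inj mA').
  + exact/fA/(model_add mA).
  + by apply: (model_add mA'); apply: fA.
  + move=> i j Ci Cj; rewrite (entry_add mA') !fE //; last exact: (model_add mA).
    exact: (entry_add mA).
- move=> c x Ax; apply: (model_inj mA').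
  + exact/fA/(model_scale mA).
  + exact/(model_scale mA')/fA.
  + move=> i j Ci Cj; rewrite (entry_scale mA') !fE //; last exact: (model_scale mA).
    exact: (entry_scale mA).
- move=> x y Ax Ay; apply: (model_inj mA').
  + exact/fA/(model_mul mA).
  + by apply: (model_mul mA'); apply: fA.
  + move=> i j Ci Cj; rewrite (entry_mul mA') ?fE //; [|exact: (model_mul mA)|exact: fA|exact: fA].
    rewrite (entry_mul mA) ?b'C // (reindex_onto b b') /=; last by move=> l /b'K.
    have -> : \sum_(l | C' (b l) && (b' (b l) == l)) phi' (f x) i (b l) * phi' (f y) (b l) j
        = \sum_(l | C l) phi' (f x) i (b l) * phi' (f y) (b l) j.
      apply: eq_bigl => l; apply/andP/idP => [[Cb /eqP <-]|Cl]; first exact: b'C.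
      by rewrite bC // bK.
    by apply: eq_bigr => l Cl; rewrite !fE ?bC // !bK.
have [|e [Ae he]] := model_surj mA (M := fun i j => (i == j)%:R).
  by move=> i j Ci _; case: eqP => // <-; rewrite (model_refl mA).
have unit (E0 : algType F) (A0 : set E0) (I0 : finType) (C0 : pred I0) R0 phi0 e0 :
    matrix_model A0 C0 R0 phi0 -> A0 e0 ->
    (forall i j, C0 i -> C0 j -> phi0 e0 i j = (i == j)%:R) -> unit_of A0 e0.
  move=> m0 A0e e0E; split=> // x Ax; split; apply: (model_inj m0) => //;
    try exact: (model_mul m0).
    move=> i j Ci Cj; rewrite (entry_mul m0) // (bigD1 i) //= e0E // eqxx mul1r.
    by rewrite big1 ?addr0 // => l /andP[Cl /negbTE li]; rewrite e0E // eq_sym li mul0r.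
  move=> i j Ci Cj; rewrite (entry_mul m0) // (bigD1 j) //= e0E // eqxx mulr1.
  by rewrite big1 ?addr0 // => l /andP[Cl /negbTE lj]; rewrite e0E // lj mulr0.
exists e; split; first exact: (unit _ _ _ _ _ _ _ mA).
apply: (unit _ _ _ _ _ _ _ mA') => [|i j Ci Cj]; first exact: fA.
rewrite fE // he ?b'C //; have -> // : (b' i == b' j) = (i == j).
by apply/eqP/eqP => [h|-> //]; rewrite -(b'K i) // h b'K.
Qed.

End MatrixModels.

Section CornerModel.
Variables (F : fieldType) (q : F) (m : nat).
Hypothesis q0 : q != 0.
Hypothesis qint_neq0 : forall n, (0 < n)%N -> qint q n%:Z != 0.
Variable B : 'I_m -> nat.
Hypothesis B_homo : {homo B : x y / (x <= y)%N}.
Variable e : hecke q m.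
Hypothesis e_eigen : forall i : 'I_m.-1, B (gen_lo i) = B (gen_hi i) ->
  sigma i * e = q *: e.
Hypothesis e_fixes : forall v : tabmod F m, q_invariant q B v -> tab_act e v = v.

(** As C is a union of shapes, a matrix respecting shapes whose columns outside C
    vanish is supported on C in its rows too. *)
Lemma corner_model (C : pred (filling m)) :
  (forall T, C T -> canonical_tab B T) ->
  (forall T U, canonical_tab B T -> C U -> boxes T = boxes U -> C T) ->
  matrix_model
    [set x | corner e x /\ forall T U, canonical_tab B T -> canonical_tab B U -> ~~ C U ->
       entry B x T U = 0]%classic
    C (fun T U => boxes T == boxes U) (entry B).
Proof.
move=> Cc Cb; split.
- move=> x y [xc x0] [yc y0]; split=> [|T U Tc Uc nC]; first exact: corner_add.
  by rewrite entryD // x0 // y0 // addr0.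
- move=> c x [xc x0]; split=> [|T U Tc Uc nC]; first exact: corner_scale.
  by rewrite entryZ // x0 // mulr0.
- move=> x y [xc x0] [yc y0]; split=> [|T U Tc Uc nC].
    exact: (corner_mul q0 qint_neq0 e_eigen e_fixes).
  rewrite (entryM q0 qint_neq0 B_homo e_eigen e_fixes) //; last exact: canonical_standard Tc.
  by apply: big1 => Z Zc; rewrite y0 // mulr0.
- by move=> x y T U; apply: entryD.
- by move=> c x T U; apply: entryZ.
- move=> x y T U [xc x0] [yc y0] TC UC; have Ts := canonical_standard (Cc _ TC).
  rewrite (entryM q0 qint_neq0 B_homo e_eigen e_fixes) // (bigID C) /=.
  rewrite [X in _ + X]big1 ?addr0 => [|Z /andP[Zc nZ]]; last first.
    by rewrite x0 ?mul0r // Cc.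
  by apply: eq_bigl => Z; case: (boolP (C Z)) => [/Cc->|]; rewrite ?andbF.
- by [].
- by move=> x T U _ TC _ ne; apply: entry_boxes => //; apply/canonical_standard/Cc.
- move=> x y [xc x0] [yc y0] xy.
  apply: (entry_inj q0 qint_neq0 B_homo e_eigen e_fixes) => // T U Tc Uc.
  case: (boolP (C U)) => [UC|nU]; last by rewrite x0 // y0.
  have [TU|ne] := eqVneq (boxes T) (boxes U); first by apply: xy => //; apply: Cb TU.
  by rewrite !entry_boxes //; apply: canonical_standard Tc.
- move=> M M0; pose M' T U := if C T && C U then M T U else 0.
  have [|x [xc hx]] := entry_surj q0 qint_neq0 B_homo e_fixes (M := M').
    by move=> T U _ _ ne; rewrite /M'; case: ifP => // /andP[TC UC]; apply: M0.
  exists x; split=> [|T U TC UC]; last by rewrite hx ?Cc // /M' TC UC.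
  by split=> // T U Tc Uc nU; rewrite hx // /M' (negbTE nU) andbF.
Qed.

End CornerModel.

(** * Removing the first column *)

Section FirstColumn.
Variables (k : nat -> nat) (n : nat).
Hypothesis k_gt0 : forall i, (0 < k i)%N.

Local Notation k' := (fun i => (k i).-1).
Local Notation m := (fused_size k n).
Local Notation m' := (fused_size k' n).
Local Notation B := (fun x : 'I_m => block k n x).
Local Notation B' := (fun x : 'I_m' => block k' n x).

Lemma offset_pred b : offset k b = (offset k' b + b)%N.
Proof.
elim: b => [|b IH]; first by rewrite /offset !big_ord0.
by rewrite !offsetS IH /=; have := k_gt0 b; lia.
Qed.

Lemma fused_size_pred : m = (m' + n)%N.
Proof. exact: offset_pred. Qed.

(** The position, in the larger tableau, of the entry x of the smaller one: every
    block starts with one additional entry. *)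
Definition skip_first (x : nat) : nat := (x + block k' n x).+1.

Lemma block_skip_first x : (x < m')%N ->
  (skip_first x < m)%N /\ block k n (skip_first x) = block k' n x.
Proof.
move=> xm; have [bn] := block_bounds xm; set b := block k' n x in bn *.
rewrite /skip_first -/b => bx; have h : (offset k b <= (x + b).+1 < offset k b.+1)%N.
  by rewrite !offset_pred; lia.
rewrite (blockE bn h); split=> //; case/andP: h => _ h; apply: leq_trans h _.
exact: offset_le.
Qed.

Lemma skip_first_mono x y : (x < m')%N -> (y < m')%N ->
  (skip_first x < skip_first y)%N = (x < y)%N.
Proof.
move=> xm ym; rewrite /skip_first; have [lt|le] := ltnP x y.
  by have := block_homo k' n (ltnW lt); lia.
by have := block_homo k' n le; lia.
Qed.

Lemma skip_first_neq_offset x b : (x < m')%N -> skip_first x <> offset k b.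
Proof.
move=> xm; rewrite /skip_first offset_pred; have [bn] := block_bounds xm.
set c := block k' n x => /andP[cx xc].
have [lt|lt] := ltnP c b; first by have := @offset_le k' _ _ lt; lia.
by have := @offset_le k' _ _ lt; lia.
Qed.

Lemma skip_first_onto x : (x < m)%N -> x != offset k (block k n x) ->
  exists2 y, (y < m')%N & x = skip_first y.
Proof.
move=> xm ne; have [bn] := block_bounds xm; set b := block k n x in bn ne *.
rewrite !offset_pred => h; rewrite offset_pred in ne.
have yb : block k' n (x - b.+1) = b by apply: blockE => //; lia.
exists (x - b.+1)%N; last by rewrite /skip_first yb; lia.
apply: leq_trans (_ : offset k' b.+1 <= m')%N; first by lia.
exact: offset_le.
Qed.

Lemma block_offset b : (b < n)%N -> (offset k b < m)%N /\ block k n (offset k b) = b.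
Proof.
move=> bn; have h : (offset k b <= offset k b < offset k b.+1)%N.
  by rewrite leqnn offsetS; have := k_gt0 b; lia.
rewrite (blockE bn h); split=> //; case/andP: h => _ h; apply: leq_trans h _.
exact: offset_le.
Qed.

(** Down a column the blocks increase strictly. *)
Lemma canonical_row_le_block (kk : nat -> nat) (T : filling (fused_size kk n)) x :
  canonical_tab (fun x => block kk n x) T -> ((T x).1 <= block kk n x)%N.
Proof.
move=> /canonicalP[Ts Tc]; have /standardP[Ti h] := Ts.
move: {2}(T x).1 (erefl (T x).1) => r; move: {2}(r : nat) (erefl (r : nat)) => d.
elim: d r x => [|d IH] r x rd Tr; first by rewrite Tr rd.
have dm : (d < fused_size kk n)%N by rewrite -ltnS -rd ltnS ltnW // ltn_ord.
have [|y yx yT] := h x (Ordinal dm, (T x).2); first by rewrite /le_box Tr rd /= leqnSn /=.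
have ne : y != x.
  apply/eqP => e; move: rd; rewrite -Tr -e yT /=; lia.
have lt : (y < x)%N by rewrite ltn_neqAle yx andbT.
have := IH (Ordinal dm) y (erefl d); rewrite yT => /(_ erefl) /= le.
rewrite Tr rd; apply: leq_ltn_trans le _.
rewrite ltn_neqAle block_homo // andbT; apply/eqP => e.
by have := Tc _ _ lt e; rewrite yT /= ltnn.
Qed.

(** For canonical tableaux this means having n rows (full_column_size). *)
Definition full_column (T : filling m) : bool :=
  [forall x : 'I_m, (x == offset k (block k n x) :> nat) ==>
     ((T x).1 == block k n x :> nat) && ((T x).2 == 0 :> nat)].

Lemma full_columnP (T : filling m) : reflect
  (forall x : 'I_m, x = offset k (block k n x) :> nat ->
     ((T x).1 = block k n x :> nat) /\ ((T x).2 = 0 :> nat)) (full_column T).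
Proof.
apply: (iffP forallP) => h x; first by move=> /eqP e; have := h x; rewrite e => /andP[/eqP ? /eqP].
by apply/implyP => /eqP/h[-> ->]; rewrite !eqxx.
Qed.

Lemma skip_ord_subproof (y : 'I_m') : (skip_first y < m)%N.
Proof. by have [] := block_skip_first (ltn_ord y). Qed.

Definition skip_ord (y : 'I_m') : 'I_m := Ordinal (skip_ord_subproof y).

Lemma skip_ord_block y : block k n (skip_ord y) = block k' n y.
Proof. by have [] := block_skip_first (ltn_ord y). Qed.

Lemma skip_ord_inj : injective skip_ord.
Proof.
move=> x y /(congr1 val) /= e; apply: val_inj.
have := skip_first_mono (ltn_ord x) (ltn_ord y).
have := skip_first_mono (ltn_ord y) (ltn_ord x); rewrite e /= ltnn.
by case: (ltngtP x y).
Qed.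

Lemma skip_ord_le x y : (skip_ord x <= skip_ord y)%N = (x <= y)%N.
Proof. by rewrite [LHS]leqNgt [RHS]leqNgt skip_first_mono. Qed.

Variant entry_spec (x : 'I_m) : Prop :=
| FirstOfBlock of x = offset k (block k n x) :> nat
| AfterFirst y of x = skip_ord y.

Lemma entryP x : entry_spec x.
Proof.
have [e|ne] := eqVneq (x : nat) (offset k (block k n x)); first exact: FirstOfBlock.
have [y ym e] := skip_first_onto (ltn_ord x) ne.
by apply: (AfterFirst (y := Ordinal ym)); apply: val_inj.
Qed.

Lemma skip_ord_not_first y : skip_ord y <> offset k (block k n (skip_ord y)) :> nat.
Proof. exact: skip_first_neq_offset. Qed.

Definition delete_column (T : filling m) : filling m' :=
  [ffun y => (insubd y ((T (skip_ord y)).1 : nat), insubd y ((T (skip_ord y)).2.-1))].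

Definition unskip (x : 'I_m) : option 'I_m' := [pick y | skip_ord y == x].

Lemma unskipK y : unskip (skip_ord y) = Some y.
Proof.
rewrite /unskip; case: pickP => [z /eqP/skip_ord_inj->//|/(_ y)].
by rewrite eqxx.
Qed.

Lemma unskip_first (x : 'I_m) : x = offset k (block k n x) :> nat -> unskip x = None.
Proof.
move=> e; rewrite /unskip; case: pickP => [z /eqP ez|//].
by case: (@skip_ord_not_first z); rewrite ez.
Qed.

Definition add_column (T : filling m') : filling m :=
  [ffun x => if unskip x is Some y then (insubd x ((T y).1 : nat), insubd x (T y).2.+1)
             else (insubd x (block k n x), insubd x 0%N)].

Lemma add_column_first T (x : 'I_m) : x = offset k (block k n x) :> nat ->
  ((add_column T x).1 = block k n x :> nat) /\ ((add_column T x).2 = 0 :> nat).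
Proof.
move=> e; rewrite ffunE unskip_first //=; have [bn _] := block_bounds (ltn_ord x).
rewrite !val_insubd (leq_ltn_trans (leq0n x) (ltn_ord x)).
by rewrite (leq_trans bn) // fused_size_pred leq_addl.
Qed.

Lemma add_column_after T y :
  ((add_column T (skip_ord y)).1 = (T y).1 :> nat) /\
  ((add_column T (skip_ord y)).2 = (T y).2.+1 :> nat).
Proof.
rewrite ffunE unskipK /= !val_insubd.
have n0 : (0 < n)%N by have [bn _] := block_bounds (ltn_ord y); apply: leq_ltn_trans bn.
have h1 := ltn_ord (T y).1; have h2 := ltn_ord (T y).2.
have me := fused_size_pred; have [-> ->] : ((T y).1 < m)%N /\ ((T y).2.+1 < m)%N by lia.
by [].
Qed.

Lemma box_eq N (p r : 'I_N * 'I_N) : p.1 = r.1 :> nat -> p.2 = r.2 :> nat -> p = r.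
Proof.
by case: p r => [a b] [c d] /= h1 h2; congr (_, _); apply: val_inj.
Qed.

Section Delete.
Variable T : filling m.
Hypothesis Tc : canonical_tab B T.
Hypothesis Tf : full_column T.

Let Ts : standard T := canonical_standard Tc.

Lemma skip_col_gt0 y : (0 < (T (skip_ord y)).2)%N.
Proof.
have [_ h] := canonicalP _ _ Tc; set x := skip_ord y.
have [bn bx] := block_bounds (ltn_ord x).
have [om ob] := block_offset bn.
have lt : (Ordinal om < x)%N.
  rewrite ltn_neqAle /=; case/andP: bx => -> _; rewrite andbT eq_sym.
  by apply/eqP/skip_ord_not_first.
by apply: leq_ltn_trans (h _ _ lt ob); rewrite leq0n.
Qed.

Lemma col_gt0_skip x : (0 < (T x).2)%N -> exists y, x = skip_ord y.
Proof.
case: (entryP x) => [e|y ->] h; last by exists y.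
by have [_ h0] := full_columnP _ Tf x e; rewrite h0 in h.
Qed.

(** Without its first column T has the standard property, so a chain of smaller entries
    leads from any box to the corner. This bound makes the default values of
    delete_column unreachable. *)
Lemma delete_bound y : ((T (skip_ord y)).1 + (T (skip_ord y)).2.-1 <= y)%N.
Proof.
have /standardP[Ti h] := Ts.
move: {2}(y : nat) (erefl (y : nat)) => d; elim/ltn_ind: d y => d IH y yd.
set x := skip_ord y; have c0 := skip_col_gt0 y; rewrite -/x in c0 *.
have step p : le_box p (T x) -> p != T x -> (0 < p.2)%N -> (p.1 + p.2.-1 < y)%N.
  move=> px pne p0; have [z zx zT] := h _ _ px.
  have [y' zy] : exists y', z = skip_ord y' by apply: col_gt0_skip; rewrite zT.
  have lt : (y' < y)%N.
    have ne : y' != y by apply: contra_neq pne => e; rewrite -zT zy e.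
    by rewrite ltn_neqAle ne /= -skip_ord_le -zy.
  by apply: leq_ltn_trans (lt); rewrite -zT zy; apply: (IH y'); rewrite -?yd.
case Tx: (T x) c0 step => [r c] /= c0 step.
have [lt|] := ltnP 1 c.
  have cm : (c.-1 < m)%N by apply: leq_ltn_trans (ltn_ord c); apply: leq_pred.
  have := step (r, Ordinal cm); rewrite /le_box /= leqnn leq_pred => /(_ isT).
  have -> : ((r, Ordinal cm) != (r, c)) by apply/eqP => -[/(congr1 val) /=]; lia.
  by move=> /(_ isT); lia.
move=> c1; have [r0|rpos] := posnP r; first by lia.
have rm : (r.-1 < m)%N by apply: leq_ltn_trans (ltn_ord r); apply: leq_pred.
have := step (Ordinal rm, c); rewrite /le_box /= leqnn leq_pred => /(_ isT).
have -> : ((Ordinal rm, c) != (r, c)) by apply/eqP => -[/(congr1 val) /=]; lia.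
by move=> /(_ isT); lia.
Qed.

Lemma delete_columnE y :
  ((delete_column T y).1 = (T (skip_ord y)).1 :> nat) /\
  ((delete_column T y).2 = (T (skip_ord y)).2.-1 :> nat).
Proof.
rewrite ffunE /= !val_insubd; have := delete_bound y; have := ltn_ord y => h1 h2.
by rewrite !ifT //; lia.
Qed.

Lemma delete_canonical : canonical_tab B' (delete_column T).
Proof.
have /standardP[Ti h] := Ts; have [_ hc] := canonicalP _ _ Tc.
apply/canonicalP; split; last first.
  move=> x y xy Bxy; have [_ ->] := delete_columnE x; have [_ ->] := delete_columnE y.
  have := hc (skip_ord x) (skip_ord y); rewrite !skip_ord_block skip_first_mono // => /(_ xy Bxy).
  by have := skip_col_gt0 x; lia.
apply/standardP; split=> [x y e|x p].
  apply/skip_ord_inj/Ti/box_eq.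
    by have [<- _] := delete_columnE x; have [<- _] := delete_columnE y; rewrite e.
  have [_ e1] := delete_columnE x; have [_ e2] := delete_columnE y.
  have := congr1 (fun r => nat_of_ord r.2) e; rewrite /= e1 e2.
  by have := skip_col_gt0 x; have := skip_col_gt0 y; lia.
rewrite /le_box; have [-> ->] := delete_columnE x => /andP[p1 p2].
have c0 := skip_col_gt0 x.
have p1m : (p.1 < m)%N by apply: leq_trans (ltn_ord _) _; rewrite fused_size_pred leq_addr.
have p2m : (p.2.+1 < m)%N by apply: leq_ltn_trans (ltn_ord (T (skip_ord x)).2); lia.
have [|z zx zT] := h (skip_ord x) (Ordinal p1m, Ordinal p2m).
  by rewrite /le_box /= p1; lia.
have [y zy] : exists y, z = skip_ord y by apply: col_gt0_skip; rewrite zT.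
exists y; first by rewrite -skip_ord_le -zy.
have [e1 e2] := delete_columnE y.
by apply: box_eq; rewrite ?e1 ?e2 -zy zT.
Qed.

Lemma add_delete : add_column (delete_column T) = T.
Proof.
apply/ffunP => x; case: (entryP x) => [e|y ->].
  have [h1 h2] := add_column_first (delete_column T) e.
  have [h3 h4] := full_columnP _ Tf x e.
  by apply: box_eq; rewrite ?h1 ?h2 ?h3 ?h4.
have [h1 h2] := add_column_after (delete_column T) y; have [h3 h4] := delete_columnE y.
apply: box_eq; rewrite ?h1 ?h2 ?h3 ?h4 // prednK //; exact: skip_col_gt0.
Qed.

End Delete.

Section Add.
Variable T : filling m'.
Hypothesis Tc : canonical_tab B' T.

Let Ts : standard T := canonical_standard Tc.

Lemma add_full : full_column (add_column T).
Proof. by apply/full_columnP => x; apply: add_column_first. Qed.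

(** An entry pushed to the second column in row r belongs to a block of index at least
    r, hence comes after the entry put on its left. *)
Lemma add_canonical : canonical_tab B (add_column T).
Proof.
have /standardP[Ti h] := Ts; have [_ hc] := canonicalP _ _ Tc.
have box0 r : (r < n)%N -> forall p : 'I_m * 'I_m, (p.1 <= r)%N -> p.2 = 0%N :> nat ->
    exists2 z : 'I_m, (z <= offset k r)%N & add_column T z = p.
  move=> rn p pr p0; have pn : (p.1 < n)%N by apply: leq_ltn_trans rn.
  have [om ob] := block_offset pn; exists (Ordinal om); first exact: offset_le.
  have [|h1 h2] := @add_column_first T (Ordinal om); first by rewrite /= ob.
  by apply: box_eq; rewrite ?h1 ?h2.
apply/canonicalP; split; last first.
  move=> x y xy Bxy; case: (entryP x) (entryP y) => [ex|x' ex] [ey|y' ey].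
  - by move: xy; rewrite ex ey Bxy ltnn.
  - have [_ ->] := add_column_first T ex; rewrite ey.
    by have [_ ->] := add_column_after T y'.
  - move: xy; rewrite ey -Bxy ltnNge.
    by have [_ /andP[-> _]] := block_bounds (ltn_ord x).
  move: xy Bxy; rewrite ex ey !skip_ord_block skip_first_mono // => xy Bxy.
  have [_ ->] := add_column_after T y'; have [_ ->] := add_column_after T x'.
  by rewrite ltnS; apply: hc.
apply/standardP; split=> [x y e|x p].
  have e1 := congr1 (fun r => nat_of_ord r.1) e; have e2 := congr1 (fun r => nat_of_ord r.2) e.
  move: e1 e2 => /=; case: (entryP x) (entryP y) => [ex|x' ex] [ey|y' ey].
  - have [-> _] := add_column_first T ex; have [-> _] := add_column_first T ey.
    by move=> Bxy _; apply: val_inj; rewrite /= ex ey Bxy.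
  - by have [_ ->] := add_column_first T ex; rewrite ey; have [_ ->] := add_column_after T y'.
  - by have [_ ->] := add_column_first T ey; rewrite ex; have [_ ->] := add_column_after T x'.
  rewrite ex ey; have [-> ->] := add_column_after T x'; have [-> ->] := add_column_after T y'.
  by move=> e1 [e2]; congr skip_ord; apply/Ti/box_eq.
case: (entryP x) => [ex|x' ex]; rewrite /le_box.
  have [-> ->] := add_column_first T ex; rewrite leqn0 => /andP[p1 /eqP p2].
  have [bn _] := block_bounds (ltn_ord x).
  by have [z zo zT] := box0 _ bn p p1 p2; exists z; rewrite // ex.
rewrite ex; have [-> ->] := add_column_after T x' => /andP[p1 p2].
have [p20|p2pos] := posnP p.2.
  have [bn bx] := block_bounds (ltn_ord (skip_ord x')).
  have le : (p.1 <= block k n (skip_ord x'))%N.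
    by rewrite skip_ord_block; apply: leq_trans p1 (canonical_row_le_block _ Tc).
  have [z zo zT] := box0 _ bn p le p20; exists z => //.
  by apply: leq_trans zo _; case/andP: bx.
have p1m : (p.1 < m')%N by apply: leq_ltn_trans (ltn_ord (T x').1).
have p2m : (p.2.-1 < m')%N by apply: leq_ltn_trans (ltn_ord (T x').2); lia.
have [|z zx zT] := h x' (Ordinal p1m, Ordinal p2m).
  by rewrite /le_box /= p1; lia.
exists (skip_ord z); first by rewrite skip_ord_le.
have [h1 h2] := add_column_after T z.
by apply: box_eq; rewrite ?h1 ?h2 zT //= prednK.
Qed.

Lemma delete_add : delete_column (add_column T) = T.
Proof.
apply/ffunP => y; have [h1 h2] := add_column_after T y.
by apply: box_eq; rewrite ffunE /= val_insubd ?h1 ?h2 ltn_ord.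
Qed.

End Add.

Lemma delete_boxes (T U : filling m) :
  canonical_tab B T -> full_column T -> canonical_tab B U -> full_column U ->
  (boxes (delete_column T) == boxes (delete_column U)) = (boxes T == boxes U).
Proof.
have sub (X Y : filling m) : canonical_tab B X -> full_column X ->
    canonical_tab B Y -> full_column Y -> boxes X = boxes Y ->
    forall p, p \in boxes (delete_column X) -> p \in boxes (delete_column Y).
  move=> Xc Xf Yc Yf e p /imsetP[y _ ->].
  have := mem_boxes X (skip_ord y); rewrite e => /imsetP[z _ zE].
  have [y' zy] : exists y', z = skip_ord y'.
    by apply: (col_gt0_skip Yf); rewrite -zE skip_col_gt0.
  apply/imsetP; exists y' => //.
  have [h1 h2] := delete_columnE Xc Xf y; have [h3 h4] := delete_columnE Yc Yf y'.
  by apply: box_eq; rewrite ?h1 ?h2 ?h3 ?h4 zE zy.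
have bus (X Y : filling m) : canonical_tab B X -> full_column X ->
    canonical_tab B Y -> full_column Y -> boxes (delete_column X) = boxes (delete_column Y) ->
    forall p, p \in boxes X -> p \in boxes Y.
  move=> Xc Xf Yc Yf e p /imsetP[x _ ->]; case: (entryP x) => [ex|y ->].
    have -> : X x = Y x; last exact: mem_boxes.
    have [h1 h2] := full_columnP _ Xf x ex; have [h3 h4] := full_columnP _ Yf x ex.
    by apply: box_eq; rewrite ?h1 ?h2 ?h3 ?h4.
  have := mem_boxes (delete_column X) y; rewrite e => /imsetP[z _ zE].
  have -> : X (skip_ord y) = Y (skip_ord z); last exact: mem_boxes.
  have [h1 h2] := delete_columnE Xc Xf y; have [h3 h4] := delete_columnE Yc Yf z.
  apply: box_eq; first by rewrite -h1 -h3 zE.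
  have : ((delete_column X y).2 = (delete_column Y z).2 :> nat) by rewrite zE.
  by rewrite h2 h4; have := skip_col_gt0 Xc y; have := skip_col_gt0 Yc z; lia.
move=> Tc Tf Uc Uf; apply/eqP/eqP => e; apply/setP => p; apply/idP/idP.
- exact: bus.
- exact/bus/esym.
- exact: sub.
- exact/sub/esym.
Qed.

End FirstColumn.

(** * Partitions and dominance *)

Section PartitionShapes.
Variable m : nat.
Implicit Types (la : seq nat) (T : filling m).

Definition diagram la : {set 'I_m * 'I_m} :=
  [set p : 'I_m * 'I_m | (p.2 < nth 0 la p.1)%N].

Lemma partition_decreasing la r s : is_partition m la -> (r <= s)%N ->
  (nth 0 la s <= nth 0 la r)%N.
Proof.
case/and3P=> sl _ _ rs; have [ss|ss] := ltnP s (size la); last by rewrite nth_default.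
have tr : transitive geq by move=> a b c ab bc; apply: leq_trans bc ab.
by apply: (sorted_leq_nth tr (fun=> leqnn _) 0 sl) => //; rewrite inE; lia.
Qed.

Lemma sum_nth_take la i : (\sum_(r < i) nth 0 la r)%N = sumn (take i la).
Proof.
elim: i la => [|i IH] [|a la]; rewrite ?big_ord0 //.
  by rewrite big1 // => r _; rewrite nth_nil.
by rewrite big_ord_recl /= -IH; congr (_ + _).
Qed.

Lemma sumn_take_le la i : (sumn (take i la) <= sumn la)%N.
Proof. by rewrite -{2}(cat_take_drop i la) sumn_cat leq_addr. Qed.

Lemma card_row (b : 'I_m * 'I_m -> bool) : #|[set p | b p]| =
  (\sum_(r < m) #|[set c | b (r, c)]|)%N.
Proof.
under eq_bigr => r _ do rewrite -sum1_card.
rewrite pair_big_dep -sum1_card /=.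
by apply: eq_bigl => -[r c]; rewrite !inE.
Qed.

Lemma card_diagram la : (#|diagram la| <= sumn la)%N.
Proof.
rewrite card_row; apply: leq_trans (sumn_take_le la m); rewrite -sum_nth_take.
apply: leq_sum => r _; rewrite -[X in (_ <= X)%N](size_iota 0) cardE.
rewrite -(size_map val); apply: uniq_leq_size.
  by rewrite map_inj_uniq ?enum_uniq //; apply: val_inj.
by move=> _ /mapP[c + ->]; rewrite mem_enum inE mem_iota.
Qed.

(** An increasing injective filling of the diagram of la is onto, as both have m
    elements. *)
Lemma stdtabE la T : is_partition m la ->
  is_stdtab la T = standard T && (boxes T == diagram la).
Proof.
move=> laP; have dec := partition_decreasing laP.
apply/and4P/andP => [[/injectiveP Ti /forallP inb rows cols]|[Ts /eqP bT]].
  have sub : boxes T \subset diagram la.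
    by apply/fintype.subsetP => p /imsetP[x _ ->]; rewrite inE inb.
  have bT : boxes T = diagram la.
    apply/eqP; rewrite eqEcard sub /=; apply: leq_trans (card_diagram la) _.
    by rewrite card_imset // card_ord; case/and3P: laP => _ _ /eqP->.
  rewrite bT; split=> //; apply/standardP; split=> // x p /andP[p1 p2].
  have inT (r : 'I_m * 'I_m) : (r.1 <= (T x).1)%N -> (r.2 <= (T x).2)%N -> exists y, T y = r.
    move=> r1 r2; have : r \in boxes T.
      rewrite bT inE; apply: leq_ltn_trans r2 _.
      by apply: leq_trans (inb x) (dec _ _ r1).
    by case/imsetP=> y _ ->; exists y.
  have [y yp] := inT p p1 p2; have [z zp] := inT (p.1, (T x).2) p1 (leqnn _).
  exists y => //; apply: (@leq_trans z).
    have [e|ne] := eqVneq p.2 (T x).2.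
      by have -> : y = z by apply: Ti; rewrite yp zp -e -surjective_pairing.
    have /forallP/(_ z)/implyP := (forallP rows) y; rewrite yp zp /= eqxx /=.
    by rewrite ltn_neqAle ne p2 => /(_ isT)/ltnW.
  have [e|ne] := eqVneq p.1 (T x).1.
    by have -> : z = x by apply: Ti; rewrite zp e -surjective_pairing.
  have /forallP/(_ x)/implyP := (forallP cols) z; rewrite zp /= eqxx /=.
  by rewrite ltn_neqAle ne p1 => /(_ isT)/ltnW.
have Ti := standard_inj Ts; split.
- exact/injectiveP.
- by apply/forallP => x; have := mem_boxes T x; rewrite bT inE.
- apply/forallP => x; apply/forallP => y; apply/implyP => /andP[/eqP e lt].
  rewrite ltn_neqAle (@standard_le _ T) ?andbT //; last by rewrite /le_box e leqnn ltnW.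
  by apply: contraTneq lt => /val_inj->; rewrite ltnn.
- apply/forallP => x; apply/forallP => y; apply/implyP => /andP[/eqP e lt].
  rewrite ltn_neqAle (@standard_le _ T) ?andbT //; last by rewrite /le_box e leqnn ltnW.
  by apply: contraTneq lt => /val_inj->; rewrite ltnn.
Qed.

Lemma down_closed_card (D : {set 'I_m}) :
  (forall c d : 'I_m, (c <= d)%N -> d \in D -> c \in D) ->
  forall c, (c \in D) = (c < #|D|)%N.
Proof.
move=> h c; apply/idP/idP => [cD|lt].
  have <- : #|[set d : 'I_m | (d < c.+1)%N]| = c.+1.
    rewrite -[RHS](size_iota 0) cardE -(size_map val); apply/perm_size/uniq_perm.
    - by rewrite map_inj_uniq ?enum_uniq //; apply: val_inj.
    - exact: iota_uniq.
    move=> x; rewrite mem_iota; apply/mapP/idP => [[d + ->]|lt]; first by rewrite mem_enum inE.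
    have xm : (x < m)%N by apply: leq_ltn_trans (ltn_ord c).
    by exists (Ordinal xm) => //; rewrite mem_enum inE.
  by apply/subset_leq_card/fintype.subsetP => d; rewrite inE ltnS => dc; apply: h cD.
apply/contraT => cD; move: lt; rewrite ltnNge => /negP[].
rewrite -[leqRHS](size_iota 0) cardE -(size_map val); apply: uniq_leq_size.
  by rewrite map_inj_uniq ?enum_uniq //; apply: val_inj.
move=> _ /mapP[d + ->]; rewrite mem_enum mem_iota /= add0n => dD.
by rewrite ltnNge; apply: contra cD => cd; apply: h dD.
Qed.

Lemma nth_filter_pos (s : seq nat) r : sorted geq s ->
  nth 0 (filter (ltn 0) s) r = nth 0 s r.
Proof.
have tr : transitive geq by move=> a b c ab bc; apply: leq_trans bc ab.
elim: s r => // a s IH r sa; have ss : sorted geq s := path_sorted sa.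
case: a sa => [|a] sa; last by case: r => //= r; apply: IH.
have s0 i : nth 0 s i = 0.
  have [lt|ge] := ltnP i (size s); last by rewrite nth_default.
  apply/eqP; rewrite -leqn0; have /allP h := order_path_min tr sa.
  exact: h (mem_nth 0%N lt).
by rewrite /= IH // s0; case: r => //= r; rewrite s0.
Qed.

Lemma standard_diagram T : standard T ->
  exists la, is_partition m la /\ diagram la = boxes T.
Proof.
move=> Ts; have /standardP[Ti h] := Ts.
have down (p r : 'I_m * 'I_m) : le_box p r -> r \in boxes T -> p \in boxes T.
  by move=> pr /imsetP[x _ e]; move: pr; rewrite e => /h[y _ <-]; apply: mem_boxes.
pose D (r : 'I_m) := [set c | (r, c) \in boxes T].
pose s := [seq #|D r| | r <- enum 'I_m].
have ss : size s = m by rewrite size_map size_enum_ord.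
have sE (r : 'I_m) : nth 0 s r = #|D r|.
  by rewrite (nth_map r) ?size_enum_ord // nth_ord_enum.
have sd : sorted geq s.
  apply/(sortedP 0%N) => i; rewrite ss => im.
  rewrite (sE (Ordinal im)) (sE (Ordinal (ltnW im))) /=.
  apply/subset_leq_card/fintype.subsetP => c; rewrite !inE; apply: down.
  by rewrite /le_box /= leqnSn /=.
exists (filter (ltn 0) s); split.
  apply/and3P; split.
  - by apply: sorted_filter => // a b c ab bc; apply: leq_trans bc ab.
  - by rewrite mem_filter.
  have -> : sumn (filter (ltn 0) s) = sumn s.
    by elim: (s) => //= -[|a] t IH //=; rewrite IH.
  rewrite sumnE big_map big_enum /= -card_row.
  have -> : [set p | p \in boxes T] = boxes T by apply/setP => p; rewrite inE.
  by rewrite card_imset // card_ord.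
apply/setP => -[r c]; rewrite inE /= nth_filter_pos // sE -down_closed_card ?inE //.
by move=> c1 c2 c12; rewrite !inE; apply: down; rewrite /le_box /= leqnn.
Qed.

End PartitionShapes.

Section Dominance.
Variables (kk : nat -> nat) (n : nat).
Local Notation m := (fused_size kk n).

Lemma card_blocks (J : seq nat) : uniq J -> {subset J <= iota 0 n} ->
  #|[set x : 'I_m | block kk n x \in J]| = sumn (map kk J).
Proof.
elim: J => [|b J IH] /=; first by move=> _ _; apply: eq_card0 => x; rewrite inE.
case/andP=> bJ uJ sub.
have bn : (b < n)%N by have := sub b (mem_head _ _); rewrite mem_iota.
have -> : [set x : 'I_m | block kk n x \in b :: J] =
    [set x : 'I_m | block kk n x == b] :|: [set x : 'I_m | block kk n x \in J].
  by apply/setP => x; rewrite !inE.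
rewrite cardsU disjoint_setI0 ?cards0 ?subn0; last first.
  rewrite -setI_eq0; apply/eqP/setP => x; rewrite !inE.
  by apply/andP => -[/eqP-> bJ']; rewrite bJ' in bJ.
rewrite IH => [||c cJ]; [|by []|by apply: sub; rewrite inE cJ orbT].
congr (_ + _)%N.
have om c : (c < kk b)%N -> (offset kk b + c < m)%N.
  move=> cb; apply: (@leq_trans (offset kk b.+1)); last exact: offset_le.
  by rewrite offsetS ltn_add2l.
rewrite -[RHS](size_iota (offset kk b)) cardE -(size_map val).
apply/perm_size/uniq_perm; [|exact: iota_uniq|].
  by rewrite map_inj_uniq ?enum_uniq //; apply: val_inj.
move=> x; rewrite mem_iota -offsetS; apply/mapP/idP => [[y + ->]|xb].
  rewrite mem_enum inE => /eqP <-.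
  by have [_] := block_bounds (ltn_ord y).
have xm : (x < m)%N by case/andP: xb => _ h; apply: leq_trans h _; apply: offset_le.
by exists (Ordinal xm) => //; rewrite mem_enum inE /= (blockE bn xb).
Qed.

Variables (T : filling m).
Hypothesis Tc : canonical_tab (fun x : 'I_m => block kk n x) T.

(** The entries of i blocks fill at most i boxes of each column, so pushing them up
    in their columns leaves them in the first i rows. *)
Lemma card_blocks_le_rows (J : seq nat) :
  (#|[set x : 'I_m | block kk n x \in J]| <= #|[set x | (T x).1 < size J]|)%N.
Proof.
have Ts := canonical_standard Tc; have /standardP[Ti h] := Ts.
have [_ hc] := canonicalP _ _ Tc.
pose above (x : 'I_m) := [set y : 'I_m | (block kk n y \in J) &&
  ((T y).2 == (T x).2) && ((T y).1 < (T x).1)%N].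
have above_le x : (#|above x| <= (T x).1)%N.
  rewrite -[leqRHS](size_iota 0) cardE.
  rewrite -(size_map (fun y => nat_of_ord (T y).1)); apply: uniq_leq_size.
    rewrite map_inj_in_uniq ?enum_uniq // => a b; rewrite !mem_enum !inE.
    move=> /andP[/andP[_ /eqP ca] _] /andP[/andP[_ /eqP cb] _] e.
    by apply/Ti/box_eq => //; rewrite ca cb.
  by move=> _ /mapP[y + ->]; rewrite mem_enum !inE mem_iota => /andP[_ ->].
have up x : exists z, (T z).1 = #|above x| :> nat /\ (T z).2 = (T x).2.
  have rm : (#|above x| < m)%N by apply: leq_ltn_trans (above_le x) (ltn_ord _).
  have [|z _ zT] := h x (Ordinal rm, (T x).2); first by rewrite /le_box /= above_le /=.
  by exists z; rewrite zT.
have [g gP] := choice up.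
rewrite -(card_in_imset (f := g)); last first.
  move=> x y; rewrite !inE => xJ yJ e.
  have [gx1 gx2] := gP x; have [gy1 gy2] := gP y.
  have col : (T x).2 = (T y).2 by rewrite -gx2 -gy2 e.
  have card : #|above x| = #|above y| by rewrite -gx1 -gy1 e.
  have strict a b : (T a).2 = (T b).2 -> block kk n a \in J -> ((T a).1 < (T b).1)%N ->
      (#|above a| < #|above b|)%N.
    move=> cab aJ lt; apply/proper_card/properP; split.
      apply/fintype.subsetP => z; rewrite !inE cab => /andP[-> /= lt'].
      exact: ltn_trans lt' lt.
    by exists a; rewrite !inE ?aJ ?cab ?eqxx ?lt ?ltnn.
  apply/Ti/box_eq; last by rewrite col.
  case: (ltngtP (T x).1 (T y).1) => // lt.
    by have := strict _ _ col xJ lt; rewrite card ltnn.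
  by have := strict _ _ (esym col) yJ lt; rewrite card ltnn.
apply/subset_leq_card/fintype.subsetP => _ /imsetP[x + ->]; rewrite !inE => xJ.
have [-> _] := gP x.
have -> : #|above x| = #|above x :|: [set x]|.-1.
  rewrite finset.setUC cardsU1; suff -> : x \notin above x by [].
  by rewrite !inE ltnn andbF.
have inJ y : y \in above x :|: [set x] -> block kk n y \in J /\ (T y).2 = (T x).2.
  by rewrite !inE => /orP[/andP[/andP[-> /eqP]]|/eqP->].
have le : (#|above x :|: [set x]| <= size J)%N.
  rewrite cardE -(size_map (fun y : 'I_m => block kk n y)); apply: uniq_leq_size.
    rewrite map_inj_in_uniq ?enum_uniq // => a b; rewrite !mem_enum.
    move=> /inJ[_ ca] /inJ[_ cb] e; have cab : (T a).2 = (T b).2 by rewrite ca cb.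
    apply: val_inj; case: (ltngtP a b) => // lt.
      by have := hc _ _ lt e; rewrite cab ltnn.
    by have := hc _ _ lt (esym e); rewrite cab ltnn.
  by move=> _ /mapP[y + ->]; rewrite mem_enum => /inJ[].
rewrite prednK //; apply/card_gt0P; exists x.
by rewrite finset.in_setU finset.set11 orbT.
Qed.

Lemma canonical_dominates la : is_partition m la -> diagram m la = boxes T ->
  dominates la (sort geq (mkseq kk n)).
Proof.
move=> laP bT i; have Ts := canonical_standard Tc.
rewrite /mkseq sort_map -map_take; set J := take i _.
have sJ : (size J <= i)%N by rewrite size_take; case: ltnP.
have uJ : uniq J by apply: take_uniq; rewrite sort_uniq iota_uniq.
have subJ : {subset J <= iota 0 n}.
  by move=> x /mem_take; rewrite mem_sort.
rewrite -card_blocks //; apply: leq_trans (card_blocks_le_rows J) _.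
rewrite -sum_nth_take.
pose D := [set p : 'I_m * 'I_m | (p \in boxes T) && (p.1 < i)%N].
apply: (@leq_trans #|D|).
  rewrite -(card_imset _ (standard_inj Ts)).
  apply/subset_leq_card/fintype.subsetP => _ /imsetP[x + ->]; rewrite !inE.
  by move=> lt; rewrite mem_boxes (leq_trans lt).
rewrite /D card_row; have row r : (#|[set c | ((r, c) \in boxes T) && ((r, c).1 < i)%N]|
    <= if (r < i)%N then nth 0%N la r else 0%N)%N.
  case: ltnP => ri; last by rewrite leqn0 cards_eq0; apply/eqP/setP => c; rewrite !inE /= andbF.
  rewrite -[leqRHS](size_iota 0) cardE -(size_map val); apply: uniq_leq_size.
    by rewrite map_inj_uniq ?enum_uniq //; apply: val_inj.
  by move=> _ /mapP[c + ->]; rewrite mem_enum !inE /= -bT inE mem_iota => /andP[].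
apply: (@leq_trans (\sum_(r < m) (if (r < i)%N then nth 0%N la r else 0%N))%N).
  by apply: leq_sum => r _; apply: row.
rewrite -(big_mkord xpredT (fun r => if (r < i)%N then nth 0%N la r else 0%N)).
rewrite -(big_mkord xpredT (fun r => nth 0%N la r)).
have -> : (\sum_(0 <= r < m) (if (r < i)%N then nth 0%N la r else 0%N) =
  \sum_(0 <= r < minn i m) nth 0%N la r)%N.
  rewrite (big_cat_nat (n := minn i m)) ?geq_minr //=.
  rewrite [X in (_ + X)%N]big_nat_cond [X in (_ + X)%N]big1 ?addn0 => [|r /andP[/andP[h1 h2] _]].
    rewrite big_nat_cond [RHS]big_nat_cond; apply: eq_bigr => r /andP[/andP[_ h] _].
    by rewrite (leq_trans h (geq_minl _ _)).
  by case: ltnP => // ri; move: h1; rewrite geq_min leqNgt ri leqNgt h2.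
rewrite [leqRHS](big_cat_nat (n := minn i m)) ?geq_minl //=; exact: leq_addr.
Qed.

End Dominance.

(** * The seminormal modules and the theorem *)

Section SeminormalLink.
Variables (F : fieldType) (q : F) (m : nat) (la : seq nat).
Hypothesis q0 : q != 0.
Hypothesis qint_neq0 : forall n, (0 < n)%N -> qint q n%:Z != 0.
Hypothesis laP : is_partition m la.

(** The embedding of V_la in the functions on all fillings. *)
Definition extend (v : Vla F m la) : tabmod F m :=
  [ffun T => if insub T : option (stdtab m la) is Some U then v U else 0].

Lemma extendE v (U : stdtab m la) : extend v (val U) = v U.
Proof. by rewrite ffunE valK. Qed.

Lemma extend0 v T : ~~ is_stdtab la T -> extend v T = 0.
Proof. by move=> nT; rewrite ffunE insubN. Qed.

Lemma extend_linear c v w : extend (c *: v + w) = c *: extend v + extend w.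
Proof.
apply/ffunP => T; rewrite [RHS]ffunE tab_scaleE.
case: (boolP (is_stdtab la T)) => [sT|nT]; last by rewrite !extend0 // mulr0 addr0.
by rewrite -[T]/(val (Sub T sT : stdtab m la)) !extendE !ffunE.
Qed.

Lemma extendD v w : extend (v + w) = extend v + extend w.
Proof. by have := extend_linear 1 v w; rewrite !scale1r. Qed.

Lemma extendZ c v : extend (c *: v) = c *: extend v.
Proof.
have e0 : extend 0 = 0.
  by have := extend_linear (-1) 0 0; rewrite scaler0 addr0 scaleN1r addNr.
by have := extend_linear c v 0; rewrite e0 !addr0.
Qed.

Lemma extend_inj : injective extend.
Proof. by move=> v w vw; apply/ffunP => U; rewrite -!extendE vw. Qed.

Lemma extend_surj (u : tabmod F m) : (forall T, ~~ is_stdtab la T -> u T = 0) ->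
  exists v, extend v = u.
Proof.
move=> u0; exists [ffun U : stdtab m la => u (val U)]; apply/ffunP => T.
case: (boolP (is_stdtab la T)) => [sT|nT]; last by rewrite extend0 // u0.
by rewrite -[T]/(val (Sub T sT : stdtab m la)) extendE ffunE.
Qed.

Lemma stdtab_swap (T : filling m) i : is_stdtab la T ->
  is_stdtab la (swap_tab T i) = standard (swap_tab T i).
Proof. by rewrite !stdtabE // boxes_swap => /andP[_ ->]; rewrite andbT. Qed.

Lemma extend_seminormal i v : extend (seminormal q i v) = tab_op q i (extend v).
Proof.
apply/ffunP => T; case: (boolP (is_stdtab la T)) => [sT|nT]; last first.
  rewrite extend0 //; case: (boolP (standard T)) => Ts; last first.
    by rewrite tab_op_nonstd // extend0 // mulr0.
  rewrite tab_opE // extend0 // [extend v (swap_tab T i)]extend0 ?mulr0.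
    by rewrite /dl !mulr0 addr0.
  move: nT; rewrite !stdtabE // boxes_swap Ts /=; apply: contra; by case/andP.
have Ts : standard T by move: sT; rewrite stdtabE // => /andP[].
have axE S : standard S -> axial q S i = acoef q (axdist S i).
  by move=> Ss; apply: acoefE => //; apply: axdist_neq0.
pose W : stdtab m la := Sub T sT.
have EW u : extend u T = u W by rewrite -(extendE u W).
rewrite EW tab_opE // EW.
rewrite /seminormal sum_ffunE.
transitivity (\sum_U v U * (axial q (val U) i * (val W == val U)%:R
   + (q^-1 + axial q (val U) i) * (val W == swap_tab (val U) i)%:R)).
  by apply: eq_bigr => U _; rewrite !ffunE.
under eq_bigr => U _ do rewrite mulrDr.
rewrite big_split /=; congr (_ + _).
  rewrite (bigD1 W) //= eqxx mulr1 big1 ?addr0 => [|U /negbTE UW].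
    by rewrite axE // mulrC.
  by rewrite -[T]/(val W) (inj_eq val_inj) eq_sym UW !mulr0.
case: (boolP (standard (swap_tab T i))) => st; last first.
  rewrite mul0r mulr0; apply: big1 => U _; case: eqP => [e|_]; last by rewrite !mulr0.
  have := valP U; rewrite stdtabE // => /andP[Us _].
  by move: st; rewrite e swap_tabK Us.
have sW : is_stdtab la (swap_tab T i) by rewrite stdtab_swap.
pose W' : stdtab m la := Sub (swap_tab T i) sW.
have -> : extend v (swap_tab T i) = v W' by rewrite -(extendE v W').
rewrite mul1r (bigD1 W') //=.
rewrite swap_tabK eqxx mulr1 big1 ?addr0 => [|U /negbTE UW].
  by rewrite axE // axdist_swap acoefN ?axdist_neq0 // mulrC /kappa; congr (_ * _); ring.
case: eqP => [e|_]; last by rewrite !mulr0.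
by move: UW; rewrite -(inj_eq val_inj) /= e swap_tabK eqxx.
Qed.

Lemma extend_act (x : hecke q m) v : extend (Vact x v) = tab_act x (extend v).
Proof.
rewrite /Vact /tab_act /hecke_act.
elim: (repr x) v => /= [i|c|t IHt u IHu|t IHt u IHu] v.
- exact: extend_seminormal.
- exact: extendZ.
- by rewrite extendD IHt IHu.
- by rewrite IHt IHu.
Qed.

End SeminormalLink.

Section FusedBlocks.
Variables (F : fieldType) (q : F).
Hypothesis q0 : q != 0.
Hypothesis qint_neq0 : forall n, (0 < n)%N -> qint q n%:Z != 0.
Variables (k : nat -> nat) (n : nat).
Hypothesis k_gt0 : forall i, (0 < k i)%N.

Local Notation m := (fused_size k n).
Local Notation B := (fun x : 'I_m => block k n x).

Lemma size_le_sumn la : 0%N \notin la -> (size la <= sumn la)%N.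
Proof.
elim: la => //= a la IH; rewrite inE negb_or eq_sym -lt0n => /andP[a0 /IH].
by move=> h; rewrite -add1n leq_add.
Qed.

(** The entries of the first column lie in distinct blocks, at most one in each of the
    n blocks. With n rows every block is met, necessarily at its first entry, and in
    increasing order. *)
Lemma full_column_size la (T : filling m) : canonical_tab B T ->
  is_partition m la -> diagram m la = boxes T -> (size la == n) = full_column T.
Proof.
move=> Tc laP bT; have Ts := canonical_standard Tc; have [_ hc] := canonicalP _ _ Tc.
have [_ la0 /eqP la_sum] := and3P laP.
have first (r : nat) : (r < size la)%N ->
    exists x : 'I_m, (T x).1 = r :> nat /\ (T x).2 = 0%N :> nat.
  move=> lt; have rm : (r < m)%N.
    by apply: leq_trans lt _; rewrite -la_sum size_le_sumn.
  have m0 : (0 < m)%N by apply: leq_ltn_trans rm.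
  have : (Ordinal rm, Ordinal m0) \in boxes T.
    by rewrite -bT inE /= lt0n; apply: contraNneq la0 => <-; apply: mem_nth.
  by case/imsetP=> x _ e; exists x; rewrite -e.
apply/eqP/full_columnP => [sla x ex|full].
  have le d : forall r z, (r + d.+1)%N = n -> (T z).1 = r :> nat -> (T z).2 = 0%N :> nat ->
      (block k n z <= r)%N.
    elim: d => [|d IH] r z rd z1 z2.
      by have [+ _] := block_bounds (ltn_ord z); move: rd; lia.
    have [|y [y1 y2]] := first r.+1; first by rewrite sla -rd; lia.
    have ym : (block k n y <= r.+1)%N by apply: (IH r.+1 y _ y1 y2); rewrite addSnnS.
    rewrite -ltnS; apply: leq_trans ym.
    have zy : (z <= y)%N by apply: (standard_le Ts); rewrite /le_box z1 y1 z2 y2 leqnSn.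
    have ne : z != y by apply/eqP => e; move: z1; rewrite e y1; lia.
    rewrite ltn_neqAle block_homo // andbT; apply/eqP => e.
    by have := hc z y; rewrite ltn_neqAle ne zy => /(_ isT e); rewrite z2 y2.
  have [bn /andP[bx _]] := block_bounds (ltn_ord x).
  have [|z [z1 z2]] := first (block k n x); first by rewrite sla.
  have bz : block k n z = block k n x.
    apply/eqP; rewrite eqn_leq (le (n - (block k n x).+1)%N) //; last by lia.
    by rewrite -z1 canonical_row_le_block.
  suff -> : x = z by rewrite bz.
  apply/eqP; rewrite -val_eqE eqn_leq /= {1}ex -{1}bz.
  have [_ /andP[-> _]] := block_bounds (ltn_ord z).
  rewrite leqNgt; apply/negP => lt.
  by have := hc _ _ lt (esym bz); rewrite z2.
apply/eqP; rewrite eqn_leq; apply/andP; split.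
  rewrite leqNgt; apply/negP => /first[y [y1 _]].
  have := canonical_row_le_block y Tc; rewrite y1; have [bn _] := block_bounds (ltn_ord y).
  by rewrite leqNgt bn.
case: (posnP n) => [->//|n0]; have bn : (n.-1 < n)%N by lia.
have [om ob] := block_offset k_gt0 bn.
have [|h1 h2] := full (Ordinal om); first by rewrite /= ob.
have : T (Ordinal om) \in diagram m la by rewrite bT mem_boxes.
rewrite inE h1 h2 /= ob => lt; rewrite -(prednK n0) ltnNge; apply/negP => le.
by rewrite nth_default in lt.
Qed.

Local Notation e := (fusedP q k n).

Lemma block_homo_ord : {homo B : x y / (x <= y)%N}.
Proof. by move=> x y; apply: block_homo. Qed.

Lemma fused_corner x : fused q k n x <-> corner e x.
Proof. by split=> [[z _ <-]|[z <-]]; exists z. Qed.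

Lemma fused_eigen (i : 'I_m.-1) : B (gen_lo i) = B (gen_hi i) -> sigma i * e = q *: e.
Proof. exact: sigma_fusedP. Qed.

Lemma fused_fixes (v : tabmod F m) : q_invariant q B v -> tab_act e v = v.
Proof. exact: fusedP_fixes. Qed.

Lemma fused_model : matrix_model (fused q k n) (canonical_tab B)
  (fun T U => boxes T == boxes U) (entry (q := q) B).
Proof.
have -> : fused q k n = [set x | corner e x /\ forall T U, canonical_tab B T ->
    canonical_tab B U -> ~~ canonical_tab B U -> entry B x T U = 0]%classic.
  apply/seteqP; split=> x /=; last by case=> /fused_corner.
  by move=> /fused_corner h; split=> // T U _ Uc; rewrite Uc.
exact: (corner_model q0 qint_neq0 block_homo_ord fused_eigen fused_fixes).
Qed.

Local Notation full T := (canonical_tab B T && full_column T).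

Lemma full_shape (T U : filling m) :
  canonical_tab B T -> full U -> boxes T = boxes U -> full T.
Proof.
move=> Tc /andP[Uc Uf] TU; rewrite Tc /=.
have [la [laP bU]] := standard_diagram (canonical_standard Uc).
rewrite -(full_column_size Tc laP); last by rewrite bU TU.
by rewrite (full_column_size Uc laP).
Qed.

Local Notation Gamma := [set la | fused_parts k n la /\ size la = n]%classic.

(** Only the modules in S_(k,n) with fewer than n rows have to be tested, since
    canonical tableaux only exist for the shapes in S_(k,n). *)
Lemma fused_blockE : fused_block q k n Gamma =
  [set x | corner e x /\ forall T U, canonical_tab B T -> canonical_tab B U ->
     ~~ full U -> entry B x T U = 0]%classic.
Proof.
have cls := @class_vector_invariant F q m q0 B.
apply/seteqP; split=> x /= [/fused_corner xc hx].
  split=> // T U Tc Uc; rewrite Uc /= => nf.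
  have Ts := canonical_standard Tc; have Us := canonical_standard Uc.
  have [TU|ne] := eqVneq (boxes T) (boxes U); last exact: entry_boxes.
  have [la [laP bU]] := standard_diagram Us.
  have laS : fused_parts k n la.
    by split=> //; apply: canonical_dominates Uc _ laP bU.
  have nG : ~ (fused_parts k n la /\ size la = n).
    by case=> _ /eqP; rewrite (full_column_size Uc laP bU) (negbTE nf).
  have [w wE] : exists w : Vla F m la, extend w = class_vector F B U.
    apply: (@extend_surj F m la) => V; rewrite stdtabE // negb_and => /orP[nV|nV].
      by rewrite ffunE /in_class (negbTE nV).
    by apply: class_vector_boxes; rewrite -bU.
  have Ww : Wla q w.
    exists w => //; apply: (@extend_inj F m la); rewrite (extend_act q0) // wE.
    exact/fused_fixes/cls.
  have := hx la laS nG w Ww => /(congr1 (@extend F m la)).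
  rewrite (extend_act q0) // wE => /(congr1 (fun v : tabmod F m => v T)).
  rewrite -/(entry B x T U) => ->.
  by have := extendZ (0 : F) (0 : Vla F m la); rewrite scale0r => ->; rewrite tab_scaleE mul0r.
split; [exact: xc | move: xc => /fused_corner xc].
move=> la laS nG w [w' _ wE]; have [laP _] := laS.
have wi : q_invariant q B (extend w).
  by rewrite -wE (extend_act q0) //; apply: (corner_invariant q0 qint_neq0 fused_eigen).
have nf U : canonical_tab B U -> is_stdtab la U -> ~~ full U.
  move=> Uc; rewrite stdtabE // => /andP[_ /eqP bU]; rewrite Uc /=.
  by rewrite -(full_column_size Uc laP) //; apply/eqP => sla; apply: nG.
have u0 := invariant_canonical q0 qint_neq0 block_homo_ord
  (corner_act q0 qint_neq0 fused_eigen fused_fixes (extend w) xc).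
apply: (@extend_inj F m la); apply/ffunP => T.
case: (boolP (is_stdtab la T)) => sT; last by rewrite !extend0.
have Ts : standard T by move: sT; rewrite stdtabE // => /andP[].
rewrite (extend_act q0) // u0 // => [|S Sc].
  by rewrite -[T]/(val (Sub T sT : stdtab m la)) extendE ffunE.
rewrite (tab_act_expand q0 qint_neq0 block_homo_ord) //; last exact: canonical_standard Sc.
apply: big1 => U Uc; case: (boolP (is_stdtab la U)) => [sU|nU].
  by rewrite hx ?mulr0 // nf.
by rewrite extend0 // mul0r.
Qed.

Lemma fused_block_model : matrix_model (fused_block q k n Gamma)
  (fun T => full T) (fun T U => boxes T == boxes U) (entry (q := q) B).
Proof.
rewrite fused_blockE.
apply: (@corner_model F q m q0 qint_neq0 B block_homo_ord e fused_eigen fused_fixes).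
  by move=> T /andP[].
exact: full_shape.
Qed.

End FusedBlocks.

Theorem proposition7p1 (R : realType) (q : R[i]) (hq0 : q != 0)
    (hq : forall r : nat, (0 < r)%N -> (q ^+ 2) ^+ r = 1 -> q ^+ 2 = 1)
    (k : nat -> nat) (hk : forall i, (0 < k i)%N) (n : nat) :
  subalg_iso
    (fused_block q k n [set la | fused_parts k n la /\ size la = n]%classic)
    (fused q (fun i => (k i).-1) n).
Proof.
(* If q^2 is not 1, it is no root of unity, so that gam j is non-zero; if q^2 = 1,
     [j]_q is j up to sign. *)
have qint_neq0 j : (0 < j)%N -> qint q j%:Z != 0.
  move=> j0; have [q2|q2] := eqVneq (q ^+ 2) 1; last first.
    apply: contra_neq q2 => z; apply: (hq j) => //; rewrite -exprM.
    by rewrite -kappa_gamn // -gam_nat // /gam z mulr0 mulr0 addr0.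
  have -> : qint q j%:Z = q ^ (j%:Z - 1) * j%:R.
    transitivity (\sum_(i < j) q ^ (j%:Z - 1)); last first.
      by rewrite sumr_const card_ord mulr_natr.
    rewrite /qint gtr0_sgz // mulr1z mul1r; apply: eq_bigr => i _.
    have -> : j%:Z - 1 - 2 * i%:Z = (j%:Z - 1) + 2 * (- i%:Z) by lia.
    by rewrite expfzDr // -exprz_exp -exprnP q2 exp1rz mulr1.
  by rewrite mulf_neq0 ?expfz_neq0 // Num.Theory.pnatr_eq0 -lt0n.
have mB := fused_model hq0 qint_neq0 (fun i => (k i).-1) n.
have mA := fused_block_model hq0 qint_neq0 n hk.
apply: (matrix_model_iso (b := @delete_column k n hk) (b' := @add_column k n hk) mA mB).
- by move=> T /andP[]; apply: delete_canonical.
- by move=> T Tc; rewrite add_canonical // add_full.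
- by move=> T /andP[Tc Tf]; apply: add_delete.
- by move=> T Tc; apply: delete_add.
- by move=> T U /andP[Tc Tf] /andP[Uc Uf]; apply: delete_boxes.
Qed.
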